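(* Let $(\mathbf{x}_i^T,y_i)$, $i=1,2,\dots$, be i.i.d. with $y_i=\mathbf{x}_i^T\boldsymbol\beta_0+u_i$, where $\mathbf{x}_i\in\mathbb{R}^p$ has distribution $G_0$, $u_i$ has distribution $F_0$, $u_i$ is independent of $\mathbf{x}_i$, and $\boldsymbol\beta_0=(\boldsymbol\beta_{0,I},\boldsymbol\beta_{0,II})$ with $\boldsymbol\beta_{0,I}\in\mathbb{R}^s$ having all coordinates non-zero and $\boldsymbol\beta_{0,II}=\mathbf{0}_{p-s}\in\mathbb{R}^{p-s}$. Let $\rho_0,\rho_1$ be bounded $\rho$-functions with $\rho_1\le\rho_0$, and let $0<b<1$. Assume: [B1] $\rho_0$ and $\rho_1$ are twice continuously differentiable and eventually constant. [B2] $P_{G_0}(\mathbf{x}^T\boldsymbol\beta=0)<1-b$ for all non-zero $\boldsymbol\beta\in\mathbb{R}^p$. [B3] $F_0$ has an even continuous density $f_0$ that is a monotone decreasing function of $|u|$ and a strictly decreasing function of $|u|$ in a neighborhood of $0$. [B4] $G_0$ has finite second moments and $\mathbf{V}_{\mathbf{x}}=E_{G_0}\mathbf{x}\mathbf{x}^T$ is non-singular. Let $q,t,\varsigma>0$, let $\lambda_n,\iota_n>0$ be (deterministic) sequences, let $\hat{\boldsymbol\beta}_1$ be a consistent estimator of $\boldsymbol\beta_0$ and let $\hat{\boldsymbol\beta}_2$ be a $\sqrt n$-consistent estimator of $\boldsymbol\beta_0$. Let $\hat{\boldsymbol\beta}_B$ and $\hat{\boldsymbol\beta}_A$ be the MM-Bridge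 and adaptive MM-Bridge estimators based on the first $n$ observations, and let $\hat{\boldsymbol\beta}_{B,II}$, $\hat{\boldsymbol\beta}_{A,II}$ be the vectors of their last $p-s$ coordinates. Then, as $n\to\infty$: (i) if $q<1$, $\lambda_n=O(\sqrt n)$ and $\lambda_n/n^{q/2}\to\infty$, then $\mathbb{P}(\hat{\boldsymbol\beta}_{B,II}=\mathbf{0}_{p-s})\to1$; (ii) if $t\le1$, $\iota_n=O(\sqrt n)$ and $\iota_n n^{(\varsigma-t)/2}\to\infty$, then $\mathbb{P}(\hat{\boldsymbol\beta}_{A,II}=\mathbf{0}_{p-s})\to1$.
   Context: The dimensions $p$ and $s$ are fixed and $\|\cdot\|$ is the Euclidean norm. A bounded $\rho$-function is a function $\rho:\mathbb{R}\to[0,1]$ such that $\rho(u)$ is a nondecreasing function of $|u|$, $\rho(0)=0$, $\lim_{u\to\infty}\rho(u)=1$, and $\rho$ is strictly increasing on $\{u>0:\rho(u)<1\}$. ''Eventually constant'' means constant for all sufficiently large $|u|$. Residuals: $r_i(\boldsymbol\beta)=y_i-\mathbf{x}_i^T\boldsymbol\beta$, $\mathbf{r}(\boldsymbol\beta)=(r_1(\boldsymbol\beta),\dots,r_n(\boldsymbol\beta))$. M-estimate of scale: $s_n(\mathbf{u})=\inf\{s>0:\frac1n\sum_{i=1}^n\rho_0(u_i/s)\le b\}$. MM-Bridge estimator: $\hat{\boldsymbol\beta}_B=\arg\min_{\boldsymbol\beta\in\mathbb{R}^p}\sum_{i=1}^n\rho_1\big(r_i(\boldsymbol\beta)/s_n(\mathbf{r}(\hat{\boldsymbol\beta}_1))\big)+\lambda_n\sum_{j=1}^p|\beta_j|^q$.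 Adaptive MM-Bridge estimator: $\hat{\boldsymbol\beta}_A=\arg\min_{\boldsymbol\beta\in\mathbb{R}^p}\sum_{i=1}^n\rho_1\big(r_i(\boldsymbol\beta)/s_n(\mathbf{r}(\hat{\boldsymbol\beta}_1))\big)+\iota_n\sum_{j=1}^p|\beta_j|^t/|\hat\beta_{2,j}|^{\varsigma}$, where if $\hat\beta_{2,j}=0$ the $j$-th penalty term is $0$ when $\beta_j=0$ and $+\infty$ otherwise (so $\hat\beta_{A,j}=0$). $\arg\min$ denotes any (measurable) minimizer; the estimators may be given arbitrary values when $s_n(\mathbf{r}(\hat{\boldsymbol\beta}_1))=0$. $\hat{\boldsymbol\beta}_1,\hat{\boldsymbol\beta}_2$ are computed from the first $n$ observations; consistent means converging in probability to $\boldsymbol\beta_0$, and $\sqrt n$-consistent means $\|\hat{\boldsymbol\beta}_2-\boldsymbol\beta_0\|=O_P(1/\sqrt n)$. *)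

(* Defs.v *)
From HB Require Import structures.
From mathcomp Require Import all_boot all_order all_algebra finmap.
From mathcomp Require Import all_classical all_reals all_analysis.
Set Implicit Arguments.
Unset Strict Implicit.
Unset Printing Implicit Defensive.
Import Order.TTheory GRing.Theory Num.Theory.
Import numFieldNormedType.Exports.
Local Open Scope classical_set_scope.
Local Open Scope ring_scope.

Definition measure_rV_display : measure_display.
Proof. exact. Qed.

(* R^p carries the product sigma-algebra of the Borel sigma-algebra of R (which
   is the Borel sigma-algebra of R^p); this is the construction that the library
   uses for [n.-tuple T]. *)
Section measurable_rV.
Context {R : realType} {p : nat}.

Let coors : 'I_p -> 'rV[R]_p -> R := fun j v => v 0 j.

Let rV_set0 : g_sigma_preimage coors set0.
Proof. exact: sigma_algebra0. Qed.

Let rV_setC A : g_sigma_preimage coors A -> g_sigma_preimage coors (~` A).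
Proof. exact: sigma_algebraC. Qed.

Let rV_bigcup (F : _^nat) : (forall i, g_sigma_preimage coors (F i)) ->
  g_sigma_preimage coors (\bigcup_i (F i)).
Proof. exact: sigma_algebra_bigcup. Qed.

HB.instance Definition _ := @isMeasurable.Build measure_rV_display
  'rV[R]_p (g_sigma_preimage coors) rV_set0 rV_setC rV_bigcup.

End measurable_rV.

Section probability_notions.
Context {d : measure_display} {T : measurableType d} {R : realType}
  (P : probability T R).

Definition has_law {d'} {T' : measurableType d'} (X : T -> T')
    (mu : probability T' R) : Prop :=
  forall A, measurable A -> P (X @^-1` A) = mu A.

Definition independent2 {d1 d2} {T1 : measurableType d1}
    {T2 : measurableType d2} (X : T -> T1) (Y : T -> T2) : Prop :=
  forall A B, measurable A -> measurable B ->
    P (X @^-1` A `&` Y @^-1` B) = (P (X @^-1` A) * P (Y @^-1` B))%E.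

Definition mutually_independent {d'} {T' : measurableType d'}
    (Z : nat -> T -> T') : Prop :=
  forall (J : {fset nat}) (A : nat -> set T'), (forall i, measurable (A i)) ->
    P (\bigcap_(i in [set` J]) Z i @^-1` A i) =
    (\prod_(i <- J) P (Z i @^-1` A i))%E.

Definition iid {d'} {T' : measurableType d'} (Z : nat -> T -> T') : Prop :=
  mutually_independent Z /\
  forall i j A, measurable A -> P (Z i @^-1` A) = P (Z j @^-1` A).

Definition stoch_bigO (X : nat -> T -> R) (a : nat -> R) : Prop :=
  forall e : R, 0 < e -> exists M : R,
    \forall n \near \oo, (P [set w | (M * a n < `|X n w|)%R] <= e%:E)%E.

End probability_notions.

(* The norm `|v| of the library on row vectors is the sup norm. *)
Definition enorm {R : realType} {p} (v : 'rV[R]_p) : R :=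
  Num.sqrt (\sum_(j < p) v 0 j ^+ 2).

Definition dotv {R : realType} {p} (v w : 'rV[R]_p) : R := (v *m w^T) 0 0.

Section estimators_asymptotics.
Context {d : measure_display} {T : measurableType d} {R : realType}
  (P : probability T R) {p : nat}.

Definition consistent (est : nat -> T -> 'rV[R]_p) (beta0 : 'rV[R]_p) : Prop :=
  forall e : R, 0 < e ->
    P [set w | e < enorm (est n w - beta0)] @[n --> \oo] --> 0%E.

Definition sqrtn_consistent (est : nat -> T -> 'rV[R]_p) (beta0 : 'rV[R]_p) :
    Prop :=
  stoch_bigO P (fun n w => enorm (est n w - beta0))
    (fun n => 1 / Num.sqrt n%:R).

End estimators_asymptotics.

Section functions.
Context {R : realType}.

Definition bounded_rho (rho : R -> R) : Prop :=
  [/\ forall u, 0 <= rho u <= 1,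
      forall u v, `|u| <= `|v| -> rho u <= rho v,
      rho 0 = 0,
      rho u @[u --> +oo] --> (1 : R)
    & forall u v, 0 < u -> rho u < 1 -> 0 < v -> rho v < 1 ->
        u < v -> rho u < rho v].

Definition twice_cont_diff (f : R -> R) : Prop :=
  [/\ forall u, derivable f u 1,
      forall u, derivable f^`()%classic u 1
    & continuous f^`(2)%classic].

Definition eventually_constant (f : R -> R) : Prop :=
  exists c M : R, forall u, M < `|u| -> f u = c.

Definition has_density (mu : probability R R) (f : R -> R) : Prop :=
  [/\ measurable_fun setT f,
      forall u, 0 <= f u
    & forall A, measurable A ->
        mu A = (\int[lebesgue_measure]_(u in A) (f u)%:E)%E].

Definition even_fun (f : R -> R) : Prop := forall u, f (- u) = f u.

Definition abs_nonincreasing (f : R -> R) : Prop :=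
  forall u v, `|u| <= `|v| -> f v <= f u.

Definition abs_decreasing_near0 (f : R -> R) : Prop :=
  exists2 e : R, 0 < e &
    forall u v, `|u| < `|v| -> `|v| < e -> f v < f u.

End functions.

Definition second_moment_mx {R : realType} {p}
    (G : probability 'rV[R]_p R) : 'M[R]_p :=
  \matrix_(j, l) \int[G]_v (v 0 j * v 0 l).

Section MM.
Context {R : realType} {p : nat}.

Definition sample (n : nat) := n.-tuple ('rV[R]_p * R)%type.

Definition residuals n (z : sample n) (beta : 'rV[R]_p) : 'rV[R]_n :=
  \row_i ((tnth z i).2 - dotv (tnth z i).1 beta).

Definition mscale (rho0 : R -> R) (b : R) n (u : 'rV[R]_n) : R :=
  inf [set s | 0 < s /\ n%:R^-1 * (\sum_(i < n) rho0 (u 0 i / s)) <= b].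

Definition mm_loss (rho1 : R -> R) (sigma : R) n (z : sample n)
    (beta : 'rV[R]_p) : R :=
  \sum_(i < n) rho1 (residuals z beta 0 i / sigma).

Definition bridge_objective rho1 sigma n (z : sample n) (lambda q : R)
    (beta : 'rV[R]_p) : R :=
  mm_loss rho1 sigma z beta + lambda * \sum_(j < p) `|beta 0 j| `^ q.

Definition adaptive_penalty (t vs : R) (beta2 beta : 'rV[R]_p) (j : 'I_p) :
    \bar R :=
  if beta2 0 j == 0 then (if beta 0 j == 0 then 0%E else +oo%E)
  else (`|beta 0 j| `^ t / `|beta2 0 j| `^ vs)%:E.

Definition adaptive_objective rho1 sigma n (z : sample n) (iota t vs : R)
    (beta2 beta : 'rV[R]_p) : \bar R :=
  ((mm_loss rho1 sigma z beta)%:E +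
   iota%:E * \sum_(j < p) adaptive_penalty t vs beta2 beta j)%E.

(* The estimators are unconstrained on samples for which the preliminary scale
   vanishes; this includes the empty sample, whose scale is the infimum of all
   positive reals. *)
Definition is_mm_bridge rho0 rho1 b lambda q n (z : sample n)
    (beta1 betaB : 'rV[R]_p) : Prop :=
  let sigma := mscale rho0 b (residuals z beta1) in
  sigma != 0 ->
  forall beta, bridge_objective rho1 sigma z lambda q betaB <=
               bridge_objective rho1 sigma z lambda q beta.

Definition is_adaptive_mm_bridge rho0 rho1 b iota t vs n (z : sample n)
    (beta1 beta2 betaA : 'rV[R]_p) : Prop :=
  let sigma := mscale rho0 b (residuals z beta1) in
  sigma != 0 ->
  forall beta, (adaptive_objective rho1 sigma z iota t vs beta2 betaA <=
                adaptive_objective rho1 sigma z iota t vs beta2 beta)%E.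

(* An estimator computed from the first n observations is a measurable function
   of the sample of size n, for each n. *)
Definition estimator := forall n : nat, {mfun sample n >-> 'rV[R]_p}.

Definition first_obs {T} (x : nat -> T -> 'rV[R]_p) (y : nat -> T -> R) n
    (w : T) : sample n :=
  [tuple (x i w, y i w) | i < n].

End MM.
Arguments sample R p n : clear implicits.
Arguments estimator R p : clear implicits.

(* Main.v *)
(* Write tau for the inverse of the preliminary scale, psi for the derivative of
   rho = rho1, d = beta - beta0, and L(d) = sum_i rho(tau (u_i - x_i^T d)).  With
   probability close to 1, tau lies in a fixed interval [t0, t1] of positive
   reals, because beta1 is consistent; since tau is random, all the estimates of
   L below are uniform over [t0, t1].

   Each estimator, compared with beta0, satisfies
     L(d) <= L(0) + D sqrt n min(1, |d|),
   because the penalty parameter is O(sqrt n), the penalty is locally Lipschitz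
   away from 0, and the weights |beta2_j|^-vs are bounded on the support.
   - By [B2] and compactness of the unit sphere, the mean of the loss exceeds
     b + eta when |d| >= A, whereas L(0) <= n (b + o(1)); hence |d| <= A.
   - On |d| <= A, L(d) - L(0) + tau sum_i psi(tau u_i) x_i^T d >= kappa n |d|^2.
     This is a second-order Taylor remainder of the loss; along rays it extends
     continuously to d = 0, its mean is positive because f0 is even and
     decreasing (reflect v to c - v), and a compactness argument in the style of
     Wald makes the law of large numbers uniform.
   - The score sum_i psi(tau u_i) x_i is O_P(sqrt n) uniformly in tau.
   Together these give |d| <= Dr / sqrt n.

   Comparing now the estimator with the vector obtained by setting its last
   p - s coordinates to 0, the gain in loss is at most of order
   sqrt n sum_j |beta_j| <= const n^(q/2) sum_j |beta_j|^q, whereas the penalty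
   charges c_n sum_j |beta_j|^q, with c_n = lambda_n for the Bridge estimator and,
   since |beta2_j| <= B / sqrt n off the support, c_n = iota_n (B / sqrt n)^-vs
   for the adaptive one.  As c_n / n^(q/2) -> oo, these coordinates vanish. *)
Require Import Defs.
From HB Require Import structures.
From mathcomp Require Import all_boot all_order all_algebra finmap.
From mathcomp Require Import all_classical all_reals all_analysis.
From mathcomp Require Import measurable_realfun.
From mathcomp Require Import ring lra.
Import Order.TTheory GRing.Theory Num.Theory.
Import numFieldNormedType.Exports.
Local Open Scope classical_set_scope.
Local Open Scope ring_scope.

Set Implicit Arguments.
Unset Strict Implicit.
Unset Printing Implicit Defensive.

(** * Events of high probability and the weak law of large numbers *)

(** The estimator is not first shown to be consistent. One quadratic lower bound on a whole ball |d|
    <= A gives the rate directly, so the mean of the loss must grow under every non-zero shift, not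
    only under small ones. The density is merely continuous, so no Hessian of the mean loss can be
    had by differentiating [f]; symmetry and monotonicity replace it.

    For the loss only lower bounds have to be uniform. It is therefore enough to cover a compact
    parameter set by finitely many neighbourhoods, each with one integrable minorant, and to apply
    the weak law to these finitely many functions; no supremum or infimum over parameters is ever
    measured. The score is the one process that needs a two-sided uniform bound, and there the only
    nonlinear parameter is the real number tau, for which a grid suffices.

    The factor min(1, |d|) in the basic inequality serves two purposes: its bound 1 leaves only an
    O(sqrt n) = o(n) excess, which excludes |d| >= A, and its bound |d| gives the rate once |d| <
    A. *)

Lemma integrable_dom {R : realType} {d} {Z : measurableType d}
    (mu : {measure set Z -> \bar R}) (f g : Z -> R) :
  measurable_fun setT f -> mu.-integrable setT (EFin \o g) ->
  (forall z, `|f z| <= g z) -> mu.-integrable setT (EFin \o f).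
Proof.
move=> mf ig fg; apply: (le_integrable measurableT _ _ ig).
  exact/measurable_EFinP.
by move=> z _ /=; rewrite lee_fin (le_trans (fg z))// ler_norm.
Qed.

Lemma integrable_bounded {R : realType} {d} {Z : measurableType d}
    (mu : probability Z R) (f : Z -> R) (M : R) :
  measurable_fun setT f -> (forall z, `|f z| <= M) ->
  mu.-integrable setT (EFin \o f).
Proof.
move=> mf fM; apply: (@integrable_dom _ _ _ _ _ (fun=> M) mf) => //.
exact: (finite_measure_integrable_cst mu M measurableT).
Qed.

Lemma integrable_measurable {R : realType} {d} {Z : measurableType d}
    (mu : {measure set Z -> \bar R}) (f : Z -> R) :
  mu.-integrable setT (EFin \o f) -> measurable_fun setT f.
Proof. by move=> /measurable_int/measurable_EFinP. Qed.

Section failure_probability.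
Context {R : realType} {d} {T : measurableType d} (P : probability T R).

(* Suprema over a continuum of parameters are not known to be measurable, so an
   event is said to fail with probability at most e when its complement is
   covered by a measurable set of probability at most e. *)
Definition fails_le (E : set T) (e : R) : Prop :=
  exists B, [/\ measurable B, ~` E `<=` B & (P B <= e%:E)%E].

(** The events do not depend on [e]. Bounds whose constants grow as [e] shrinks, such as tightness
    of the score, cannot be put in this form and are stated with [fails_le]. *)
Definition whp (E : nat -> set T) : Prop :=
  forall e : R, 0 < e -> \forall n \near \oo, fails_le (E n) e.

Lemma fails_leS (E F : set T) (e e' : R) :
  E `<=` F -> e <= e' -> fails_le E e -> fails_le F e'.
Proof.
move=> EF ee' [B [mB EB PB]]; exists B; split => //.
  by move=> w Fw; apply: EB => /EF.
by rewrite (le_trans PB)// lee_fin.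
Qed.

Lemma fails_leT (e : R) : 0 <= e -> fails_le setT e.
Proof. by move=> e0; exists set0; rewrite setCT measure0 lee_fin; split. Qed.

Lemma fails_leI (E F : set T) (e e' : R) :
  fails_le E e -> fails_le F e' -> fails_le (E `&` F) (e + e').
Proof.
move=> [B [mB EB PB]] [C [mC FC PC]]; exists (B `|` C); split.
- exact: measurableU.
- by rewrite setCI; exact: setUSS.
- by rewrite (le_trans (measureU2 _ mB mC))// EFinD leeD.
Qed.

Lemma fails_le_probability (E : set T) (e : R) :
  measurable E -> fails_le E e -> (1 - e%:E <= P E)%E.
Proof.
move=> mE [B [mB EB PB]].
have PCE : (P (~` E) <= e%:E)%E.
  by rewrite (le_trans _ PB)// le_measure ?inE//; exact: measurableC.
have := probability_setC P mE; move: PCE => /[swap] -> .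
rewrite -(fineK (fin_num_measure P E mE)) -!EFinB !lee_fin; lra.
Qed.

Lemma whpS (E F : nat -> set T) :
  (\forall n \near \oo, E n `<=` F n) -> whp E -> whp F.
Proof.
move=> EF wE e e0; near=> n.
by apply: (@fails_leS (E n) (F n) e e) => //; near: n => //; exact: wE.
Unshelve. all: by end_near. Qed.

Lemma whpI (E F : nat -> set T) :
  whp E -> whp F -> whp (fun n => E n `&` F n).
Proof.
move=> wE wF e e0; have e20 : 0 < e / 2 by lra.
near=> n; rewrite [e]splitr; apply: fails_leI; near: n; [exact: wE|exact: wF].
Unshelve. all: by end_near. Qed.

Lemma whp_near (Q : nat -> Prop) :
  (\forall n \near \oo, Q n) -> whp (fun n => [set _ | Q n]).
Proof.
move=> hQ e e0; near=> n; apply: (fails_leS _ (lexx e) (fails_leT (ltW e0))) => w _.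
by near: n.
Unshelve. all: by end_near. Qed.

(** Markov's inequality; the bad set [M <= X w] is measurable and serves as the covering set. *)
Lemma markov_fails_le (X : T -> R) (e M : R) :
  0 < M -> (forall w, 0 <= X w) ->
  P.-integrable setT (EFin \o X) -> \int[P]_w X w <= e * M ->
  fails_le [set w | X w < M] e.
Proof.
move=> M0 X0 iX XM; have mX := integrable_measurable iX.
exists [set w | M <= X w]; split.
- rewrite (_ : [set _ | _] = X @^-1` `[M, +oo[); last first.
    by apply/seteqP; split => w /=; rewrite in_itv/= andbT.
  by rewrite -[X in measurable X]setTI; exact: mX.
- by move=> w /=; move/negP; rewrite -leNgt.
- rewrite -(@lee_pmul2l _ M%:E) ?lte_fin//.
  have := @le_integral_comp_abse _ _ _ P setT measurableT (EFin \o X) M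
    id (@measurable_id _ _ setT) (fun _ h => h).
  move=> /(_ _ _ M0).
  rewrite setTI /= => h.
  rewrite (_ : [set _ | _] = [set w | (M%:E <= `|X w|%:E)%E]); last first.
    by apply/seteqP; split => w /=; rewrite lee_fin ger0_norm.
  apply: (le_trans (h _ _)) => //.
    exact/measurable_EFinP.
  rewrite -EFinM mulrC; under eq_integral do rewrite /= ger0_norm//.
  rewrite -(@fineK _ (\int[P]_w _)%E) ?lee_fin//.
  exact: integrable_fin_num iX.
Qed.

End failure_probability.

(** The single change of variables of the development: it is applied to observations with a given
    law, to the coordinates of a product measure, to reflections of the line, and to the transport
    of [F0] to another copy of the reals. *)
Lemma integral_measure_preserving {R : realType} {d d'}
    {T : measurableType d} {Z : measurableType d'}
    (nu : {measure set T -> \bar R}) (mu : {measure set Z -> \bar R})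
    (W : T -> Z) (f : Z -> R) :
  measurable_fun setT W ->
  (forall A, measurable A -> nu (W @^-1` A) = mu A) ->
  mu.-integrable setT (EFin \o f) ->
  nu.-integrable setT (EFin \o (fun w => f (W w))) /\
  \int[nu]_w f (W w) = \int[mu]_z f z.
Proof.
move=> mW lW /integrableP[mf fi].
have E (g : Z -> \bar R) :
    (\int[mu]_z g z = \int[pushforward nu W]_z g z)%E.
  by apply: eq_measure_integral => //= A mA _; rewrite /pushforward lW.
have i1 : nu.-integrable setT ((EFin \o f) \o W).
  apply/integrableP; split; first exact: measurableT_comp.
  move: fi; rewrite E ge0_integral_pushforward//.
  exact: measurableT_comp.
split => //; rewrite /Rintegral E integral_pushforward//.
Qed.

(** * Moments of sums of pairwise independent observations *)

Section pairwise_independent_sample.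
Context {R : realType} {d} {T : measurableType d} (P : probability T R)
  {d'} {Z : measurableType d'} (mu : probability Z R).

(** On rectangles the joint law of the pair agrees with the product measure, so uniqueness of
    product measures identifies them, and Fubini factors the integral. *)
Lemma indep_integral (V W : T -> Z) (f g : Z -> R) :
  measurable_fun setT V -> measurable_fun setT W ->
  has_law P V mu -> has_law P W mu -> independent2 P V W ->
  mu.-integrable setT (EFin \o f) -> mu.-integrable setT (EFin \o g) ->
  P.-integrable setT (EFin \o (fun w => f (V w) * g (W w))) /\
  \int[P]_w (f (V w) * g (W w)) = (\int[mu]_z f z) * (\int[mu]_z g z).
Proof.
move=> mV mW lV lW VW jf jg.
have mf := integrable_measurable jf.
have mg := integrable_measurable jg.
have mVW : measurable_fun setT (fun w => (V w, W w)).
  exact: measurable_fun_pair.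
have law A : measurable A -> pushforward P (fun w => (V w, W w)) A =
    (mu \x mu)%E A.
  move=> mA; symmetry; apply: product_measure_unique => //= B C mB mC.
  rewrite -lV// -lW// -VW//.
have lawi : has_law P (fun w => (V w, W w)) (mu \x mu)%E by [].
have ifg : (mu \x mu)%E.-integrable setT
    (EFin \o (fun z : Z * Z => f z.1 * g z.2)).
  apply/integrable12ltyP.
    apply/measurable_EFinP; apply: measurable_funM.
      exact: measurableT_comp.
    exact: measurableT_comp.
  under eq_integral => z _.
    under eq_integral => z' _ do rewrite /= normrM EFinM.
    rewrite ge0_integralZl//; last first.
      by apply/measurable_EFinP; exact: measurableT_comp.
    over.
  rewrite ge0_integralZr//.
  - apply: lte_mul_pinfty => //.
    + exact: integral_ge0.
    + by case/integrableP: jf => _ /=; rewrite ge0_fin_numE// integral_ge0.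
    + by case/integrableP: jg.
  - by apply/measurable_EFinP; exact: measurableT_comp.
  - exact: integral_ge0.
have [ip ->] := integral_measure_preserving mVW lawi ifg; split => //.
rewrite /Rintegral -integral12_prod_meas1//.
rewrite (_ : fubini_F _ _ = fun z => (f z)%:E * (\int[mu]_z (g z)%:E))%E; last first.
  apply/funext => z; rewrite /fubini_F -integralZl//.
rewrite -(fineK (integrable_fin_num measurableT jg)).
rewrite integralZr//= fineM//.
exact: integrable_fin_num jf.
Qed.

Context (W : nat -> T -> Z).
Hypothesis mW : forall i, measurable_fun setT (W i).
Hypothesis lawW : forall i, has_law P (W i) mu.
Hypothesis indW : forall i j, i != j -> independent2 P (W i) (W j).

Lemma integrable_sample (f : Z -> R) i : mu.-integrable setT (EFin \o f) ->
  P.-integrable setT (EFin \o (fun w => f (W i w))).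
Proof. by move=> jf; have [] := integral_measure_preserving (mW i) (lawW i) jf. Qed.

Lemma integral_sample (f : Z -> R) i : mu.-integrable setT (EFin \o f) ->
  \int[P]_w f (W i w) = \int[mu]_z f z.
Proof. by move=> jf; have [] := integral_measure_preserving (mW i) (lawW i) jf. Qed.

Lemma integral_sample_sum (f : Z -> R) n :
  mu.-integrable setT (EFin \o f) ->
  P.-integrable setT (EFin \o (fun w => \sum_(i < n) f (W i w))) /\
  \int[P]_w (\sum_(i < n) f (W i w)) = n%:R * \int[mu]_z f z.
Proof.
move=> jf; elim: n => [|n [IH1 IH2]].
  under eq_fun do rewrite big_ord0.
  by rewrite Rintegral_cst// !mul0r; split => //; exact: integrable0.
have jn := integrable_sample n jf.
under eq_fun do rewrite big_ord_recr/=.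
split.
  have := integrableD measurableT IH1 jn.
  by apply: eq_integrable.
by rewrite RintegralD// IH2 integral_sample// -addn1 natrD mulrDl mul1r.
Qed.

(** Each new term is uncorrelated with the previous partial sum, because a product of two centred
    independent factors has mean 0; pairwise independence is enough for this. *)
Lemma integral_sample_sum_sqr (f : Z -> R) n :
  mu.-integrable setT (EFin \o f) ->
  mu.-integrable setT (EFin \o (fun z => f z ^+ 2)) ->
  \int[mu]_z f z = 0 ->
  P.-integrable setT (EFin \o (fun w => (\sum_(i < n) f (W i w)) ^+ 2)) /\
  \int[P]_w (\sum_(i < n) f (W i w)) ^+ 2 = n%:R * \int[mu]_z f z ^+ 2.
Proof.
move=> jf jf2 f0.
have cross m k : (k <= m)%N ->
    P.-integrable setT
      (EFin \o (fun w => \sum_(i < k) f (W i w) * f (W m w))) /\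
    \int[P]_w (\sum_(i < k) f (W i w) * f (W m w)) = 0.
  elim: k => [_|k IH km].
    under eq_fun do rewrite big_ord0.
    by rewrite Rintegral_cst// !mul0r; split => //; exact: integrable0.
  have [IH1 IH2] := IH (ltnW km).
  have [jk ek] := indep_integral (mW k) (mW m) (lawW k) (lawW m)
    (indW (negbT (ltn_eqF km))) jf jf.
  under eq_fun do rewrite big_ord_recr/=.
  split; last by rewrite RintegralD// IH2 ek f0 mulr0 addr0.
  exact: eq_integrable (integrableD measurableT IH1 jk).
elim: n => [|n [IH1 IH2]].
  under eq_fun do rewrite big_ord0 expr0n.
  by rewrite Rintegral_cst// !mul0r; split => //; exact: integrable0.
have [c1 c2] := cross n n (leqnn n).
have jn := integrable_sample n jf2.
have E w : (\sum_(i < n.+1) f (W i w)) ^+ 2 =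
    ((\sum_(i < n) f (W i w)) ^+ 2 +
      2 * \sum_(i < n) f (W i w) * f (W n w)) + f (W n w) ^+ 2.
  by rewrite big_ord_recr/= -mulr_suml; ring.
have c3 : P.-integrable setT
    (EFin \o (fun w => 2 * \sum_(i < n) f (W i w) * f (W n w))).
  exact: eq_integrable (integrableZl measurableT 2 c1).
have c4 : P.-integrable setT (EFin \o (fun w => (\sum_(i < n) f (W i w)) ^+ 2 +
      2 * \sum_(i < n) f (W i w) * f (W n w))).
  exact: eq_integrable (integrableD measurableT IH1 c3).
under eq_fun do rewrite E.
split.
  exact: eq_integrable (integrableD measurableT c4 jn).
rewrite !RintegralD// RintegralZl// c2 IH2 mulr0 addr0 (@integral_sample (fun z => f z ^+ 2))//.
by rewrite [in RHS]mulrSr mulrDl mul1r.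
Qed.

End pairwise_independent_sample.

Lemma measurable_ltr_indic {R : realType} {d} {Z : measurableType d}
    (N : Z -> R) (M : R) :
  measurable_fun setT N -> measurable_fun setT (fun z => (M < N z)%R%:R : R).
Proof.
move=> mN; rewrite (_ : (fun _ => _) = \1_(N @^-1` `]M, +oo[)).
  by apply: measurable_indic; rewrite -[X in measurable X]setTI; exact: mN.
apply/funext => z; rewrite indicE; congr (nat_of_bool _)%:R.
by apply/idP/idP; rewrite inE/= in_itv/= andbT.
Qed.

Lemma Rintegral_probability_cst {R : realType} {d} {Z : measurableType d}
    (mu : probability Z R) (c : R) : \int[mu]_z c = c.
Proof. by rewrite Rintegral_cst//= probability_setT mulr1. Qed.

(** The truncation device used throughout: [N] is finite everywhere, so the indicators of
    [N > n + 1] decrease to 0, and dominated convergence applies with dominating function [g]. *)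
Lemma tail_integral {R : realType} {d} {Z : measurableType d}
    (mu : probability Z R) (g N : Z -> R) (e : R) :
  mu.-integrable setT (EFin \o g) -> (forall z, 0 <= g z) ->
  measurable_fun setT N -> 0 < e ->
  exists2 M, 0 < M & \int[mu]_z (g z * (M < N z)%R%:R) <= e.
Proof.
move=> ig g0 mN e0.
have mg := integrable_measurable ig.
pose h n z : R := g z * (n.+1%:R < N z)%R%:R.
have mh n : measurable_fun setT (h n).
  by apply: measurable_funM => //; exact: measurable_ltr_indic.
have cvgh : {ae mu, forall x, [set: Z] x -> EFin (h n x) @[n --> \oo] --> 0%E}.
  apply: aeW => z _; apply: cvg_near_cst.
  near=> n; rewrite /h/= ltNge (_ : N z <= n.+1%:R) ?mulr0//.
  near: n; exists (Num.truncn `|N z|) => // n /= hn.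
  rewrite (le_trans (ler_norm _))// (le_trans (ltW (truncnS_gt _)))//.
  by rewrite ler_nat.
have hb : {ae mu, forall x n, [set: Z] x -> (`|EFin (h n x)| <= (EFin \o g) x)%E}.
  apply: aeW => z n _ /=; rewrite lee_fin /h normrM !ger0_norm// ler_piMr//.
  by rewrite lern1 leq_b1.
have [_ _] := @dominated_convergence _ _ _ mu setT measurableT
  (fun n => EFin \o h n) (cst 0%E) (EFin \o g)
  (fun n => (measurable_EFinP _ _).2 (mh n)) (@measurable_cst _ _ _ _ _ _)
  cvgh ig hb.
rewrite integral0 => /fine_cvgP[_ /cvgrPdist_le/(_ e e0)] [n _ hn].
exists n.+1%:R; first by rewrite ltr0n.
have := hn n (leqnn n) => /=.
rewrite sub0r normrN => /(le_trans (ler_norm _)) //.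
Unshelve. all: by end_near. Qed.

Section weak_law.
Context {R : realType} {d} {T : measurableType d} (P : probability T R)
  {d'} {Z : measurableType d'} (mu : probability Z R).
Context (W : nat -> T -> Z).
Hypothesis mW : forall i, measurable_fun setT (W i).
Hypothesis lawW : forall i, has_law P (W i) mu.
Hypothesis indW : forall i j, i != j -> independent2 P (W i) (W j).

Lemma mean_markov (f : Z -> R) (e M : R) n :
  (0 < n)%N -> 0 < M -> mu.-integrable setT (EFin \o f) ->
  (forall z, 0 <= f z) -> \int[mu]_z f z <= e * M ->
  fails_le P [set w | n%:R^-1 * \sum_(i < n) f (W i w) < M] e.
Proof.
move=> n0 M0 jf f0 fM.
have n0' : 0 < n%:R :> R by rewrite ltr0n.
have [j1 j2] := integral_sample_sum mW lawW n jf.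
apply: (fails_leS _ (lexx e)
  (@markov_fails_le _ _ _ P (fun w => \sum_(i < n) f (W i w)) e (n%:R * M) _ _ _ _)).
- by move=> w /= h; rewrite mulrC ltr_pdivrMr// mulrC.
- exact: mulr_gt0.
- by move=> w; apply: sumr_ge0.
- exact: j1.
- by rewrite j2 mulrCA ler_pM2l.
Qed.

(** Only a first moment is assumed, so [f] is cut at a level [L]: the bounded part obeys Chebyshev's
    inequality, and the tail [f2] is small in mean and obeys Markov's. *)
Lemma weak_law_large_numbers (f : Z -> R) (eta : R) :
  mu.-integrable setT (EFin \o f) -> 0 < eta ->
  whp P (fun n => [set w |
    `|n%:R^-1 * \sum_(i < n) f (W i w) - \int[mu]_z f z| <= eta]).
Proof.
move=> jf eta0 e e0.
have mf := integrable_measurable jf.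
have mnf : measurable_fun setT (fun z => `|f z|) by exact: measurableT_comp.
have jnf : mu.-integrable setT (EFin \o (fun z => `|f z|)).
  by apply: (integrable_dom mnf (integrable_norm jf)) => z; rewrite normr_id.
(* The bound [eta / 4] controls the mean of [f2] itself; the bound [e * eta / 8], which is
   [(e / 2) * (eta / 4)], makes Markov's inequality fail with probability at most [e / 2]. *)
have eta'0 : 0 < Num.min (eta / 4) (e * eta / 8).
  by rewrite lt_min; apply/andP; split; rewrite divr_gt0// mulr_gt0.
have [L L0 tL] := tail_integral jnf (fun z => normr_ge0 (f z)) mnf eta'0.
pose f2 z := f z * (L < `|f z|)%R%:R.
pose f1 z := f z - f2 z.
have mf2 : measurable_fun setT f2.
  by apply: measurable_funM => //; exact: measurable_ltr_indic.
have jf2 : mu.-integrable setT (EFin \o f2).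
  apply: (integrable_dom mf2 jnf) => z; rewrite /f2 normrM ler_piMr//.
  by rewrite ger0_norm// lern1 leq_b1.
have mnf2 : measurable_fun setT (fun z => `|f2 z|) by exact: measurableT_comp.
have jnf2 : mu.-integrable setT (EFin \o (fun z => `|f2 z|)).
  by apply: (integrable_dom mnf2 (integrable_norm jf2)) => z; rewrite normr_id.
have if2 : \int[mu]_z `|f2 z| <= Num.min (eta / 4) (e * eta / 8).
  apply: le_trans tL; rewrite le_eqVlt; apply/orP; left; apply/eqP.
  apply: eq_Rintegral => z _.
  by rewrite /f2 normrM [X in _ * X]ger0_norm// ler0n.
move: if2; rewrite le_min => /andP[if2a if2b].
have f1L z : `|f1 z| <= L.
  rewrite /f1 /f2; case: (ltP L `|f z|) => h; first by rewrite mulr1 subrr normr0 ltW.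
  by rewrite mulr0 subr0.
have mf1 : measurable_fun setT f1 by exact: measurable_funB.
have jf1 := integrable_bounded mu mf1 f1L.
pose c := \int[mu]_z f1 z.
have cL : `|c| <= L.
  rewrite (le_trans (le_normr_Rintegral measurableT jf1))//.
  rewrite (@le_trans _ _ (\int[mu]_z (cst L z)))//.
    apply: le_Rintegral => //.
    - apply: (@integrable_bounded _ _ _ mu _ L) => [|z].
        exact: measurableT_comp.
      by rewrite normr_id.
    - exact: (@integrable_bounded _ _ _ mu (cst L) `|L|).
by rewrite Rintegral_probability_cst.
pose g z := f1 z - c.
have mg : measurable_fun setT g by exact: measurable_funB.
have g2L z : `|g z| <= 2 * L.
  by rewrite /g (le_trans (ler_normB _ _))// [leRHS]mulr_natl mulr2n lerD.
have jg := integrable_bounded mu mg g2L.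
have mg2 : measurable_fun setT (fun z => g z ^+ 2) by exact: measurable_funX.
have gg z : `|g z ^+ 2| <= (2 * L) ^+ 2.
  by rewrite normrX ler_pXn2r// nnegrE// mulr_ge0// ltW.
have jg2 := integrable_bounded mu mg2 gg.
have g0 : \int[mu]_z g z = 0.
  rewrite RintegralB//; last exact: (@integrable_bounded _ _ _ mu (cst c) `|c|).
  by rewrite Rintegral_probability_cst subrr.
have vg : \int[mu]_z g z ^+ 2 <= (2 * L) ^+ 2.
  rewrite (@le_trans _ _ (\int[mu]_z (cst ((2 * L) ^+ 2) z)))//.
    apply: le_Rintegral => //.
    - exact: (@integrable_bounded _ _ _ mu (cst _) `|(2 * L) ^+ 2|).
    - by move=> z _; rewrite (le_trans (ler_norm _)).
  by rewrite Rintegral_probability_cst.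
have Ef : \int[mu]_z f z = c + \int[mu]_z f2 z.
  by rewrite /c -RintegralD//; apply: eq_Rintegral => z _; rewrite /f1 subrK.
have If2 : `|\int[mu]_z f2 z| <= eta / 4.
  exact: le_trans (le_normr_Rintegral measurableT jf2) if2a.
near=> n.
have n0 : (0 < n)%N by near: n; exists 1%N.
have n0' : 0 < n%:R :> R by rewrite ltr0n.
rewrite [e]splitr.
have A : fails_le P [set w | n%:R^-1 * \sum_(i < n) `|f2 (W i w)| < eta / 4] (e / 2).
  apply: (mean_markov n0 _ jnf2) => //; first by rewrite divr_gt0.
  apply: (le_trans if2b); lra.
have [s1 s2] := integral_sample_sum_sqr mW lawW indW n jg jg2 g0.
have B : fails_le P [set w | (\sum_(i < n) g (W i w)) ^+ 2 < (n%:R * (eta / 4)) ^+ 2] (e / 2).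
  apply: markov_fails_le s1 _.
  - by rewrite exprn_gt0// mulr_gt0// divr_gt0.
  - by move=> w; rewrite sqr_ge0.
  - rewrite s2 (le_trans (ler_wpM2l (ltW n0') vg))//.
    rewrite [(n%:R * _) ^+ 2]exprMn (_ : e / 2 * _ = n%:R * (n%:R * (e / 2 * (eta / 4) ^+ 2))); last ring.
    rewrite ler_pM2l// -ler_pdivrMr ?mulr_gt0 ?exprn_gt0 ?divr_gt0//.
    near: n; exists (Num.truncn (`|(2 * L) ^+ 2 / (e / 2 * (eta / 4) ^+ 2)|)).+1 => // n /= hn.
    rewrite (le_trans (ler_norm _))// (le_trans (ltW (truncnS_gt _)))//.
    by rewrite ler_nat.
apply: (fails_leS _ (lexx _) (fails_leI A B)) => w [/= hA hB].
have hB' : `|n%:R^-1 * \sum_(i < n) g (W i w)| <= eta / 4.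
  rewrite normrM gtr0_norm ?invr_gt0// mulrC ler_pdivrMr// mulrC.
  rewrite -(@ler_pXn2r _ 2) ?nnegrE ?mulr_ge0 ?divr_ge0 ?(ltW n0') ?(ltW eta0)//.
  by rewrite real_normK ?num_real// ltW.
have hA' : `|n%:R^-1 * \sum_(i < n) f2 (W i w)| <= eta / 4.
  rewrite normrM gtr0_norm ?invr_gt0//; apply: le_trans (ltW hA).
  by rewrite ler_pM2l ?invr_gt0// ler_norm_sum.
(* Three errors of at most [eta / 4] each: centred bounded part, empirical tail, mean of the
   tail. *)
have -> : n%:R^-1 * \sum_(i < n) f (W i w) - \int[mu]_z f z =
    n%:R^-1 * \sum_(i < n) g (W i w) + n%:R^-1 * \sum_(i < n) f2 (W i w)
     - \int[mu]_z f2 z.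
  rewrite Ef -mulrDr -big_split/=.
  under [in RHS]eq_bigr => i _.
    rewrite (_ : g _ + f2 _ = f (W i w) - c); last by rewrite /g /f1; ring.
    over.
  rewrite sumrB sumr_const card_ord mulrBr -[c *+ n]mulr_natl mulKf ?gt_eqF//.
  ring.
rewrite (le_trans (ler_normB _ _))//.
have := ler_normD (n%:R^-1 * \sum_(i < n) g (W i w)) (n%:R^-1 * \sum_(i < n) f2 (W i w)).
lra.
Unshelve. all: by end_near. Qed.

End weak_law.

(** * Smooth rho-functions *)

Lemma is_derive_unique {R : realType} (f : R -> R) (v a b : R) :
  is_derive v (1 : R) f a -> is_derive v (1 : R) f b -> a = b.
Proof. by move=> [_ <-] [_ <-]. Qed.

Lemma mvt {R : realType} (f df : R -> R) (a b : R) :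
  (forall x : R, is_derive x (1 : R) f (df x)) ->
  exists2 c, Num.min a b <= c <= Num.max a b & f b - f a = df c * (b - a).
Proof.
move=> fdf.
have cf : continuous f.
  by move=> x; apply/differentiable_continuous/derivable1_diffP.
have [ab|ba] := leP a b.
  have [c cab e] := MVT_segment ab (fun x _ => fdf x) (continuous_subspaceT cf).
  by exists c => //; move: cab; rewrite in_itv.
have [c cab e] := MVT_segment (ltW ba) (fun x _ => fdf x) (continuous_subspaceT cf).
exists c; first by move: cab; rewrite in_itv.
by rewrite -opprB e -mulrN opprB.
Qed.

Lemma mvt_le {R : realType} (f df : R -> R) (C a b : R) :
  (forall x : R, is_derive x (1 : R) f (df x)) -> (forall x, `|df x| <= C) ->
  `|f b - f a| <= C * `|b - a|.
Proof.
by move=> fdf dfC; have [c _ ->] := mvt a b fdf; rewrite normrM ler_wpM2r.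
Qed.

(** The facts about a bounded rho-function under B1 on which the proof rests. [M] is a threshold
    beyond which the loss is saturated at 1, and one constant [C] bounds both derivatives. In
    [smooth_lt] the larger argument may already be saturated. *)
Record smooth_rho {R : realType} (rho psi dpsi : R -> R) (M C : R) : Prop := {
  smooth_ge0 : forall v, 0 <= rho v;
  smooth_le1 : forall v, rho v <= 1;
  smooth_le : forall v w, `|v| <= `|w| -> rho v <= rho w;
  smooth_lt : forall v w, `|v| < `|w| -> rho v < 1 -> rho v < rho w;
  smooth_0 : rho 0 = 0;
  smooth_M_gt0 : 0 < M;
  smooth_C_gt0 : 0 < C;
  smooth_1 : forall v, M <= `|v| -> rho v = 1;
  smooth_dpsi0 : forall v, M <= `|v| -> dpsi v = 0;
  smooth_psi : forall v : R, is_derive v (1 : R) rho (psi v);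
  smooth_dpsi : forall v : R, is_derive v (1 : R) psi (dpsi v);
  smooth_psi_le : forall v, `|psi v| <= C;
  smooth_dpsi_le : forall v, `|dpsi v| <= C;
  smooth_dpsi_cont : continuous dpsi }.

Lemma compact_support_bounded {R : realType} (f : R -> R) (M : R) :
  0 < M -> continuous f -> (forall v, M <= `|v| -> f v = 0) ->
  exists2 C, 0 < C & forall v, `|f v| <= C.
Proof.
move=> M0 cf f0.
have cnf : continuous (fun v => `|f v|).
  by move=> v; apply: continuous_comp; [exact: cf|exact: norm_continuous].
have [c _ hc] := @EVT_max R (fun v => `|f v|) (- M) M ltac:(lra)
  (continuous_subspaceT cnf).
exists (`|f c| + 1); first by rewrite ltr_pwDr.
move=> v; have [/f0 ->|vM] := leP M `|v|.
  by rewrite normr0 addr_ge0.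
rewrite (@le_trans _ _ `|f c|) ?lerDl// hc// in_itv/=.
by rewrite -ler_norml ltW.
Qed.

Lemma smooth_rho_exists {R : realType} (rho : R -> R) :
  bounded_rho rho -> twice_cont_diff rho -> eventually_constant rho ->
  exists M C, smooth_rho rho (derive1 rho) (derive1n 2 rho) M C.
Proof.
move=> [r01 rle r0 r1 rlt] [d1 d2 cd2] [c [M0 rM]].
have c1 : c = 1.
  have : rho u @[u --> +oo] --> c.
    apply: cvg_near_cst; near=> u; apply: rM.
    rewrite (@lt_le_trans _ _ u) ?ler_norm//; near: u.
    by apply: nbhs_pinfty_gt; rewrite num_real.
  by move=> rc; exact: (cvg_unique _ rc r1).
(* The margin 1 keeps the whole interval of radius 1 around a point with [M <= |v|] outside the
   threshold [M0]. There [psi] is identically 0, whence [dpsi v = 0]. *)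
pose M := `|M0| + 1.
have M_gt0 : 0 < M by rewrite ltr_pwDr.
have M_gt v : M <= `|v| -> M0 < `|v|.
  by apply: lt_le_trans; rewrite (le_lt_trans (ler_norm M0))// ltrDl.
have e1 v : M0 < `|v| -> rho v = 1 by move=> /rM ->.
have dr v : is_derive v (1 : R) rho ((derive1 rho) v).
  by rewrite derive1E; exact/derivableP.
have dp v : is_derive v (1 : R) (derive1 rho) (derive1n 2 rho v).
  by rewrite [derive1n 2 rho v]derive1E; exact/derivableP.
have p0 v : M0 < `|v| -> (derive1 rho) v = 0.
  move=> vM; apply: (is_derive_unique (dr v)).
  (* At a saturated point [rho] attains its maximal value 1, so its derivative vanishes. *)
  apply: (@derive1_at_max _ _ (v - 1) (v + 1)) => //; first by lra.
    by rewrite in_itv/=; apply/andP; split; lra.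
  by move=> t _; rewrite (e1 v)//; have /andP[] := r01 t.
have pM v : M <= `|v| -> (derive1 rho) v = 0 by move=> /M_gt/p0.
have dpM v : M <= `|v| -> derive1n 2 rho v = 0.
  move=> vM; apply: (is_derive_unique (dp v)).
  have {vM}[vM|vM] : M <= v \/ M <= - v.
    by move: vM; rewrite ler_normr => /orP.
  - apply: (@derive1_at_max _ _ (v - 1) (v + 1)) => //; first by lra.
      by rewrite in_itv/=; apply/andP; split; lra.
    move=> t; rewrite in_itv/= => /andP[vt _].
    rewrite !p0//; first by apply: M_gt; rewrite ler_normr vM.
    rewrite ltr_normr; apply/orP; left.
    by have := ler_norm M0; rewrite /M in vM; lra.
  - apply: (@derive1_at_max _ _ (v - 1) (v + 1)) => //; first by lra.
      by rewrite in_itv/=; apply/andP; split; lra.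
    move=> t; rewrite in_itv/= => /andP[_ vt].
    rewrite !p0//; first by apply: M_gt; rewrite ler_normr vM orbT.
    rewrite ltr_normr; apply/orP; right.
    by have := ler_norm M0; rewrite /M in vM; lra.
have cp : continuous (derive1 rho).
  by move=> v; apply/differentiable_continuous/derivable1_diffP.
have [C1 C10 hC1] := compact_support_bounded M_gt0 cp pM.
have [C2 C20 hC2] := compact_support_bounded M_gt0 cd2 dpM.
have rabs v : rho `|v| = rho v.
  by apply/eqP; rewrite eq_le !rle ?normr_id.
exists M, (C1 + C2); split => //.
- by move=> v; have /andP[] := r01 v.
- by move=> v; have /andP[] := r01 v.
- move=> v w vw rv1; have [rw|rw] := ltP (rho w) 1; last exact: lt_le_trans rw.
  (* Strict monotonicity is only given between positive arguments, so the comparison with 0 passes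
     through [a / 2]. *)
  have lt_pos a : 0 < a -> rho a < 1 -> 0 < rho a.
    move=> a0 ra1; have /andP[ra0 _] := r01 (a / 2).
    apply: (le_lt_trans ra0); apply: rlt => //; try lra.
    by apply: le_lt_trans ra1; apply: rle; rewrite !gtr0_norm; lra.
  rewrite -(rabs v) -(rabs w); have [/eqP v0|v0] := boolP (v == 0).
    by rewrite v0 normr0 r0; apply: lt_pos; rewrite ?rabs// (le_lt_trans _ vw).
  by apply: rlt; rewrite ?rabs// ?normr_gt0// -normr_gt0 (lt_trans _ vw) ?normr_gt0.
- by rewrite addr_gt0.
- by move=> v /M_gt/e1.
- by move=> v; rewrite (le_trans (hC1 v))// lerDl ltW.
- by move=> v; rewrite (le_trans (hC2 v))// lerDr ltW.
Unshelve. all: by end_near. Qed.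

Section smooth_rho_theory.
Context {R : realType} (rho psi dpsi : R -> R) (M C : R).
Hypothesis S : smooth_rho rho psi dpsi M C.

Lemma smooth_even v : rho (- v) = rho v.
Proof.
by apply/eqP; rewrite eq_le; apply/andP; split; apply: (smooth_le S); rewrite normrN.
Qed.

Lemma smooth_psi_odd v : psi (- v) = - psi v.
Proof.
have := smooth_psi S v => d1.
have d2 : is_derive v (1 : R) (rho \o (-%R : R -> R)) (psi (- v) * -1).
  by apply: is_derive1_comp; exact: (smooth_psi S).
rewrite mulrN1 in d2.
have : rho \o (-%R : R -> R) = rho by apply/funext => w; exact: smooth_even.
by move: d2 => /[swap] -> d2; rewrite (is_derive_unique d1 d2) opprK.
Qed.

Lemma smooth_gt0 v : v != 0 -> 0 < rho v.
Proof.
move=> v0; rewrite -[X in X < _](smooth_0 S); apply: (smooth_lt S).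
  by rewrite normr0 normr_gt0.
by rewrite (smooth_0 S).
Qed.

Lemma smooth_lipschitz v w : `|rho v - rho w| <= C * `|v - w|.
Proof. exact: mvt_le (smooth_psi S) (smooth_psi_le S). Qed.

Lemma smooth_psi_lipschitz v w : `|psi v - psi w| <= C * `|v - w|.
Proof. exact: mvt_le (smooth_dpsi S) (smooth_dpsi_le S). Qed.

Lemma smooth_continuous : continuous rho.
Proof.
move=> v; apply/differentiable_continuous/derivable1_diffP.
by have [] := smooth_psi S v.
Qed.

Lemma smooth_psi_continuous : continuous psi.
Proof.
move=> v; apply/differentiable_continuous/derivable1_diffP.
by have [] := smooth_dpsi S v.
Qed.

(** Mean value theorem on [[0, e]], where [rho] rises from 0 to a positive value. *)
Lemma smooth_psi_gt0 e : 0 < e -> exists2 p, 0 < p < e & 0 < psi p.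
Proof.
move=> e0.
have [c c01 h] := MVT e0 (fun x _ => smooth_psi S x)
  (continuous_subspaceT smooth_continuous).
exists c; first by move: c01; rewrite in_itv.
move: h; rewrite (smooth_0 S) !subr0 => h.
by have := smooth_gt0 (negbT (gt_eqF e0)); rewrite h pmulr_lgt0.
Qed.

(* Second-order remainder, comparing the second derivative with an arbitrary
   constant a; a = 0 bounds it and a = dpsi v0 gives the continuity of the
   remainder at h = 0. *)
Lemma smooth_taylor v h a eta :
  (forall w, `|w - v| <= `|h| -> `|dpsi w - a| <= eta) ->
  `|rho (v - h) - rho v + psi v * h - a * h ^+ 2 / 2| <= eta * h ^+ 2.
Proof.
move=> H.
have d (t : R) : is_derive t (1 : R)
    (fun t => rho (v - t) - rho v + psi v * t - a * t ^+ 2 / 2) (psi v - psi (v - t) - a * t).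
  have h1 : is_derive t (1 : R) (rho \o (fun t => v - t)) (psi (v - t) * (- 1)).
    apply: is_derive1_comp; first exact: (smooth_psi S).
    rewrite -[X in is_derive _ _ _ X]add0r.
    exact: (@is_deriveB R R^o R^o (cst v) id).
  have -> : (fun t => rho (v - t) - rho v + psi v * t - a * t ^+ 2 / 2) =
      (rho \o (fun t => v - t)) - cst (rho v) + psi v \*: (id : R -> R^o)
      - (a / 2) \*: ((id : R -> R) ^+ 2 : R -> R^o).
    by apply/funext => x; rewrite !fctE /= /GRing.scale/=; ring.
  by apply: is_derive_eq; rewrite /GRing.scale/=; field.
have [c c0 e] := mvt 0 h d.
have -> : rho (v - h) - rho v + psi v * h - a * h ^+ 2 / 2 =
    (psi v - psi (v - c) - a * c) * h.
  move: e; rewrite !subr0 subrr mulr0 expr0n !(mulr0, mul0r) !subr0 add0r.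
  by rewrite subr0 => ->.
have [x x0 e'] := mvt (v - c) v (smooth_dpsi S).
have -> : psi v - psi (v - c) - a * c = (dpsi x - a) * c by rewrite e'; ring.
have ch : `|c| <= `|h|.
  move: c0; case: (leP 0 h) => h0 /andP[? ?]; first by rewrite !ger0_norm; lra.
  by rewrite !ler0_norm; lra.
have xc : `|x - v| <= `|c|.
  by move: x0; case: (leP (v - c) v) => h0 /andP[? ?]; rewrite ler_norml;
    have := ler_norm c; have := ler_norm (- c); rewrite normrN; lra.
rewrite normrM normrM -[h ^+ 2]real_normK ?num_real// expr2 mulrA.
rewrite ler_wpM2r// ler_pM// H// (le_trans xc)//.
Qed.
End smooth_rho_theory.

(** The value at [h = 0] is the limit of the quotient. With it the remainder is jointly continuous,
    so that compactness arguments can include shifts of length 0. *)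
Definition taylor_rem {R : realType} (rho psi dpsi : R -> R) (v h : R) : R :=
  if h == 0 then dpsi v / 2 else (rho (v - h) - rho v + psi v * h) / h ^+ 2.

Section taylor_remainder.
Context {R : realType} (rho psi dpsi : R -> R) (M C : R).
Hypothesis S : smooth_rho rho psi dpsi M C.
Let Q := taylor_rem rho psi dpsi.

Lemma taylor_remE v h : rho (v - h) - rho v + psi v * h = Q v h * h ^+ 2.
Proof.
rewrite /Q /taylor_rem; case: eqVneq => [->|h0]; last by rewrite divfK// expf_neq0.
by rewrite subr0 subrr !mulr0 expr0n/= mulr0 addr0.
Qed.

Lemma taylor_rem_near v h a eta :
  (forall w, `|w - v| <= `|h| -> `|dpsi w - a| <= eta) ->
  `|Q v h - a / 2| <= eta.
Proof.
move=> H; rewrite /Q /taylor_rem; case: eqVneq => [h0|h0].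
  have := H v; rewrite subrr normr0 => /(_ (normr_ge0 _)).
  rewrite -mulrBl normrM (@ger0_norm _ 2^-1)//; have := normr_ge0 (dpsi v - a); lra.
have h20 : 0 < h ^+ 2 by rewrite lt0r expf_neq0//= sqr_ge0.
have H' := smooth_taylor S H.
rewrite -(@ler_pM2r _ (h ^+ 2) h20); apply: le_trans H'.
rewrite -[X in _ * X](gtr0_norm h20) -normrM le_eqVlt; apply/orP; left.
by apply/eqP; congr `|_|; field; rewrite h0.
Qed.

Lemma taylor_rem_le v h : `|Q v h| <= C.
Proof.
have := @taylor_rem_near v h 0 C; rewrite mul0r subr0; apply => w _.
by rewrite subr0 (smooth_dpsi_le S).
Qed.

(** Away from [h = 0] this is a quotient of continuous functions. At [h = 0] the remainder is
    compared with [dpsi v0 / 2] by means of [taylor_rem_near], and only continuity of [dpsi] at [v0]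
    enters. *)
Lemma taylor_rem_continuous : continuous (fun p : R * R => Q p.1 p.2).
Proof.
move=> [v0 h0]; have [h00|h00] := eqVneq h0 0; last first.
  have near_h : \forall p \near (v0, h0), (p : R * R).2 != 0.
    have : \forall h \near h0, h != 0 by exact: open_neq.
    by move=> H; exact: (cvg_snd H).
  have cg : (fun p : R * R => (rho (p.1 - p.2) - rho p.1 + psi p.1 * p.2)
      / p.2 ^+ 2) p @[p --> (v0, h0)] -->
      (rho (v0 - h0) - rho v0 + psi v0 * h0) / h0 ^+ 2.
    have c1 : (p : R * R).1 @[p --> (v0, h0)] --> v0 by exact: cvg_fst.
    have c2 : (p : R * R).2 @[p --> (v0, h0)] --> h0 by exact: cvg_snd.
    apply: cvgM.
      apply: cvgD; last first.
        by apply: cvgM => //; apply: (cvg_comp _ _ c1); exact: (smooth_psi_continuous S).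
      apply: cvgB.
        by apply: (cvg_comp _ _ (cvgB c1 c2)); exact: (smooth_continuous S).
      by apply: (cvg_comp _ _ c1); exact: (smooth_continuous S).
    apply: cvgV; first by rewrite expf_neq0.
    by rewrite expr2; exact: (cvgM c2 c2).
  rewrite /continuous_at /Q /taylor_rem /= (negbTE h00).
  apply: cvg_trans cg; apply: near_eq_cvg; near=> p.
  by rewrite (negbTE (_ : p.2 != 0))//; near: p.
rewrite h00 {h0 h00}; apply/cvgrPdist_le => /= eta eta0.
have /cvgrPdist_le/(_ _ eta0) : dpsi w @[w --> v0] --> dpsi v0 by exact: (smooth_dpsi_cont S).
move=> [/= dl dl0 hdl].
have -> : Q v0 0 = dpsi v0 / 2 by rewrite /Q /taylor_rem eqxx.
have nb (x0 : R) : \forall w \near x0, `|x0 - w| < dl / 2.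
  by exists (dl / 2) => //=; lra.
near=> p; rewrite distrC; apply: taylor_rem_near => w wp.
rewrite distrC; apply: hdl => /=; rewrite distrC.
have p1 : `|v0 - p.1| < dl / 2.
  by near: p; exact: (cvg_fst (nb v0)).
have p2 : `|0 - p.2| < dl / 2.
  by near: p; exact: (cvg_snd (nb 0)).
rewrite sub0r normrN in p2.
rewrite (_ : w - v0 = (w - p.1) - (v0 - p.1)); last ring.
have := ler_normB (w - p.1) (v0 - p.1); lra.
Unshelve. all: by end_near. Qed.

End taylor_remainder.

(** Tube lemma, through the near-covering form of compactness: a product neighbourhood of [(x0, y)]
    on which [f] varies by at most [eta / 2] controls both [f (x, y')] and [f (x0, y')]. *)
Lemma compact_uniform {R : realType} {X Y : topologicalType} (K : set Y)
    (f : X * Y -> R) (x0 : X) (eta : R) :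
  compact K -> continuous f -> 0 < eta ->
  \forall x \near x0, forall y, K y -> `|f (x, y) - f (x0, y)| <= eta.
Proof.
move=> /compact_near_coveringP cK cf eta0.
apply: (cK X (nbhs x0) (fun x y => `|f (x, y) - f (x0, y)| <= eta)) => y Ky.
have eta20 : 0 < eta / 2 by lra.
have /cvgrPdist_le/(_ _ eta20)[/= [U V] [/= xU yV] UV] := cf (x0, y).
exists (V, U) => //= -[y' x] [/= Vy' Ux].
have h1 := UV (x, y') (conj Ux Vy').
have h2 := UV (x0, y') (conj (nbhs_singleton xU) Vy').
rewrite /= in h1 h2.
rewrite (_ : f (x, y') - f (x0, y') =
  (f (x0, y) - f (x0, y')) - (f (x0, y) - f (x, y'))); last ring.
have := ler_normB (f (x0, y) - f (x0, y')) (f (x0, y) - f (x, y')); lra.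
Qed.

(** * Translations of an even unimodal density *)

(** Uniqueness of Lebesgue measure: the image measure agrees with it on half-open intervals, since
    reflection preserves lengths. *)
Lemma lebesgue_reflection {R : realType} (c : R) (A : set R) :
  measurable A -> lebesgue_measure ((fun v : R => c - v) @^-1` A) = lebesgue_measure A.
Proof.
have mr : measurable_fun setT (fun v : R => c - v) by exact: measurable_funB.
move=> mA; symmetry.
pose phi : measurableTypeR R -> measurableTypeR R := fun v => c - v.
apply: (@lebesgue_measure_unique R
  (pushforward (@lebesgue_measure R) phi)) => //.
move=> X [[a b] _ <-] /=.
have pre : phi @^-1` `]a, b]%classic = `[c - b, c - a[%classic.
  by apply/seteqP; split => v /=; rewrite !in_itv/= /phi => /andP[? ?];
    apply/andP; split; lra.
transitivity (lebesgue_measure `[c - b, c - a[%classic); last by rewrite -pre.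
rewrite !lebesgue_measure_itv/= !lte_fin.
rewrite (_ : (c - b < c - a) = (a < b)); last by apply/idP/idP; lra.
by case: ifP => // _; rewrite -!EFinB; congr EFin; ring.
Qed.

Lemma integral_reflection {R : realType} (c : R) (g : R -> R) :
  lebesgue_measure.-integrable setT (EFin \o g) ->
  lebesgue_measure.-integrable setT (EFin \o (fun v : R => g (c - v))) /\
  \int[lebesgue_measure]_v g (c - v) = \int[lebesgue_measure]_v g v.
Proof.
apply: integral_measure_preserving; first exact: measurable_funB.
by move=> A mA; exact: lebesgue_reflection.
Qed.

Section density.
Context {R : realType} (F0 : probability R R) (f : R -> R).
Hypothesis fd : has_density F0 f.
Local Notation lambda := (@lebesgue_measure R).

Lemma density_integrable : lambda.-integrable setT (EFin \o f).
Proof.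
have [mf f0 fA] := fd; apply/integrableP; split; first exact/measurable_EFinP.
under eq_integral do rewrite /= ger0_norm//.
by rewrite -fA// probability_setT ltry.
Qed.

(** The hypothesis gives [F0] only on sets. It identifies [f] almost everywhere with the
    Radon-Nikodym derivative, and the change of measure then carries the formula to bounded
    functions. *)
Lemma density_integral (phi : R -> R) (B : R) :
  measurable_fun setT phi -> (forall v, `|phi v| <= B) ->
  lambda.-integrable setT (EFin \o (fun v => phi v * f v)) /\
  \int[F0]_v phi v = \int[lambda]_v (phi v * f v).
Proof.
move=> mphi phiB; have [mf f0 fA] := fd.
have if0 := density_integrable.
have ipf : lambda.-integrable setT (EFin \o (fun v => phi v * f v)).
  apply: (@integrable_dom _ _ _ lambda _ (fun v => B * f v)).
  - exact: measurable_funM.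
  - exact: eq_integrable (integrableZl measurableT B if0).
  - by move=> v; rewrite normrM (ger0_norm (f0 v)) ler_wpM2r.
split=> //.
(* Lebesgue measure lives on a copy of R with another display, to which F0 has
   to be transported. *)
have midR : measurable_fun setT (idfun : R -> measurableTypeR R).
  by move=> _ A mA; rewrite setTI.
pose idR : {mfun R >-> measurableTypeR R} :=
  HB.pack (idfun : R -> measurableTypeR R) (isMeasurableFun.Build _ _ _ _ _ midR).
pose F1 := distribution F0 idR.
have F1E A : F1 A = F0 A by [].
have bphi := integrable_bounded F1 mphi phiB.
have [_ ->] := @integral_measure_preserving _ _ _ _ _ F0 F1 (idfun : R -> measurableTypeR R) phi midR (fun A _ => erefl) bphi.
rewrite /Rintegral; congr fine.
have dom : F1 `<< lambda.
  apply/null_content_dominatesP => A mA A0; rewrite F1E fA// null_set_integral//.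
  by apply/measurable_EFinP; exact: measurable_funTS.
pose RN := Radon_Nikodym (charge_of_finite_measure F1) lambda.
have mRN : lambda.-integrable setT RN by exact: Radon_Nikodym_integrable.
rewrite -(Radon_Nikodym_change_of_variables dom measurableT bphi).
apply: ae_eq_integral => //.
- apply: emeasurable_funM; first exact/measurable_EFinP.
  exact: measurable_int mRN.
- exact: measurable_int ipf.
- have h : ae_eq lambda setT RN (EFin \o f).
    apply: integral_ae_eq => //; first exact/measurable_EFinP.
    by move=> E _ mE; rewrite -fA// -Radon_Nikodym_integral.
  apply: filterS h => v /= hv _; rewrite -/RN hv// EFinM.
Qed.

Hypothesis f_even : even_fun f.
Hypothesis f_cont : continuous f.
Hypothesis f_noninc : abs_nonincreasing f.
Hypothesis f_dec0 : abs_decreasing_near0 f.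

Lemma integral_odd (phi : R -> R) (B : R) :
  measurable_fun setT phi -> (forall v, `|phi v| <= B) ->
  (forall v, phi (- v) = - phi v) -> \int[F0]_v phi v = 0.
Proof.
move=> mphi phiB phiN.
have [i1 e1] := density_integral mphi phiB.
have [i2 e2] := integral_reflection 0 i1.
have : \int[lambda]_v (phi v * f v) = - \int[lambda]_v (phi v * f v).
  rewrite -[in LHS]e2 -[RHS]mulN1r -RintegralZl//.
  by apply: eq_Rintegral => v _; rewrite sub0r phiN f_even; ring.
rewrite -e1; lra.
Qed.

(* Reflecting v -> c - v exchanges h (v - c) with h v and f v with f (v - c). *)
Lemma integral_translation_gap (h : R -> R) (B c : R) :
  measurable_fun setT h -> (forall v, `|h v| <= B) -> (forall v, h (- v) = h v) ->
  lambda.-integrable setT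
    (EFin \o (fun v => (h (v - c) - h v) * (f v - f (v - c)))) /\
  2 * \int[F0]_v (h (v - c) - h v) =
    \int[lambda]_v ((h (v - c) - h v) * (f v - f (v - c))).
Proof.
move=> mh hB hN.
have mhc : measurable_fun setT (fun v : R => h (v - c) - h v).
  apply: measurable_funB => //; apply: measurableT_comp => //.
  exact: measurable_funB.
have hcB v : `|h (v - c) - h v| <= B + B.
  by rewrite (le_trans (ler_normB _ _))// lerD.
have [i1 e1] := density_integral mhc hcB.
have [i2 e2] := integral_reflection c i1.
have E v : (h (c - v - c) - h (c - v)) * f (c - v) =
    - ((h (v - c) - h v) * f (v - c)).
  rewrite (_ : c - v - c = - v); last ring.
  by rewrite hN -[c - v]opprB hN f_even; ring.
have i3 : lambda.-integrable setT (EFin \o (fun v => (h (v - c) - h v) * f v +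
    (h (c - v - c) - h (c - v)) * f (c - v))).
  exact: eq_integrable (integrableD measurableT i1 i2).
have e3 : (fun v => (h (v - c) - h v) * f v +
    (h (c - v - c) - h (c - v)) * f (c - v)) =
    (fun v => (h (v - c) - h v) * (f v - f (v - c))).
  by apply/funext => v; rewrite E; ring.
rewrite -e3; split => //.
rewrite (RintegralD measurableT i1 i2) [X in _ = _ + X]e2 -e1; ring.
Qed.

End density.

Lemma integral_indic_itv {R : realType} (l r : bool) (a b : R) : a <= b ->
  lebesgue_measure.-integrable setT
    (EFin \o (\1_[set` Interval (BSide l a) (BSide r b)] : R -> R)) /\
  \int[lebesgue_measure]_v
    (\1_[set` Interval (BSide l a) (BSide r b)] v : R) = b - a.
Proof.
move=> ab.
have mI : lebesgue_measure [set` Interval (BSide l a) (BSide r b)] = (b - a)%:E.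
  rewrite lebesgue_measure_itv/= lte_fin; case: ltP => // ba.
  by rewrite (_ : b = a) ?subrr//; apply/eqP; rewrite eq_le ba ab.
split.
  apply/integrableP; split.
    by apply/measurable_EFinP; exact: measurable_indic.
  under eq_integral do rewrite /= ger0_norm//.
  by rewrite integral_indic// setIT/= mI ltry.
by rewrite /Rintegral integral_indic// setIT/= mI.
Qed.

Lemma integral_translation {R : realType} (c : R) (g : R -> R) :
  lebesgue_measure.-integrable setT (EFin \o g) ->
  lebesgue_measure.-integrable setT (EFin \o (fun v : R => g (v - c))) /\
  \int[lebesgue_measure]_v g (v - c) = \int[lebesgue_measure]_v g v.
Proof.
move=> ig; have [i1 e1] := integral_reflection 0 ig.
have [i2 e2] := integral_reflection c i1.
have E : (fun v => g (0 - (c - v))) = (fun v => g (v - c)).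
  by apply/funext => v; congr g; ring.
by rewrite E in i2 e2; rewrite e2 e1.
Qed.

(** On the right the overlap [[p + c, q - c]] cancels. What remains is [f] on a left end of length
    [c], where it is at least [f (p + c)], minus [f] on a right end of length [c], where it is at
    most [f (q - c)]. *)
Lemma shifted_interval_le {R : realType} (f : R -> R) (p q c v : R) :
  abs_nonincreasing f -> 0 < p -> 0 < c -> p + c <= q - c ->
  f (p + c) * (p <= v < p + c)%R%:R - f (q - c) * (q - c < v <= q)%R%:R <=
  (p <= v <= q - c)%R%:R * f v - (p + c <= v <= q)%R%:R * f v.
Proof.
move=> f_noninc p0 c0 pcq.
have fp : p <= v -> v < p + c -> f (p + c) <= f v.
  by move=> ? ?; apply: f_noninc; rewrite !gtr0_norm; lra.
have fq : q - c < v -> f v <= f (q - c).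
  by move=> ?; apply: f_noninc; rewrite !gtr0_norm; lra.
move: (f (p + c)) (f (q - c)) (f v) fp fq => A B D.
case: (ltP v p) => vp; first (case: (ltP (q - c) v) => vqc; first lra).
  by move=> _ _; rewrite /= (lt_geF (_ : v < p + c)) ?mulr0 ?mul0r ?subrr//; lra.
case: (ltP v (p + c)) => vpc; case: (ltP (q - c) v) => vqc;
  case: (leP v q) => vq /= fp fq; rewrite ?(mul0r, mulr0, mul1r, mulr1);
  try (by have := fp isT isT; lra); try (by have := fq isT; lra); lra.
Qed.

Section density_gap.
Context {R : realType} (F0 : probability R R) (f : R -> R).
Hypothesis fd : has_density F0 f.
Hypothesis f_even : even_fun f.
Hypothesis f_cont : continuous f.
Hypothesis f_noninc : abs_nonincreasing f.
Hypothesis f_dec0 : abs_decreasing_near0 f.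
Context (rho psi dpsi : R -> R) (M C : R).
Hypothesis S : smooth_rho rho psi dpsi M C.
Context (tau : R).
Hypothesis tau_gt0 : 0 < tau.
Local Notation lambda := (@lebesgue_measure R).

Let h (v : R) := rho (tau * v).
Let G (c v : R) := (h (v - c) - h v) * (f v - f (v - c)).

Let h_le v w : `|v| <= `|w| -> h v <= h w.
Proof. by move=> vw; apply: (smooth_le S); rewrite !normrM ler_wpM2l. Qed.

Let h_cont : continuous h.
Proof.
move=> v; apply: (@continuous_comp _ _ _ ( *%R tau) rho); first exact: mulrl_continuous.
exact: (smooth_continuous S).
Qed.

Let mh : measurable_fun setT h.
Proof. exact: continuous_measurable_fun. Qed.

(** [h] grows and [f] decays with the absolute value, so the two factors never have opposite
    signs. *)
Let G_ge0 c v : 0 <= G c v.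
Proof.
rewrite /G; case: (leP `|v| `|v - c|) => vc.
  by apply: mulr_ge0; rewrite subr_ge0; [exact: h_le|exact: f_noninc].
by apply: mulr_le0; rewrite subr_le0; [exact/h_le/ltW|exact/f_noninc/ltW].
Qed.

Let h_abs v : `|h v| <= 1.
Proof. by rewrite ger0_norm ?(smooth_ge0 S)// (smooth_le1 S). Qed.

Let h_even v : h (- v) = h v.
Proof. by rewrite /h mulrN (smooth_even S). Qed.

Lemma translation_gap_ge (c : R) (g : R -> R) :
  lambda.-integrable setT (EFin \o g) -> (forall v, g v <= G c v) ->
  \int[lambda]_v g v <= 2 * \int[F0]_v (rho (tau * (v - c)) - rho (tau * v)).
Proof.
move=> ig gG.
have [iG ->] := integral_translation_gap fd f_even c mh h_abs h_even.
exact: le_Rintegral.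
Qed.

Lemma density_lt0 c : c != 0 -> f c < f 0.
Proof.
move=> c0; have [e e0 fe] := f_dec0.
(* Strict decrease is known only near 0: it separates [f 0] from [f w], and plain monotonicity leads
   from [w] to [c]. *)
pose w := Num.min `|c| e / 2.
have w0 : 0 < w by rewrite divr_gt0// lt_min normr_gt0 c0.
have m1 : Num.min `|c| e <= `|c| by rewrite ge_min lexx.
have m2 : Num.min `|c| e <= e by rewrite ge_min lexx orbT.
have we : w < e by rewrite /w; lra.
have wc : w <= `|c| by rewrite /w; have := normr_ge0 c; lra.
apply: (@le_lt_trans _ _ (f w)).
  by apply: f_noninc; rewrite gtr0_norm.
by apply: fe; rewrite ?normr0 ?gtr0_norm.
Qed.

(** At [v = 0] the symmetrized integrand [G c] equals [rho (tau c) * (f 0 - f c)] up to the parity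
    of [rho] and [f], which is positive; by continuity it keeps half of this value on an
    interval. *)
Lemma translation_gap_gt0 c : c != 0 ->
  0 < \int[F0]_v (rho (tau * (v - c)) - rho (tau * v)).
Proof.
move=> c0.
have G0 : 0 < G c 0.
  rewrite /G sub0r h_even f_even /h mulr0 (smooth_0 S) subr0.
  rewrite mulr_gt0//; last by rewrite subr_gt0 density_lt0.
  by apply: (smooth_gt0 S); rewrite mulf_neq0// gt_eqF.
have cG : continuous (G c).
  move=> v; apply: cvgM; apply: cvgB.
  - apply: (@continuous_comp _ _ _ (fun v => v - c) h); last exact: h_cont.
    by apply: cvgB; [exact: cvg_id|exact: cvg_cst].
  - exact: h_cont.
  - exact: f_cont.
  - apply: (@continuous_comp _ _ _ (fun v => v - c) f); last exact: f_cont.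
    by apply: cvgB; [exact: cvg_id|exact: cvg_cst].
have G20 : 0 < G c 0 / 2 by rewrite divr_gt0.
have /cvgrPdist_le/(_ _ G20)[/= dl dl0 hdl] := cG 0.
have dl2 : - (dl / 2) <= dl / 2 by lra.
have [i1 e1] := integral_indic_itv true false dl2.
have i2 : lambda.-integrable setT (EFin \o (fun v => (G c 0 / 2) *
    (\1_[set` `[(- (dl / 2)), (dl / 2)]] v : R))).
  exact: eq_integrable (integrableZl measurableT (G c 0 / 2) i1).
have := translation_gap_ge i2; rewrite RintegralZl// e1 => H.
rewrite -(@pmulr_rgt0 _ 2)//; apply: lt_le_trans (H c _).
  by rewrite mulr_gt0//; lra.
move=> v; rewrite indicE; case: (boolP (_ \in _)) => hv; last by rewrite mulr0 G_ge0.
have : v \in `[(- (dl / 2)), (dl / 2)] by rewrite mem_setE in hv.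
rewrite in_itv/= => /andP[v1 v2]; rewrite mulr1.
have := hdl v; rewrite /= sub0r normrN.
have -> : `|v| < dl by rewrite ltr_norml; apply/andP; split; lra.
by move=> /(_ isT); rewrite ler_norml => /andP[]; lra.
Qed.

Lemma psi_gt0_interval e : 0 < e ->
  exists p q m, [/\ 0 < p, p < q, q < e, 0 < m &
    forall v, tau * p <= v <= tau * q -> m <= psi v].
Proof.
move=> e0.
have te0 : 0 < tau * e by rewrite mulr_gt0.
have [p1 /andP[p10 p1e] psip] := smooth_psi_gt0 S te0.
have psip2 : 0 < psi p1 / 2 by rewrite divr_gt0.
have cpsi : continuous psi by exact: (smooth_psi_continuous S).
have /cvgrPdist_le/(_ _ psip2)[/= dl dl0 hdl] := cpsi p1.
(* The first bound stays where [psi] exceeds half of [psi p1], the second keeps [q1] below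
   [tau * e]. *)
pose q1 := Num.min (p1 + dl / 2) ((p1 + tau * e) / 2).
have q1p : p1 < q1 by rewrite lt_min; apply/andP; split; lra.
have q1e : q1 < tau * e by rewrite gt_min; apply/orP; right; lra.
have q1d : q1 <= p1 + dl / 2 by rewrite ge_min lexx.
exists (p1 / tau), (q1 / tau), (psi p1 / 2); split => //.
- by rewrite divr_gt0.
- by rewrite ltr_pM2r// invr_gt0.
- by rewrite ltr_pdivrMr// mulrC.
- move=> v; rewrite ![tau * _]mulrC !divfK ?gt_eqF// => /andP[v1 v2].
  have := hdl v; rewrite /=.
  have -> : `|p1 - v| < dl by rewrite ltr_norml; apply/andP; split; lra.
  by move=> /(_ isT); rewrite ler_norml => /andP[]; lra.
Qed.

(** Positivity for each [c] would allow the remainder to degenerate as the shift tends to 0; here is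
    the rate that prevents it. One factor [c] comes from the increment of [h], whose slope is
    bounded below where [psi] is. The other comes from the integral of [f (v - c) - f v], which
    telescopes to two end intervals of length [c]; no derivative of [f] is involved. *)
Lemma translation_gap_quadratic : exists k c0, [/\ 0 < k, 0 < c0 &
  forall c, 0 < c <= c0 ->
    k * c ^+ 2 <= 2 * \int[F0]_v (rho (tau * (v - c)) - rho (tau * v))].
Proof.
have [e e0 fe] := f_dec0.
have [p [q [m [p0 pq qe m0 psim]]]] := psi_gt0_interval e0.
(* For [c <= (q - p) / 3] one has [p + c <= p'] and [q' <= q - c], so [f p' - f q'] is a gap that
   does not depend on [c]. *)
pose p' := p + (q - p) / 3; pose q' := q - (q - p) / 3.
have fpq : 0 < f p' - f q'.
  by rewrite subr_gt0; apply: fe; rewrite /p' /q' !gtr0_norm; lra.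
exists (tau * m * (f p' - f q')), ((q - p) / 3); split; [| lra |].
  by rewrite !mulr_gt0.
move=> c /andP[c0 cq].
have pcqc : p + c <= q - c by lra.
have ppc : p <= p + c by lra.
have qcq : q - c <= q by lra.
have f_noninc0 a a' : 0 < a -> a <= a' -> f a' <= f a.
  by move=> a0 aa'; apply: f_noninc; rewrite !gtr0_norm// (lt_le_trans a0).
have fp : f p' <= f (p + c) by apply: f_noninc0; rewrite /p'; lra.
have fq : f (q - c) <= f q' by apply: f_noninc0; rewrite /q'; lra.
have vcv v : p + c <= v -> f v <= f (v - c).
  by move=> pcv; apply: f_noninc0; lra.
have if0 := density_integrable fd.
have [mf f0 _] := fd.
have ind_int l r (a b : R) (g : R -> R) : lambda.-integrable setT (EFin \o g) ->
    measurable_fun setT g ->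
    lambda.-integrable setT
      (EFin \o (fun v => (\1_[set` Interval (BSide l a) (BSide r b)] v : R) * g v)).
  move=> ig mg; apply: (@integrable_dom _ _ _ lambda _ (fun v => `|g v|)).
  - by apply: measurable_funM => //; exact: measurable_indic.
  - exact: eq_integrable (integrable_norm ig).
  - move=> v; rewrite normrM ler_piMl// indicE.
    by rewrite ger0_norm// lern1 leq_b1.
have mfc : measurable_fun setT (fun v : R => f (v - c)).
  by apply: measurableT_comp => //; exact: measurable_funB.
have [ifc efc] := integral_translation c if0.
have i1 := ind_int true false (p + c) q _ ifc mfc.
have i2 := ind_int true false (p + c) q _ if0 mf.
have i3 := ind_int true false p (q - c) _ if0 mf.
have e1 : \int[lambda]_v ((\1_[set` `[p + c, q]] v : R) * f (v - c)) =
    \int[lambda]_v ((\1_[set` `[p, q - c]] v : R) * f v).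
  have [_ <-] := integral_translation c i3.
  apply: eq_Rintegral => v _; congr (_ * _); rewrite !indicE; congr (nat_of_bool _)%:R.
  by rewrite !mem_setE !in_itv/=; apply/idP/idP => /andP[? ?]; apply/andP; split; lra.
have i12 : lambda.-integrable setT (EFin \o (fun v =>
    (\1_[set` `[p + c, q]] v : R) * f (v - c) - (\1_[set` `[p + c, q]] v : R) * f v)).
  exact: eq_integrable (integrableB measurableT i1 i2).
have i12' : lambda.-integrable setT (EFin \o (fun v => (tau * m * c) *
    ((\1_[set` `[p + c, q]] v : R) * f (v - c) - (\1_[set` `[p + c, q]] v : R) * f v))).
  exact: eq_integrable (integrableZl measurableT (tau * m * c) i12).
have low : c * (f p' - f q') <= \int[lambda]_v
    ((\1_[set` `[p + c, q]] v : R) * f (v - c) - (\1_[set` `[p + c, q]] v : R) * f v).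
  rewrite RintegralB// e1 -RintegralB//.
  have [j1 d1] := integral_indic_itv true true ppc.
  have [j2 d2] := integral_indic_itv false false qcq.
  have j1' : lambda.-integrable setT (EFin \o (fun v => f (p + c) * (\1_[set` `[p, p + c[] v : R))).
    exact: eq_integrable (integrableZl measurableT _ j1).
  have j2' : lambda.-integrable setT (EFin \o (fun v => f (q - c) * (\1_[set` `]q - c, q]] v : R))).
    exact: eq_integrable (integrableZl measurableT _ j2).
  apply: (@le_trans _ _ (\int[lambda]_v (f (p + c) * (\1_[set` `[p, p + c[] v : R) -
      f (q - c) * (\1_[set` `]q - c, q]] v : R)))).
    rewrite RintegralB// !RintegralZl// d1 d2.
    rewrite (_ : p + c - p = c); last ring.
    rewrite (_ : q - (q - c) = c); last ring.
    by rewrite -mulrBl mulrC ler_wpM2r ?(ltW c0)// lerB.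
  apply: le_Rintegral => //.
  - exact: eq_integrable (integrableB measurableT j1' j2').
  - exact: eq_integrable (integrableB measurableT i3 i2).
  move=> v _; rewrite !indicE !mem_setE !in_itv/=.
  exact: shifted_interval_le.
apply: (@le_trans _ _ (\int[lambda]_v ((tau * m * c) *
    ((\1_[set` `[p + c, q]] v : R) * f (v - c) - (\1_[set` `[p + c, q]] v : R) * f v)))).
  rewrite RintegralZl//.
  rewrite (_ : _ * c ^+ 2 = (tau * m * c) * (c * (f p' - f q'))); last ring.
  by rewrite ler_wpM2l// !mulr_ge0// ltW.
apply: translation_gap_ge i12' _ => v.
rewrite -mulrBr indicE; case: (boolP (_ \in _)) => hv; last by rewrite mul0r mulr0.
have : v \in `[(p + c), q] by rewrite mem_setE in hv.
rewrite in_itv/= => /andP[v1 v2]; rewrite mul1r /G.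
(* On [[p + c, q]] both factors of [G c v] are nonpositive; both signs are flipped. *)
rewrite -[X in _ <= X]mulrNN !opprB ler_wpM2r//.
  by rewrite subr_ge0 vcv.
have [x x0 e2] := mvt (tau * (v - c)) (tau * v) (smooth_psi S).
rewrite /h e2 (_ : tau * v - tau * (v - c) = tau * c); last ring.
rewrite (_ : tau * m * c = m * (tau * c)); last ring.
rewrite ler_wpM2r//; first by rewrite mulr_ge0// ltW.
apply: psim; move: x0; rewrite min_l ?max_r ?ler_pM2l//; try lra.
move=> /andP[x1 x2]; apply/andP; split.
  by apply: le_trans x1; rewrite ler_pM2l//; lra.
by apply: (le_trans x2); rewrite ler_pM2l.
Qed.

End density_gap.

(** * Positivity of the mean Taylor remainder *)

Lemma Rintegral_gt0 {R : realType} {d} {Z : measurableType d}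
    (mu : {measure set Z -> \bar R}) (g : Z -> R) :
  mu.-integrable setT (EFin \o g) -> (forall z, 0 <= g z) ->
  (0 < mu [set z | g z != 0%R])%E -> 0 < \int[mu]_z g z.
Proof.
move=> ig g0 mg; rewrite lt0r Rintegral_ge0// andbT; apply/negP => /eqP i0.
have mEg : measurable_fun setT (EFin \o g) by exact: measurable_int ig.
have : (\int[mu]_(z in setT) `|(EFin \o g) z| = 0)%E.
  under eq_integral do rewrite /= ger0_norm//.
  by rewrite -(fineK (integrable_fin_num measurableT ig)) -/(Rintegral _ _ _) i0.
move=> /(ae_eq_integral_abs _ measurableT mEg)[N [mN N0 gN]].
have : (mu [set z | g z != 0%R] <= mu N)%E.
  apply: le_measure; rewrite ?inE//.
    rewrite -[X in measurable X]setTI.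
    rewrite (_ : [set z | g z != 0] = g @^-1` (~` [set 0])); last first.
      by apply/seteqP; split => z /= /eqP.
    apply: (integrable_measurable ig) => //.
    by apply: measurableC; exact: measurable_set1.
  move=> z /= /eqP gz; apply: gN => /= /(_ I) [].
  exact: gz.
by rewrite N0 leNgt mg.
Qed.

Lemma Rintegral_fubini {R : realType} {d1 d2} {X : measurableType d1}
    {Y : measurableType d2} (m1 : probability X R) (m2 : probability Y R)
    (f : X * Y -> R) :
  (m1 \x m2)%E.-integrable setT (EFin \o f) ->
  (forall x, m2.-integrable setT (EFin \o (fun y => f (x, y)))) ->
  m1.-integrable setT (EFin \o (fun x => \int[m2]_y f (x, y))) /\
  \int[(m1 \x m2)%E]_z f z = \int[m1]_x \int[m2]_y f (x, y).
Proof.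
move=> jf jx.
have E : fubini_F m2 (EFin \o f) = EFin \o (fun x => \int[m2]_y f (x, y)).
  by apply/funext => x; rewrite /fubini_F /= fineK//; exact: integrable_fin_num (jx x).
split; first by rewrite -E; exact: integrable_fubini_F.
by rewrite [in LHS]/Rintegral -integral12_prod_meas1// E.
Qed.

Section taylor_mean.
Context {R : realType} (F0 : probability R R) (f : R -> R).
Hypothesis fd : has_density F0 f.
Hypothesis f_even : even_fun f.
Hypothesis f_cont : continuous f.
Hypothesis f_noninc : abs_nonincreasing f.
Hypothesis f_dec0 : abs_decreasing_near0 f.
Context (rho psi dpsi : R -> R) (M C : R).
Hypothesis S : smooth_rho rho psi dpsi M C.
Context (tau : R).
Hypothesis tau_gt0 : 0 < tau.
Let Q := taylor_rem rho psi dpsi.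

Lemma measurable_scale_comp (g : R -> R) (a : R) :
  continuous g -> measurable_fun setT (fun v : R => g (a * v)).
Proof.
move=> cg; apply: measurableT_comp; first exact: continuous_measurable_fun.
exact: measurable_funM.
Qed.

Lemma measurable_taylor_rem h : measurable_fun setT (fun v : R => Q (tau * v) h).
Proof.
apply: continuous_measurable_fun => v.
apply: (@continuous_comp _ _ _ (fun v => (tau * v, h)) (fun p => Q p.1 p.2)).
  exact: (cvg_pair (@mulrl_continuous _ tau v) (cvg_cst _)).
exact: (taylor_rem_continuous S).
Qed.

Lemma integrable_taylor_rem h :
  F0.-integrable setT (EFin \o (fun v : R => Q (tau * v) h)).
Proof.
apply: (@integrable_bounded _ _ _ _ _ C); first exact: measurable_taylor_rem.
by move=> v; exact: (taylor_rem_le S).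
Qed.

Lemma integral_psi0 : F0.-integrable setT (EFin \o (fun v : R => psi (tau * v))) /\
  \int[F0]_v psi (tau * v) = 0.
Proof.
have mp := measurable_scale_comp tau (smooth_psi_continuous S).
have pC v : `|psi (tau * v)| <= C by exact: (smooth_psi_le S).
split; first exact: integrable_bounded mp pC.
apply: (integral_odd fd f_even mp pC) => v.
by rewrite mulrN (smooth_psi_odd S).
Qed.

(** The linear term has mean 0 because [psi] is odd and [f] even, so only the translation gap is
    left. *)
Lemma integral_taylor_rem s :
  (\int[F0]_v Q (tau * v) (tau * s)) * (tau * s) ^+ 2 =
  \int[F0]_v (rho (tau * (v - s)) - rho (tau * v)).
Proof.
rewrite -RintegralZr//; last exact: integrable_taylor_rem.
have [ip p0] := integral_psi0.
have mr : measurable_fun setT (fun v : R => rho (tau * (v - s)) - rho (tau * v)).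
  apply: measurable_funB; last exact: measurable_scale_comp (smooth_continuous S).
  apply: (@measurableT_comp _ _ _ _ _ _ (fun v => rho (tau * v))).
    exact: measurable_scale_comp (smooth_continuous S).
  exact: measurable_funB.
have ir : F0.-integrable setT (EFin \o (fun v : R => rho (tau * (v - s)) - rho (tau * v))).
  apply: (@integrable_bounded _ _ _ _ _ 1 mr) => v.
  rewrite ler_norml.
  have := smooth_ge0 S (tau * (v - s)); have := smooth_le1 S (tau * (v - s)).
  have := smooth_ge0 S (tau * v); have := smooth_le1 S (tau * v).
  by move=> *; apply/andP; split; lra.
have ip' : F0.-integrable setT (EFin \o (fun v : R => psi (tau * v) * (tau * s))).
  exact: eq_integrable (integrableZr measurableT (tau * s) ip).
transitivity (\int[F0]_v ((rho (tau * (v - s)) - rho (tau * v)) + psi (tau * v) * (tau * s))).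
  by apply: eq_Rintegral => v _; rewrite /Q -taylor_remE mulrBr.
by rewrite RintegralD// RintegralZr// p0 mul0r addr0.
Qed.

(** For [s != 0] this is the translation gap divided by a square. At [s = 0] the mean is a limit
    along shifts [c0 / (n + 1)], by dominated convergence with bound [C], and the quadratic estimate
    keeps the means above [k / (2 * tau ^+ 2)]. *)
Lemma taylor_mean_gt0 s : 0 < \int[F0]_v Q (tau * v) (tau * s).
Proof.
have [->|s0] := eqVneq s 0; last first.
  have : 0 < (tau * s) ^+ 2 by rewrite lt0r sqr_ge0 expf_neq0// mulf_neq0// gt_eqF.
  move=> h; rewrite -(pmulr_lgt0 _ h) integral_taylor_rem.
  exact: (translation_gap_gt0 fd _ _ _ _ S).
have [k [c0 [k0 c00 H]]] := translation_gap_quadratic fd f_even f_noninc f_dec0 S tau_gt0.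
pose c n : R := c0 / n.+1%:R.
have cc n : 0 < c n <= c0.
  rewrite /c divr_gt0//= ler_pdivrMr// ler_peMr// ?(ltW c00)//.
  by rewrite ler1n.
have low n : k / (2 * tau ^+ 2) <= \int[F0]_v Q (tau * v) (tau * c n).
  have /andP[cn0 _] := cc n.
  have h : 0 < (tau * c n) ^+ 2 by rewrite exprn_gt0// mulr_gt0.
  rewrite -(ler_pM2r h) integral_taylor_rem -(@ler_pM2l _ 2)//.
  apply: le_trans (H _ (cc n)); rewrite le_eqVlt; apply/orP; left; apply/eqP.
  by field; rewrite gt_eqF.
rewrite mulr0; apply: (@lt_le_trans _ _ (k / (2 * tau ^+ 2))).
  by rewrite divr_gt0// mulr_gt0// exprn_gt0.
have c_cvg : tau * c n @[n --> \oo] --> (0 : R).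
  rewrite -[X in _ --> X](mulr0 tau); apply: cvgM; first exact: cvg_cst.
  rewrite -[X in _ --> X](mulr0 c0); apply: cvgM; first exact: cvg_cst.
  exact: cvg_harmonic.
have ptw v : (Q (tau * v) (tau * c n))%:E @[n --> \oo] --> (Q (tau * v) 0)%:E.
  apply: cvg_EFin; first exact: nearW.
  have cQ : continuous (fun p : R * R => Q p.1 p.2) by exact: (taylor_rem_continuous S).
  exact: (cvg_comp _ _ (cvg_pair (cvg_cst (tau * v)) c_cvg) (cQ (tau * v, 0))).
have [_ _] := @dominated_convergence _ _ _ F0 setT measurableT
  (fun n v => (Q (tau * v) (tau * c n))%:E) (fun v => (Q (tau * v) 0)%:E) (cst C%:E)
  (fun n => (measurable_EFinP _ _).2 (measurable_taylor_rem _))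
  ((measurable_EFinP _ _).2 (measurable_taylor_rem _))
  (aeW _ (fun v _ => ptw v)) (finite_measure_integrable_cst F0 C measurableT)
  (aeW _ (fun v n _ => taylor_rem_le S _ _)).
rewrite -(fineK (integrable_fin_num measurableT (integrable_taylor_rem 0))).
move=> /fine_cvgP[_ lim].
by apply: (cvgr_to_ge lim); near=> n; exact: low.
Unshelve. all: by end_near. Qed.

End taylor_mean.

(** * Local minorants of the Taylor remainder of the loss *)

(** Compactness as an induction principle: a property of sets that is local and stable under subsets
    and unions holds on [K]. This is what replaces explicit finite subcovers below. *)
Lemma compact_induction {X : topologicalType} (K : set X) (Phi : set X -> Prop) :
  compact K -> Phi set0 -> (forall U V, V `<=` U -> Phi U -> Phi V) ->
  (forall U V, Phi U -> Phi V -> Phi (U `|` V)) ->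
  (forall x, K x -> exists2 U, nbhs x U & Phi U) -> Phi K.
Proof.
move=> /compact_near_coveringP cK Phi0 PhiS PhiU Phinbhs.
have FF : Filter [set A | Phi (~` A)].
  split => /=; first by rewrite setCT.
    by move=> A B /= PA PB; rewrite setCI; exact: PhiU.
  by move=> A B AB /=; apply: PhiS => x Bx /AB.
(* The sets with complement in [Phi] form a filter. The near-covering property, applied to the
   relation [i <> y], shows that the points avoiding [K] belong to it, and their complement contains
   [K]. *)
suff : Phi (~` [set i | forall y, K y -> i <> y]).
  by apply: PhiS => x Kx /= /(_ x Kx).
apply: (cK X [set A | Phi (~` A)] (fun i y => i <> y) FF) => y Ky.
have [U yU PhiU'] := Phinbhs y Ky.
exists (U, ~` U); first by split => //; rewrite /nbhs /= setCK.
by move=> [y' i] [/= Uy' Ui] iy; apply: Ui; rewrite iy.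
Qed.

Section row_vectors.
Context {R : realType} {p : nat}.
Implicit Types x e : 'rV[R]_p.

(** Dual to the sup norm of row vectors in [dotv_le]; being a sum of coordinates, it is visibly
    measurable. *)
Definition l1norm x : R := \sum_j `|x 0 j|.

Lemma dotvE x e : dotv x e = \sum_j x 0 j * e 0 j.
Proof. by rewrite /dotv mxE; apply: eq_bigr => j _; rewrite mxE. Qed.

Lemma dotvZ x e (a : R) : dotv x (a *: e) = a * dotv x e.
Proof.
rewrite !dotvE mulr_sumr; apply: eq_bigr => j _; rewrite mxE; ring.
Qed.

Lemma dotvB x e e' : dotv x (e - e') = dotv x e - dotv x e'.
Proof.
rewrite !dotvE -sumrB; apply: eq_bigr => j _; rewrite !mxE; ring.
Qed.

Lemma dotv0 x : dotv x 0 = 0.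
Proof. by rewrite dotvE big1// => j _; rewrite mxE mulr0. Qed.

Lemma coord_norm_le e j : `|e 0 j| <= `|e|.
Proof.
rewrite [leRHS]/Num.Def.normr/= mx_normrE.
by apply: (@le_bigmax _ _ _ 0 (fun k : 'I_1 * 'I_p => `|e k.1 k.2|) (0, j)).
Qed.

Lemma l1norm_ge0 x : 0 <= l1norm x.
Proof. exact: sumr_ge0. Qed.

Lemma norm_le_l1norm x : `|x| <= l1norm x.
Proof.
rewrite [leLHS]/Num.Def.normr/= mx_normrE.
apply: bigmax_le; first exact: l1norm_ge0.
by move=> [i j] _ /=; rewrite ord1 /l1norm (bigD1 j)//= lerDl sumr_ge0.
Qed.

Lemma dotv_le x e : `|dotv x e| <= l1norm x * `|e|.
Proof.
rewrite dotvE (le_trans (ler_norm_sum _ _ _))// mulr_suml.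
by apply: ler_sum => j _; rewrite normrM ler_wpM2l// coord_norm_le.
Qed.

Lemma dotv_continuous : continuous (fun q : 'rV[R]_p * 'rV[R]_p => dotv q.1 q.2).
Proof.
rewrite (_ : (fun q => _) = fun q : 'rV[R]_p * 'rV[R]_p => \sum_j q.1 0 j * q.2 0 j); last first.
  by apply/funext => q; rewrite dotvE.
move=> q; apply: cvg_big => [|j _]; first exact: add_continuous.
have c1 : q'.1 @[q' --> q] --> q.1 by exact: cvg_fst.
have c2 : q'.2 @[q' --> q] --> q.2 by exact: cvg_snd.
apply: cvgM.
  exact: (cvg_comp _ _ c1 (@coord_continuous _ _ _ _ _ _)).
exact: (cvg_comp _ _ c2 (@coord_continuous _ _ _ _ _ _)).
Qed.

Lemma measurable_coord (j : 'I_p) :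
  measurable_fun setT (fun v : 'rV[R]_p => v 0 j).
Proof.
move=> _ Y mY; rewrite setTI; apply: sub_sigma_algebra => /=.
rewrite -bigcup_seq/=; exists j => /=; first by rewrite mem_index_enum.
by exists Y => //; rewrite setTI.
Qed.

Lemma measurable_dotv e : measurable_fun setT (fun x => dotv x e).
Proof.
rewrite (_ : (fun x => _) = fun x => \sum_j x 0 j * e 0 j); last first.
  by apply/funext => x; rewrite dotvE.
by apply: measurable_sum => j; apply: measurable_funM => //; exact: measurable_coord.
Qed.

Lemma measurable_l1norm : measurable_fun setT l1norm.
Proof.
apply: measurable_sum => j; apply: measurableT_comp => //; exact: measurable_coord.
Qed.

End row_vectors.

Section product_law.
Context {R : realType} {d1 d2} {X : measurableType d1} {Y : measurableType d2}
  (m1 : probability X R) (m2 : probability Y R).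

Lemma integral_fst (g : X -> R) : m1.-integrable setT (EFin \o g) ->
  (m1 \x m2)%E.-integrable setT (EFin \o (fun z : X * Y => g z.1)) /\
  \int[(m1 \x m2)%E]_z g z.1 = \int[m1]_x g x.
Proof.
apply: integral_measure_preserving => // A mA.
rewrite (_ : fst @^-1` A = A `*` setT); last first.
  by apply/seteqP; split => z //= [].
by rewrite /= product_measure1E//= (@probability_setT _ _ _ m2) mule1.
Qed.

End product_law.

Lemma integrable_sum_fin {R : realType} {d} {Z : measurableType d}
    (mu : {measure set Z -> \bar R}) (I : finType) (h : I -> Z -> R) :
  (forall i, mu.-integrable setT (EFin \o h i)) ->
  mu.-integrable setT (EFin \o (fun z => \sum_i h i z)) /\
  \int[mu]_z (\sum_i h i z) = \sum_i \int[mu]_z h i z.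
Proof.
move=> hi.
suff H : forall s : seq I,
  mu.-integrable setT (EFin \o (fun z => \sum_(i <- s) h i z)) /\
  \int[mu]_z (\sum_(i <- s) h i z) = \sum_(i <- s) \int[mu]_z h i z.
  exact: H.
elim => [|i s [IH1 IH2]].
  under eq_fun do rewrite big_nil.
  rewrite big_nil; split; first exact: integrable0.
  by rewrite /Rintegral integral0.
under eq_fun do rewrite big_cons.
rewrite big_cons; split; first exact: eq_integrable (integrableD measurableT (hi i) IH1).
by rewrite RintegralD// IH2.
Qed.

Section loss_law.
Context {R : realType} {p : nat} (G0 : probability 'rV[R]_p R)
  (F0 : probability R R) (f : R -> R).
Hypothesis fd : has_density F0 f.
Hypothesis f_even : even_fun f.
Hypothesis f_cont : continuous f.
Hypothesis f_noninc : abs_nonincreasing f.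
Hypothesis f_dec0 : abs_decreasing_near0 f.
Hypothesis G2 : forall j, G0.-integrable setT (EFin \o (fun v : 'rV[R]_p => v 0 j ^+ 2)).
Hypothesis G_nd : forall e : 'rV[R]_p, e != 0 -> (0 < G0 [set v | dotv v e != 0%R])%E.
Context (rho psi dpsi : R -> R) (M C : R).
Hypothesis S : smooth_rho rho psi dpsi M C.
Let Q := taylor_rem rho psi dpsi.
Local Notation mu := (G0 \x F0)%E.

Lemma integrable_l1norm2 : G0.-integrable setT (EFin \o (fun v => l1norm v ^+ 2)).
Proof.
have h j k : G0.-integrable setT (EFin \o (fun v : 'rV[R]_p => v 0 j ^+ 2 + v 0 k ^+ 2)).
  exact: eq_integrable (integrableD measurableT (G2 j) (G2 k)).
have [i1 _] := integrable_sum_fin (fun j => (integrable_sum_fin (h j)).1).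
apply: (integrable_dom _ i1).
  by apply: measurable_funX; exact: measurable_l1norm.
move=> v; rewrite ger0_norm ?sqr_ge0// expr2 {1}/l1norm mulr_suml.
apply: ler_sum => j _; rewrite mulr_sumr; apply: ler_sum => k _.
rewrite -[v 0 j ^+ 2]real_normK ?num_real// -[v 0 k ^+ 2]real_normK ?num_real//.
have := sqr_ge0 (`|v 0 j| - `|v 0 k|).
have := sqr_ge0 (`|v 0 j|); have := sqr_ge0 (`|v 0 k|).
rewrite !expr2; set a := `|v 0 j|; set b := `|v 0 k|.
move=> ? ? ?; nra.
Qed.

(* For th = (e, (r, tau)): the Taylor remainder of the loss at r *: e divided by
   r ^ 2, extended continuously to r = 0. *)
Definition scaled_rem (th : 'rV[R]_p * (R * R)) (z : 'rV[R]_p * R) : R :=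
  (th.2.2 * dotv z.1 th.1) ^+ 2 *
    Q (th.2.2 * z.2) (th.2.2 * (th.2.1 * dotv z.1 th.1)).

Lemma scaled_rem_continuous : continuous (fun q => scaled_rem q.1 q.2).
Proof.
move=> q; rewrite /scaled_rem /continuous_at.
have c1 : q'.1 @[q' --> q] --> q.1 by exact: cvg_fst.
have c2 : q'.2 @[q' --> q] --> q.2 by exact: cvg_snd.
have c11 : q'.1.1 @[q' --> q] --> q.1.1 by exact: (cvg_comp _ _ c1 cvg_fst).
have c12 : q'.1.2 @[q' --> q] --> q.1.2 by exact: (cvg_comp _ _ c1 cvg_snd).
have c121 : q'.1.2.1 @[q' --> q] --> q.1.2.1 by exact: (cvg_comp _ _ c12 cvg_fst).
have c122 : q'.1.2.2 @[q' --> q] --> q.1.2.2 by exact: (cvg_comp _ _ c12 cvg_snd).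
have c21 : q'.2.1 @[q' --> q] --> q.2.1 by exact: (cvg_comp _ _ c2 cvg_fst).
have c22 : q'.2.2 @[q' --> q] --> q.2.2 by exact: (cvg_comp _ _ c2 cvg_snd).
have cd : dotv q'.2.1 q'.1.1 @[q' --> q] --> dotv q.2.1 q.1.1.
  exact: (cvg_comp _ _ (cvg_pair c21 c11) (@dotv_continuous R p (q.2.1, q.1.1))).
have cQ : continuous (fun p : R * R => Q p.1 p.2) by exact: (taylor_rem_continuous S).
have ctd : q'.1.2.2 * dotv q'.2.1 q'.1.1 @[q' --> q] --> q.1.2.2 * dotv q.2.1 q.1.1.
  exact: cvgM.
apply: cvgM; first exact: (cvgM ctd ctd).
have cu : q'.1.2.2 * q'.2.2 @[q' --> q] --> q.1.2.2 * q.2.2 by exact: cvgM.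
have crd : q'.1.2.1 * dotv q'.2.1 q'.1.1 @[q' --> q] --> q.1.2.1 * dotv q.2.1 q.1.1.
  exact: cvgM.
have ch : q'.1.2.2 * (q'.1.2.1 * dotv q'.2.1 q'.1.1) @[q' --> q] -->
    q.1.2.2 * (q.1.2.1 * dotv q.2.1 q.1.1) by exact: cvgM.
exact: (cvg_comp _ _ (cvg_pair cu ch) (cQ (_, _))).
Qed.

Lemma scaled_remE th z : th.2.1 != 0 ->
  scaled_rem th z = (rho (th.2.2 * (z.2 - dotv z.1 (th.2.1 *: th.1))) -
    rho (th.2.2 * z.2) +
    psi (th.2.2 * z.2) * (th.2.2 * dotv z.1 (th.2.1 *: th.1))) / th.2.1 ^+ 2.
Proof.
move=> r0; rewrite dotvZ mulrBr (taylor_remE rho psi dpsi) -/Q /scaled_rem.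
by field.
Qed.

Lemma scaled_rem_le th z :
  `|scaled_rem th z| <= C * (th.2.2 * (l1norm z.1 * `|th.1|)) ^+ 2.
Proof.
rewrite normrM mulrC; apply: ler_pM => //; first exact: (taylor_rem_le S).
rewrite ger0_norm ?sqr_ge0//.
rewrite -[leLHS]real_normK ?num_real// -[leRHS]real_normK ?num_real//.
rewrite ler_pXn2r ?nnegrE// normrM [leRHS]normrM ler_wpM2l//.
exact: le_trans (dotv_le _ _) (ler_norm _).
Qed.

Lemma measurable_scaled_rem th : measurable_fun setT (scaled_rem th).
Proof.
case: th => e [r t].
have md : measurable_fun setT (fun z : 'rV[R]_p * R => dotv z.1 e).
  exact: (measurableT_comp (measurable_dotv e) measurable_fst).
have [r0|r0] := eqVneq r 0.
  rewrite /scaled_rem /=; apply: measurable_funM; first by apply: measurable_funX; exact: measurable_funM.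
  rewrite r0 /=.
  have -> : (fun z : 'rV[R]_p * R => Q (t * z.2) (t * (0 * dotv z.1 e))) =
      (fun v => Q (t * v) 0) \o snd.
    by apply/funext => z /=; rewrite mul0r mulr0.
  exact: (measurableT_comp (measurable_taylor_rem S t 0) measurable_snd).
have m2 : measurable_fun setT (fun z : 'rV[R]_p * R => t * z.2).
  exact: measurable_funM.
have md' : measurable_fun setT (fun z : 'rV[R]_p * R => dotv z.1 (r *: e)).
  exact: (measurableT_comp (measurable_dotv (r *: e)) measurable_fst).
have mr (g : R -> R) : continuous g -> measurable_fun setT g.
  exact: continuous_measurable_fun.
rewrite (_ : scaled_rem _ = fun z => (rho (t * (z.2 - dotv z.1 (r *: e))) -
    rho (t * z.2) + psi (t * z.2) * (t * dotv z.1 (r *: e))) / r ^+ 2); last first.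
  by apply/funext => z; rewrite scaled_remE.
apply: measurable_funM => //; apply: measurable_funD; last first.
  apply: measurable_funM; last exact: measurable_funM.
  by apply: measurableT_comp m2; apply: mr; exact: (smooth_psi_continuous S).
apply: measurable_funB.
  apply: measurableT_comp; first by apply: mr; exact: (smooth_continuous S).
  by apply: measurable_funM => //; exact: measurable_funB.
by apply: measurableT_comp m2; apply: mr; exact: (smooth_continuous S).
Qed.

Lemma integrable_l1norm2_mu B :
  mu.-integrable setT (EFin \o (fun z : 'rV[R]_p * R => B * l1norm z.1 ^+ 2)).
Proof.
have [i1 _] := integral_fst F0 integrable_l1norm2.
exact: eq_integrable (integrableZl measurableT B i1).
Qed.

Lemma scaled_rem_le2 th z : `|scaled_rem th z| <=
  C * (th.2.2 * `|th.1|) ^+ 2 * l1norm z.1 ^+ 2.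
Proof.
apply: (le_trans (scaled_rem_le th z)); rewrite le_eqVlt; apply/orP; left.
by apply/eqP; ring.
Qed.

Lemma integrable_scaled_rem th : mu.-integrable setT (EFin \o scaled_rem th).
Proof.
apply: integrable_dom (integrable_l1norm2_mu (C * (th.2.2 * `|th.1|) ^+ 2)) _.
  exact: measurable_scaled_rem.
exact: scaled_rem_le2.
Qed.

(** Given the design vector, the mean over the error is [(t * dotv x e) ^+ 2] times a positive
    number. It vanishes only where [dotv x e = 0], and the complement of that set has positive
    probability. *)
Lemma scaled_rem_mean_gt0 th : th.1 != 0 -> 0 < th.2.2 ->
  0 < \int[mu]_z scaled_rem th z.
Proof.
case: th => e [r t] /= e0 t0.
pose J c := \int[F0]_v Q (t * v) (t * c).
have J0 c : 0 < J c := taylor_mean_gt0 fd f_even f_cont f_noninc f_dec0 S t0 c.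
have sec x : F0.-integrable setT (EFin \o (fun v => scaled_rem (e, (r, t)) (x, v))).
  have := integrableZl measurableT ((t * dotv x e) ^+ 2)
    (integrable_taylor_rem F0 S t (t * (r * dotv x e))).
  exact: eq_integrable.
have [i1 ->] := Rintegral_fubini (integrable_scaled_rem (e, (r, t))) sec.
have E x : \int[F0]_v scaled_rem (e, (r, t)) (x, v) =
    (t * dotv x e) ^+ 2 * J (r * dotv x e).
  by rewrite /scaled_rem /= RintegralZl//; exact: integrable_taylor_rem S _ _.
have ge0 x : 0 <= \int[F0]_v scaled_rem (e, (r, t)) (x, v).
  by rewrite E mulr_ge0 ?sqr_ge0// ltW.
apply: Rintegral_gt0 => //.
rewrite (_ : [set x | _] = [set v | dotv v e != 0]); first exact: G_nd.
apply/seteqP; split => x /=; rewrite E.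
  by apply: contraNneq => ->; rewrite mulr0 expr0n mul0r.
by move=> d0; rewrite mulf_neq0// ?expf_neq0 ?mulf_neq0// gt_eqF.
Qed.

(** Wald's device with an explicit minorant in place of an infimum over a neighbourhood:
    [scaled_rem th0 - m / 4 - g]. On the part with [N z <= A], which lies in a compact set, uniform
    continuity costs at most [m / 4]; elsewhere [g] takes over. The mean is at least [m / 2]. *)
Lemma scaled_rem_minorant (th0 : 'rV[R]_p * (R * R)) : th0.1 != 0 -> 0 < th0.2.2 ->
  exists l : 'rV[R]_p * R -> R, [/\ mu.-integrable setT (EFin \o l),
    0 < \int[mu]_z l z & \forall th \near th0, forall z, l z <= scaled_rem th z].
Proof.
move=> e0 t0; pose m := \int[mu]_z scaled_rem th0 z.
have m0 : 0 < m by exact: scaled_rem_mean_gt0.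
have im := integrable_scaled_rem th0.
(* The two summands 1 leave room for parameters near [th0], so that one dominating function serves
   them all. *)
pose B := C * ((th0.2.2 + 1) * (`|th0.1| + 1)) ^+ 2.
have B0 : 0 <= B by rewrite mulr_ge0 ?sqr_ge0// ltW// (smooth_C_gt0 S).
have near_le : \forall th \near th0, forall z, `|scaled_rem th z| <= B * l1norm z.1 ^+ 2.
  have n1 : \forall th \near th0, `|th.1| < `|th0.1| + 1.
    have c1 : `|th.1| @[th --> th0] --> `|th0.1|.
      by apply: cvg_norm; exact: cvg_fst.
    by apply: (cvgr_lt _ c1); rewrite ltrDl.
  have n2 : \forall th \near th0, 0 < th.2.2 < th0.2.2 + 1.
    have c1 : th.2.2 @[th --> th0] --> th0.2.2.
      exact: (cvg_comp _ _ cvg_snd cvg_snd).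
    near=> th; apply/andP; split.
      by near: th; exact: (cvgr_gt _ c1).
    by near: th; apply: (cvgr_lt _ c1); rewrite ltrDl.
  near=> th => z; apply: (le_trans (scaled_rem_le2 _ _)).
  rewrite ler_wpM2r ?sqr_ge0// /B ler_wpM2l ?(ltW (smooth_C_gt0 S))//.
  have /andP[th0' th1] : 0 < th.2.2 < th0.2.2 + 1 by near: th.
  have thn : `|th.1| < `|th0.1| + 1 by near: th.
  rewrite ler_pXn2r ?nnegrE//; first by rewrite ler_pM// ltW.
    by rewrite mulr_ge0// ltW.
  by rewrite mulr_ge0// addr_ge0// ltW.
pose N (z : 'rV[R]_p * R) := Num.max (l1norm z.1) `|z.2|.
have mN : measurable_fun setT N.
  apply: measurable_maxr; first by apply: measurableT_comp => //; exact: measurable_l1norm.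
  by apply: measurableT_comp => //; exact: measurable_snd.
have m8 : 0 < m / 4 by rewrite divr_gt0.
have g0 (z : 'rV[R]_p * R) : 0 <= 2 * B * l1norm z.1 ^+ 2.
  by rewrite mulr_ge0 ?sqr_ge0// mulr_ge0.
have ig := integrable_l1norm2_mu (2 * B).
have [A A0 tA] := tail_integral ig g0 mN m8.
(* The factor 2 absorbs the difference of two remainders, each bounded by [B * l1norm z.1 ^+ 2]. *)
pose g z := 2 * B * l1norm z.1 ^+ 2 * (A < N z)%R%:R.
have mg : measurable_fun setT g.
  apply: measurable_funM; last exact: measurable_ltr_indic.
  exact: integrable_measurable ig.
have igg : mu.-integrable setT (EFin \o g).
  apply: (integrable_dom mg ig) => z; rewrite normrM [X in _ * X]ger0_norm//.
  by rewrite ger0_norm// ler_piMr// lern1 leq_b1.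
have ic : mu.-integrable setT (EFin \o (fun=> m / 4)).
  by apply: (@integrable_bounded _ _ _ mu _ `|m / 4|).
have i1 : mu.-integrable setT (EFin \o (fun z => scaled_rem th0 z - m / 4)).
  exact: eq_integrable (integrableB measurableT im ic).
exists (fun z => scaled_rem th0 z - m / 4 - g z); split.
- exact: eq_integrable (integrableB measurableT i1 igg).
- rewrite RintegralB// RintegralB// Rintegral_probability_cst -/m.
  by move: tA; rewrite -/g; lra.
- pose K := [set x : 'rV[R]_p | `|x| <= A] `*` [set v : R | `|v| <= A].
  have cK : compact K.
    apply: compact_setX.
      apply: bounded_closed_compact.
        by exists A; split; [exact: num_real|move=> b Ab x /= xA; rewrite (le_trans xA)// ltW].
      apply: (@preimage_closed _ _ (fun x : 'rV[R]_p => `|x|) [set r | r <= A]).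
        by move=> x _; exact: norm_continuous.
      exact: closed_le.
    rewrite (_ : [set v | _] = `[- A, A]%classic); first exact: segment_compact.
    by apply/seteqP; split => v /=; rewrite in_itv/= ler_norml.
  have := compact_uniform th0 cK scaled_rem_continuous m8.
  apply: filter_app; apply: (filterS _ near_le) => th hB hK z.
  rewrite /g; case: (ltP A (N z)) => hN /=.
    rewrite mulr1.
    have := hB z; have := nbhs_singleton near_le z.
    by rewrite !ler_norml => /andP[? ?] /andP[? ?]; lra.
  move: hN; rewrite ge_max => /andP[hN1 hN2].
  have : K z by split => //=; rewrite (le_trans (norm_le_l1norm _)).
  by move=> /hK; rewrite ler_norml => /andP[? ?]; lra.
Unshelve. all: end_near.
Qed.
End loss_law.

(** * Uniform lower bounds for the empirical loss *)

Definition emp_mean {R : realType} {T Z : Type} (W : nat -> T -> Z) (n : nat)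
    (g : Z -> R) (w : T) : R := n%:R^-1 * \sum_(i < n) g (W i w).

Lemma emp_mean_le {R : realType} {T Z : Type} (W : nat -> T -> Z) n (g h : Z -> R) w :
  (forall z, g z <= h z) -> emp_mean W n g w <= emp_mean W n h w.
Proof. by move=> gh; rewrite ler_wpM2l ?invr_ge0// ler_sum. Qed.

Lemma whp_all {R : realType} {d} {T : measurableType d} (P : probability T R)
    (E : nat -> set T) : (forall n w, E n w) -> whp P E.
Proof.
move=> allE e e0; apply: nearW => n.
by apply: (fails_leS _ (lexx e) (fails_leT P (ltW e0))) => w _.
Qed.

Section uniform_lower_bounds.
Context {R : realType} {p : nat} {d} {T : measurableType d} (P : probability T R)
  (G0 : probability 'rV[R]_p R)
  (F0 : probability R R) (f : R -> R).
Hypothesis fd : has_density F0 f.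
Hypothesis f_even : even_fun f.
Hypothesis f_cont : continuous f.
Hypothesis f_noninc : abs_nonincreasing f.
Hypothesis f_dec0 : abs_decreasing_near0 f.
Hypothesis G2 : forall j, G0.-integrable setT (EFin \o (fun v : 'rV[R]_p => v 0 j ^+ 2)).
Context (rho psi dpsi : R -> R) (M C : R).
Hypothesis S : smooth_rho rho psi dpsi M C.
Local Notation mu := (G0 \x F0)%E.
Context (W : nat -> T -> 'rV[R]_p * R).
Hypothesis mW : forall i, measurable_fun setT (W i).
Hypothesis lawW : forall i, has_law P (W i) mu.
Hypothesis indW : forall i j, i != j -> independent2 P (W i) (W j).

Lemma emp_mean_whp (g : 'rV[R]_p * R -> R) (eta : R) :
  mu.-integrable setT (EFin \o g) -> 0 < eta ->
  whp P (fun n => [set w | `|emp_mean W n g w - \int[mu]_z g z| <= eta]).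
Proof. exact: weak_law_large_numbers. Qed.

Lemma unit_sphere_compact : compact [set e : 'rV[R]_p | `|e| = 1].
Proof.
apply: bounded_closed_compact.
  by exists 1; split; [exact: num_real|move=> b b1 e /= ->; exact: ltW].
apply: (@preimage_closed _ _ (fun x : 'rV[R]_p => `|x|) [set r | r = 1]).
  by move=> x _; exact: norm_continuous.
exact: closed_eq.
Qed.

(** In polar coordinates [b = r *: e] the parameters [(e, (r, t))] fill a compact set, which
    includes [r = 0] thanks to the continuous extension. Local minorants, the law of large numbers
    and [compact_induction] bound the scaled remainder below, and multiplication by [r ^+ 2] returns
    to [b]. *)
Lemma loss_curvature (K t0 t1 : R) :
  (forall e : 'rV[R]_p, e != 0 -> (0 < G0 [set v | dotv v e != 0%R])%E) ->
  0 < t0 -> exists2 k : R, 0 < k & whp P (fun n => [set w |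
    forall t (b : 'rV[R]_p), t0 <= t <= t1 -> `|b| <= K ->
      k * `|b| ^+ 2 <= emp_mean W n (fun z =>
        rho (t * (z.2 - dotv z.1 b)) - rho (t * z.2) +
        psi (t * z.2) * (t * dotv z.1 b)) w]).
Proof.
move=> G_nd t00.
pose F := scaled_rem rho psi dpsi (p := p).
pose Phi (U : set ('rV[R]_p * (R * R))) := exists2 k : R, 0 < k &
  whp P (fun n => [set w | forall th, U th -> k <= emp_mean W n (F th) w]).
have : Phi ([set e : 'rV[R]_p | `|e| = 1] `*` (`[0, K]%classic `*` `[t0, t1]%classic)).
  apply: compact_induction.
  - apply: compact_setX; first exact: unit_sphere_compact.
    by apply: compact_setX; exact: segment_compact.
  - by exists 1 => //; apply: whp_all => n w th [].
  - move=> U V VU [k k0 h]; exists k => //; apply: whpS h.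
    by apply: nearW => n w h th /VU; exact: h.
  - move=> U V [k k0 h] [l l0 h']; exists (Num.min k l); first by rewrite lt_min k0.
    apply: whpS (whpI h h'); apply: nearW => n w [/= hU hV] th [/hU|/hV] h1;
      by rewrite ge_min h1 ?orbT.
  - move=> [e [r t]] [/= e1 [_ /=]]; rewrite in_itv/= => /andP[tt _].
    have e0 : e != 0 by rewrite -normr_gt0 e1.
    have [l [il l0 hl]] := scaled_rem_minorant fd f_even f_cont f_noninc f_dec0
       G2 G_nd S (th0 := (e, (r, t))) e0 (lt_le_trans t00 tt).
    exists [set th | forall z, l z <= F th z] => //.
    exists (\int[mu]_z l z / 2); first by rewrite divr_gt0.
    have l20 : 0 < \int[mu]_z l z / 2 by rewrite divr_gt0.
    apply: whpS (emp_mean_whp il l20); apply: nearW => n w /= hw th hth.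
    apply: le_trans (emp_mean_le W n w hth).
    by move: hw; rewrite ler_norml => /andP[? _]; lra.
move=> [k k0 hk]; exists k => //; apply: whpS hk; apply: nearW => n w /= h t b tt bK.
have [->|b0] := eqVneq b 0.
  rewrite normr0 expr0n mulr0 /emp_mean big1 ?mulr0// => i _.
  by rewrite dotv0 subr0 subrr !mulr0 addr0.
have nb0 : 0 < `|b| by rewrite normr_gt0.
have : k <= emp_mean W n (F (`|b|^-1 *: b, (`|b|, t))) w.
  apply: h; split => /=; last by split; rewrite /= in_itv//= normr_ge0.
  by rewrite normrZ ger0_norm ?invr_ge0// mulVf ?gt_eqF.
rewrite -(@ler_pM2r _ (`|b| ^+ 2)) ?exprn_gt0// => /le_trans; apply.
rewrite /emp_mean -mulrA ler_wpM2l ?invr_ge0// mulr_suml; apply: ler_sum => i _.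
rewrite /F (scaled_remE rho psi dpsi) /= ?gt_eqF// divfK ?expf_neq0 ?gt_eqF//.
by rewrite scalerA divff ?gt_eqF// scale1r.
Qed.

(** The minorant is the indicator of [dotv z.1 e0 != 0], whose mean exceeds [b] by B2, cut down to
    points where the design and the error are bounded and [dotv z.1 e0] is not too small. There a
    long step in a direction near [e0] saturates the loss. *)
Lemma far_direction (b t0 : R) (e0 : 'rV[R]_p) : 0 < t0 ->
  (G0 [set v | dotv v e0 = 0%R] < (1 - b)%:E)%E ->
  exists (l : 'rV[R]_p * R -> R) (A : R), [/\ 0 < A,
    mu.-integrable setT (EFin \o l), b < \int[mu]_z l z &
    \forall e \near e0, forall r t z, A <= r -> t0 <= t ->
      l z <= rho (t * (z.2 - r * dotv z.1 e))].
Proof.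
move=> t00 B2e.
have md : measurable_fun setT (fun z : 'rV[R]_p * R => dotv z.1 e0).
  exact: (measurableT_comp (measurable_dotv e0) measurable_fst).
pose E := [set z : 'rV[R]_p * R | dotv z.1 e0 != 0].
have mE0 : measurable [set v : 'rV[R]_p | dotv v e0 = 0].
  rewrite -[X in measurable X]setTI.
  exact: (measurable_dotv e0 measurableT (measurable_set1 0)).
have mE : measurable E.
  rewrite (_ : E = ~` (fst @^-1` [set v : 'rV[R]_p | dotv v e0 = 0])).
    by apply: measurableC; rewrite -[X in measurable X]setTI; exact: measurable_fst.
  by apply/seteqP; split => z /= /eqP.
pose g : 'rV[R]_p * R -> R := \1_E.
have mg : measurable_fun setT g by exact: measurable_indic.
have g0 z : 0 <= g z by rewrite /g indicE.
have g1 z : `|g z| <= 1 by rewrite ger0_norm// /g indicE lern1 leq_b1.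
have ig := integrable_bounded mu mg g1.
have Eg : b < \int[mu]_z g z.
  pose A := ~` [set v : 'rV[R]_p | dotv v e0 = 0].
  have mA : measurable A by exact: measurableC.
  have iA : G0.-integrable setT (EFin \o (\1_A : 'rV[R]_p -> R)).
    apply: (@integrable_bounded _ _ _ _ _ 1); first exact: measurable_indic.
    by move=> v; rewrite ger0_norm indicE// lern1 leq_b1.
  have [_ EA] := integral_fst F0 iA.
  have -> : \int[mu]_z g z = \int[G0]_v (\1_A v : R).
    rewrite -EA; apply: eq_Rintegral => z _; rewrite /g !indicE; congr (nat_of_bool _)%:R.
    by apply/idP/idP; rewrite !inE => /eqP.
  rewrite /Rintegral integral_indic// setIT /A /= (probability_setC G0 mE0).
  move: B2e; rewrite -(fineK (fin_num_measure G0 _ mE0)) lte_fin /= => B2e; lra.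
pose c := (\int[mu]_z g z - b) / 2.
have c0 : 0 < c by rewrite divr_gt0// subr_gt0.
(* [N z <= A] also forces [dotv z.1 e0] to be at least [A^-1] in absolute value when it is non-zero.
   The power -1 of 0 is 0, so this says nothing off [E], where the minorant is 0 anyway. *)
pose N (z : 'rV[R]_p * R) := Num.max (Num.max (l1norm z.1) `|z.2|) (`|dotv z.1 e0| `^ (-1)).
have mN : measurable_fun setT N.
  apply: measurable_maxr; first apply: measurable_maxr.
  - exact: (measurableT_comp (@measurable_l1norm R p) measurable_fst).
  - exact: (measurableT_comp (@normr_measurable R setT) measurable_snd).
  apply: (@measurableT_comp _ _ _ _ _ _ (fun x : R => x `^ (-1)) _ (fun z : 'rV[R]_p * R => `|dotv z.1 e0|)).
    exact: measurable_powR.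
  exact: (measurableT_comp (@normr_measurable R setT) md).
have [A A0 tA] := tail_integral ig g0 mN c0.
have mh : measurable_fun setT (fun z => g z * (A < N z)%R%:R).
  by apply: measurable_funM => //; exact: measurable_ltr_indic.
have ih : mu.-integrable setT (EFin \o (fun z => g z * (A < N z)%R%:R)).
  apply: (integrable_dom mh ig) => z; rewrite ger0_norm ?mulr_ge0//.
  by rewrite ler_piMr// lern1 leq_b1.
have M0 := smooth_M_gt0 S.
(* Directions within [2^-1 * A^-1 * A^-1] of [e0] keep at least [2^-1 * A^-1] of the inner product.
   A step of the given length thus moves the residual by at least [A + M / t0]; the error uses up at
   most [A]. *)
exists (fun z => g z - g z * (A < N z)%R%:R), (2 * A * (A + M / t0)); split.
- by rewrite !mulr_gt0// addr_gt0// divr_gt0.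
- exact: eq_integrable (integrableB measurableT ig ih).
- by rewrite RintegralB//; rewrite /c in tA; lra.
have d0 : 0 < 2^-1 * A^-1 * A^-1 by rewrite !mulr_gt0 ?invr_gt0.
near=> e => r t z Ar tt.
rewrite /g indicE; case: (boolP (z \in E)) => zE; last first.
  by rewrite mul0r subrr (smooth_ge0 S).
rewrite mul1r; case: (ltP A (N z)) => AN /=.
  by rewrite subrr (smooth_ge0 S).
move: AN; rewrite !ge_max => /andP[/andP[zN uN] dN].
have dz : 0 < `|dotv z.1 e0| by rewrite normr_gt0; rewrite inE in zE.
have dzA : A^-1 <= `|dotv z.1 e0| by rewrite -[leRHS]invrK lef_pV2 ?posrE ?invr_gt0// -powR_inv1// ltW.
have de : `|dotv z.1 e0 - dotv z.1 e| <= 2^-1 * A^-1.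
  rewrite -dotvB (le_trans (dotv_le _ _))//.
  rewrite (@le_trans _ _ (A * (2^-1 * A^-1 * A^-1)))//.
    by rewrite ler_pM ?l1norm_ge0// ltW.
  by rewrite le_eqVlt; apply/orP; left; apply/eqP; field; rewrite gt_eqF.
have dze : 2^-1 * A^-1 <= `|dotv z.1 e|.
  have := ler_normD (dotv z.1 e0 - dotv z.1 e) (dotv z.1 e); rewrite subrK; lra.
rewrite subr0 (smooth_1 S)//.
have r0 : 0 < r by apply: lt_le_trans Ar; rewrite !mulr_gt0// addr_gt0// divr_gt0.
have t_gt0 : 0 < t := lt_le_trans t00 tt.
have big : A + M / t0 <= `|r * dotv z.1 e|.
  rewrite normrM gtr0_norm//.
  rewrite (@le_trans _ _ (2 * A * (A + M / t0) * (2^-1 * A^-1)))//.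
    by rewrite le_eqVlt; apply/orP; left; apply/eqP; field; rewrite !gt_eqF.
  apply: ler_pM => //; first by rewrite !mulr_ge0// ?ltW// addr_gt0// divr_gt0.
  by rewrite ltW// mulr_gt0// invr_gt0.
have far : M / t0 <= `|z.2 - r * dotv z.1 e|.
  have := ler_normB z.2 (z.2 - r * dotv z.1 e); rewrite opprB addrC subrK; lra.
rewrite normrM gtr0_norm// (@le_trans _ _ (t0 * (M / t0)))//.
  by rewrite mulrC divfK// gt_eqF.
by apply: ler_pM => //; rewrite ltW// divr_gt0.
Unshelve. all: end_near.
Qed.

(** Only the directions need compactness: the minorants of [far_direction] hold for all large radii
    and all [t >= t0] at once. *)
Lemma loss_far (b t0 : R) :
  (forall e : 'rV[R]_p, e != 0 -> (G0 [set v | dotv v e = 0%R] < (1 - b)%:E)%E) ->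
  0 < t0 -> exists A eta : R, 0 < eta /\ whp P (fun n => [set w |
    forall t (e : 'rV[R]_p), t0 <= t -> A <= `|e| ->
      b + eta <= emp_mean W n (fun z => rho (t * (z.2 - dotv z.1 e))) w]).
Proof.
move=> B2 t00.
pose Phi (U : set 'rV[R]_p) := exists A eta : R, [/\ 0 < A, 0 < eta &
  whp P (fun n => [set w | forall e r t, U e -> A <= r -> t0 <= t ->
    b + eta <= emp_mean W n (fun z => rho (t * (z.2 - r * dotv z.1 e))) w])].
have : Phi [set e : 'rV[R]_p | `|e| = 1].
  apply: compact_induction.
  - exact: unit_sphere_compact.
  - by exists 1, 1; split => //; apply: whp_all => n w e r t [].
  - move=> U V VU [A [eta [A0 eta0 h]]]; exists A, eta; split => //; apply: whpS h.
    by apply: nearW => n w h e r t /VU; exact: h.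
  - move=> U V [A [eta [A0 eta0 h]]] [B [eta' [B0 eta'0 h']]].
    exists (Num.max A B), (Num.min eta eta'); split.
    + by rewrite lt_max A0.
    + by rewrite lt_min eta0.
    apply: whpS (whpI h h'); apply: nearW => n w [/= hU hV] e r t.
    rewrite ge_max => -[Ue|Ve] /andP[rA rB] tt.
      by apply: le_trans (hU _ _ _ Ue rA tt); rewrite lerD2l ge_min lexx.
    by apply: le_trans (hV _ _ _ Ve rB tt); rewrite lerD2l ge_min lexx orbT.
  - move=> e0 /= e01.
    have e00 : e0 != 0 by rewrite -normr_gt0 e01.
    have [l [A [A0 il bl hl]]] := far_direction t00 (B2 _ e00).
    exists [set e | forall r t z, A <= r -> t0 <= t ->
      l z <= rho (t * (z.2 - r * dotv z.1 e))] => //.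
    have c0 : 0 < (\int[mu]_z l z - b) / 2 by rewrite divr_gt0// subr_gt0.
    exists A, ((\int[mu]_z l z - b) / 2); split => //.
    apply: whpS (emp_mean_whp il c0); apply: nearW => n w /= hw e r t he Ar tt.
    apply: le_trans (emp_mean_le W n w (fun z => he r t z Ar tt)).
    by move: hw; rewrite ler_norml => /andP[? _]; lra.
move=> [A [eta [A0 eta0 h]]]; exists A, eta; split => //.
apply: whpS h; apply: nearW => n w /= h t e tt Ae.
have ne0 : 0 < `|e| := lt_le_trans A0 Ae.
have e1 : `| (`|e|^-1 *: e) | = 1.
  by rewrite normrZ ger0_norm ?invr_ge0// mulVf ?gt_eqF.
apply: (le_trans (h _ _ _ e1 Ae tt)); apply: emp_mean_le => z.
by rewrite -dotvZ scalerA divff ?gt_eqF// scale1r.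
Qed.

End uniform_lower_bounds.

(** * Tightness of the score process *)

(** The derivative in [t] is [dpsi (t * u) * u]. It vanishes unless [t * u] is below [M] in absolute
    value, which bounds [u] by [M / t0]; hence a constant that does not depend on [u]. *)
Lemma psi_scale_lipschitz {R : realType} (rho psi dpsi : R -> R) (M C t0 : R) :
  smooth_rho rho psi dpsi M C -> 0 < t0 -> forall t t' u, t0 <= t -> t0 <= t' ->
  `|psi (t * u) - psi (t' * u)| <= C * (M / t0) * `|t - t'|.
Proof.
move=> S t00 t t' u tt tt'.
have dg (s : R) : is_derive s (1 : R) (fun s => psi (s * u)) (dpsi (s * u) * u).
  have h : is_derive s (1 : R) (fun s : R => s * u) u.
    rewrite (_ : (fun s => _) = u \*: (id : R -> R^o)); last first.
      by apply/funext => r; rewrite /= mulrC.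
    by apply: is_derive_eq; rewrite /GRing.scale/= mulr1.
  have h2 : is_derive s (1 : R) (psi \o (fun s : R => s * u)) (dpsi (s * u) * u).
    by apply: is_derive1_comp; exact: (smooth_dpsi S).
  exact: h2.
have [c /andP[c1 _] ->] := mvt t' t dg.
have ct : t0 <= c by apply: le_trans c1; rewrite le_min tt tt'.
have c0 : 0 < c := lt_le_trans t00 ct.
rewrite normrM ler_wpM2r//.
have MC : 0 <= C * (M / t0).
  by rewrite mulr_ge0 ?divr_ge0 ?(ltW (smooth_C_gt0 S)) ?(ltW (smooth_M_gt0 S)) ?ltW.
have [cM|cM] := leP M `|c * u|; first by rewrite (smooth_dpsi0 S cM) mul0r normr0.
rewrite normrM ler_pM// ?(smooth_dpsi_le S)//.
rewrite ler_pdivlMr// mulrC; move: cM; rewrite normrM gtr0_norm// => cM.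
by apply: le_trans (ltW cM); rewrite ler_wpM2r.
Qed.

Lemma le_half_sqr {R : realFieldType} (a m : R) : 0 < m -> `|a| <= (a ^+ 2 / m + m) / 2.
Proof.
move=> m0; rewrite -(ler_pM2r m0) -[a ^+ 2]real_normK ?num_real//.
rewrite (_ : _ / 2 * m = (`|a| ^+ 2 + m ^+ 2) / 2); last by field; rewrite gt_eqF.
have := sqr_ge0 (`|a| - m); rewrite sqrrB; lra.
Qed.

Section score.
Context {R : realType} {p : nat} (G0 : probability 'rV[R]_p R)
  (F0 : probability R R).
Hypothesis G2 : forall j, G0.-integrable setT (EFin \o (fun v : 'rV[R]_p => v 0 j ^+ 2)).
Local Notation mu := (G0 \x F0)%E.
Let V j := \int[G0]_v v 0 j ^+ 2.

Lemma integrable_coord j : G0.-integrable setT (EFin \o (fun v : 'rV[R]_p => v 0 j)).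
Proof.
have ic : G0.-integrable setT (EFin \o (fun=> 1 : R)).
  by apply: (@integrable_bounded _ _ _ G0 _ 1) => // z; rewrite normr1.
have i1 : G0.-integrable setT (EFin \o (fun v : 'rV[R]_p => v 0 j ^+ 2 + 1)).
  exact: eq_integrable (integrableD measurableT (G2 j) ic).
apply: (integrable_dom _ i1); first exact: measurable_coord.
move=> v; have := le_half_sqr (v 0 j) (ltr01 : 0 < 1); rewrite divr1.
have := sqr_ge0 (v 0 j); lra.
Qed.

Lemma integral_weighted_coord (h : R -> R) (B : R) (j : 'I_p) :
  continuous h -> (forall v, `|h v| <= B) -> \int[F0]_v h v = 0 ->
  [/\ mu.-integrable setT (EFin \o (fun z : 'rV[R]_p * R => h z.2 * z.1 0 j)),
      mu.-integrable setT (EFin \o (fun z : 'rV[R]_p * R => (h z.2 * z.1 0 j) ^+ 2)),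
      \int[mu]_z (h z.2 * z.1 0 j) = 0 &
      \int[mu]_z ((h z.2 * z.1 0 j) ^+ 2) <= B ^+ 2 * V j].
Proof.
move=> ch hB h0.
have mh : measurable_fun setT h by exact: continuous_measurable_fun.
have B0 : 0 <= B := le_trans (normr_ge0 _) (hB 0).
have mg : measurable_fun setT (fun z : 'rV[R]_p * R => h z.2 * z.1 0 j).
  apply: measurable_funM; first exact: (measurableT_comp mh measurable_snd).
  exact: (measurableT_comp (@measurable_coord R p j) measurable_fst).
have iB : mu.-integrable setT (EFin \o (fun z : 'rV[R]_p * R => B * `|z.1 0 j|)).
  have [i1 _] := integral_fst F0 (integrable_coord j).
  exact: eq_integrable (integrableZl measurableT B (integrable_norm i1)).
have [i2 e2] := integral_fst F0 (G2 j).
have iB2 : mu.-integrable setT (EFin \o (fun z : 'rV[R]_p * R => B ^+ 2 * z.1 0 j ^+ 2)).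
  exact: eq_integrable (integrableZl measurableT (B ^+ 2) i2).
have ig : mu.-integrable setT (EFin \o (fun z : 'rV[R]_p * R => h z.2 * z.1 0 j)).
  by apply: (integrable_dom mg iB) => z; rewrite normrM ler_wpM2r.
have hB2 v : h v ^+ 2 <= B ^+ 2.
  by rewrite -real_normK ?num_real// ler_pXn2r ?nnegrE.
have ig2 : mu.-integrable setT (EFin \o (fun z : 'rV[R]_p * R => (h z.2 * z.1 0 j) ^+ 2)).
  apply: (integrable_dom _ iB2); first exact: measurable_funX.
  by move=> z; rewrite ger0_norm ?sqr_ge0// exprMn ler_wpM2r ?sqr_ge0.
split => //.
  have ih : F0.-integrable setT (EFin \o h) by exact: integrable_bounded mh hB.
  have [x|_ ->] := Rintegral_fubini ig _.
    exact: eq_integrable (integrableZr measurableT (x 0 j) ih).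
  under eq_Rintegral => x _ do rewrite RintegralZr// h0 mul0r.
  by rewrite Rintegral_probability_cst.
rewrite /V -e2 -RintegralZl//; apply: le_Rintegral => //.
by move=> z _; rewrite exprMn ler_wpM2r ?sqr_ge0.
Qed.

End score.

(** Telescoping leads from [t0] to the last grid point before [t], and the Lipschitz bound covers
    the remaining distance, at most one mesh. *)
Lemma grid_bound {R : realType} (F : R -> R) (t0 t1 A : R) (n : nat) :
  (0 < n)%N -> t0 < t1 -> 0 <= A ->
  (forall t t', t0 <= t <= t1 -> t0 <= t' <= t1 -> `|F t - F t'| <= A * `|t - t'|) ->
  forall t, t0 <= t <= t1 ->
    `|F t| <= `|F t0| + \sum_(k < n) `|F (t0 + k.+1%:R * ((t1 - t0) / n%:R)) -
                                     F (t0 + k%:R * ((t1 - t0) / n%:R))|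
              + A * ((t1 - t0) / n%:R).
Proof.
move=> n0 t01 A0 FA t /andP[tt0 tt1].
have n0' : 0 < n%:R :> R by rewrite ltr0n.
set h := (t1 - t0) / n%:R.
have h0 : 0 < h by rewrite divr_gt0// subr_gt0.
pose g k := F (t0 + k%:R * h).
have g_le k : `|g k| <= `|F t0| + \sum_(0 <= l < k) `|g l.+1 - g l|.
  elim: k => [|k IH]; first by rewrite big_nil /g mul0r !addr0.
  rewrite big_nat_recr//= addrA.
  by rewrite -[X in `|X| <= _](subrK (g k)) addrC (le_trans (ler_normD _ _))// lerD.
have th0 : 0 <= (t - t0) / h by rewrite divr_ge0 ?subr_ge0// ltW.
have /andP[k1 k2] := Num.Theory.truncn_itv th0.
set k := Num.truncn _ in k1 k2.
have kt : k%:R * h <= t - t0 by rewrite -ler_pdivlMr.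
have kt' : t - t0 < k%:R * h + h.
  by move: k2; rewrite ltr_pdivrMr// -natr1 mulrDl mul1r.
have kn : (k <= n)%N.
  rewrite -(ler_nat R) -(ler_pM2r h0) (le_trans kt)//.
  by rewrite /h mulrC divfK ?gt_eqF// lerD2r.
have kh0 : 0 <= k%:R * h by rewrite mulr_ge0// ltW.
have Ft : `|F t - g k| <= A * h.
  apply: le_trans (FA _ _ _ _) _; [by rewrite tt0 tt1| |].
    by apply/andP; split; lra.
  by rewrite ler_wpM2l// ger0_norm; lra.
have sub : \sum_(0 <= l < k) `|g l.+1 - g l| <= \sum_(k < n) `|g k.+1 - g k|.
  rewrite -(big_mkord xpredT (fun l => `|g l.+1 - g l|)) (big_cat_nat (leq0n k) kn)//=.
  by rewrite lerDl sumr_ge0.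
have := ler_normD (F t - g k) (g k); rewrite subrK => H.
apply: (le_trans H); rewrite addrC lerD//.
by apply: (le_trans (g_le k)); rewrite lerD2l.
Qed.

Section score_tightness.
Context {R : realType} {p : nat} {d} {T : measurableType d} (P : probability T R)
  (G0 : probability 'rV[R]_p R) (F0 : probability R R) (f : R -> R).
Hypothesis fd : has_density F0 f.
Hypothesis f_even : even_fun f.
Hypothesis G2 : forall j, G0.-integrable setT (EFin \o (fun v : 'rV[R]_p => v 0 j ^+ 2)).
Context (rho psi dpsi : R -> R) (M C : R).
Hypothesis S : smooth_rho rho psi dpsi M C.
Local Notation mu := (G0 \x F0)%E.
Context (W : nat -> T -> 'rV[R]_p * R).
Hypothesis mW : forall i, measurable_fun setT (W i).
Hypothesis lawW : forall i, has_law P (W i) mu.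
Hypothesis indW : forall i j, i != j -> independent2 P (W i) (W j).

(* Along a grid of mesh (t1 - t0) / n the increments D of the score process
   have second moments of order n / n^2, so that the bound
   |D| <= (D ^ 2 / m + m) / 2 with m = (t1 - t0) / sqrt n gives a total
   variation of order sqrt n; between grid points a Lipschitz bound suffices. *)
Lemma score_tight (t0 t1 e : R) : 0 < t0 -> t0 < t1 -> 0 < e ->
  exists2 B : R, 0 < B & forall n, (0 < n)%N -> fails_le P [set w |
    forall t b, t0 <= t <= t1 ->
      `|\sum_(i < n) psi (t * (W i w).2) * dotv (W i w).1 b| <=
        B * Num.sqrt n%:R * `|b|] e.
Proof.
move=> t00 t01 e0.
pose V j := \int[G0]_v v 0 j ^+ 2.
have V0 j : 0 <= V j by apply: Rintegral_ge0 => v _; rewrite sqr_ge0.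
pose a j := \int[G0]_v `|v 0 j|.
have a0 j : 0 <= a j by apply: Rintegral_ge0.
pose D := t1 - t0.
have D0 : 0 < D by rewrite subr_gt0.
pose L := C * (M / t0).
have L0 : 0 <= L.
  by rewrite mulr_ge0 ?divr_ge0 ?(ltW (smooth_C_gt0 S)) ?(ltW (smooth_M_gt0 S)) ?ltW.
pose Sc n j t w := \sum_(i < n) psi (t * (W i w).2) * (W i w).1 0 j.
pose gr n k : R := t0 + k%:R * (D / n%:R).
(* Three nonnegative statistics whose means are bounded independently of [n]: the normalized score
   at [t0], the squared grid increments, and the Lipschitz constant between grid points. The
   summands of [c j] bound them in this order, and one application of Markov's inequality controls
   them together. *)
pose X n j w := Sc n j t0 w ^+ 2 / n%:R +
  (\sum_(k < n) (Sc n j (gr n k.+1) w - Sc n j (gr n k) w) ^+ 2) / D +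
  n%:R^-1 * \sum_(i < n) `|(W i w).1 0 j|.
pose c j := C ^+ 2 * V j + L ^+ 2 * V j * D + a j.
have cpsi : continuous psi by exact: (smooth_psi_continuous S).
have cpsit t : continuous (fun v : R => psi (t * v)).
  move=> v; apply: (@continuous_comp _ _ _ ( *%R t) psi); last exact: cpsi.
  exact: mulrl_continuous.
have XE n j : (0 < n)%N -> P.-integrable setT (EFin \o X n j) /\ \int[P]_w X n j w <= c j.
  move=> n0; have n0' : 0 < n%:R :> R by rewrite ltr0n.
  have [i1 i1' m1 v1] := integral_weighted_coord G2 j (cpsit t0)
    (fun v => smooth_psi_le S _) (integral_psi0 fd f_even S t0).2.
  have [s1 s1'] := integral_sample_sum_sqr mW lawW indW n i1 i1' m1.
  have mesh0 : 0 < D / n%:R by rewrite divr_gt0.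
  have grt k : t0 <= gr n k by rewrite lerDl mulr_ge0// ltW.
  have cdif k : continuous (fun v : R => psi (gr n k.+1 * v) - psi (gr n k * v)).
    by move=> v; apply: cvgB; exact: cpsit.
  have dL k v : `|psi (gr n k.+1 * v) - psi (gr n k * v)| <= L * (D / n%:R).
    apply: (le_trans (psi_scale_lipschitz S t00 v (grt _) (grt _))).
    rewrite ler_wpM2l// /gr -natr1 (_ : _ - _ = D / n%:R) ?ger0_norm//; last ring.
    exact: ltW.
  have d0 k : \int[F0]_v (psi (gr n k.+1 * v) - psi (gr n k * v)) = 0.
    have [p1 q1] := integral_psi0 fd f_even S (gr n k.+1).
    have [p2 q2] := integral_psi0 fd f_even S (gr n k).
    by rewrite RintegralB// q1 q2 subrr.
  have ED k : P.-integrable setT (EFin \o (fun w =>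
        (Sc n j (gr n k.+1) w - Sc n j (gr n k) w) ^+ 2)) /\
      \int[P]_w ((Sc n j (gr n k.+1) w - Sc n j (gr n k) w) ^+ 2) <=
        n%:R * ((L * (D / n%:R)) ^+ 2 * V j).
    have [k1 k1' km kv] := integral_weighted_coord G2 j (cdif k) (dL k) (d0 k).
    have [h1 h2] := integral_sample_sum_sqr mW lawW indW n k1 k1' km.
    have E w : Sc n j (gr n k.+1) w - Sc n j (gr n k) w = \sum_(i < n)
        (psi (gr n k.+1 * (W i w).2) - psi (gr n k * (W i w).2)) * (W i w).1 0 j.
      by rewrite -sumrB; apply: eq_bigr => i _; rewrite mulrBl.
    under eq_fun do rewrite E.
    by split => //; rewrite h2 ler_wpM2l// ltW.
  have [sk1 sk2] := integrable_sum_fin (fun k : 'I_n => (ED k).1).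
  have sk3 : P.-integrable setT (EFin \o (fun w =>
      (\sum_(k < n) (Sc n j (gr n k.+1) w - Sc n j (gr n k) w) ^+ 2) / D)).
    exact: eq_integrable (integrableZr measurableT D^-1 sk1).
  have s2 : P.-integrable setT (EFin \o (fun w => Sc n j t0 w ^+ 2 / n%:R)).
    exact: eq_integrable (integrableZr measurableT n%:R^-1 s1).
  have [l1 _] := integral_fst F0 (integrable_norm (integrable_coord G2 j)).
  have la : \int[mu]_z `|z.1 0 j| = a j.
    have h : G0.-integrable setT (EFin \o (fun v : 'rV[R]_p => `|v 0 j|)).
      exact: integrable_norm (integrable_coord G2 j).
    by have [_ ->] := integral_fst F0 h.
  have la1 : mu.-integrable setT (EFin \o (fun z : 'rV[R]_p * R => `|z.1 0 j|)).
    exact: l1.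
  have [a1 a2] := integral_sample_sum mW lawW n la1.
  have a3 : P.-integrable setT (EFin \o (fun w =>
      n%:R^-1 * \sum_(i < n) `|(W i w).1 0 j|)).
    exact: eq_integrable (integrableZl measurableT n%:R^-1 a1).
  have s12 : P.-integrable setT (EFin \o (fun w => Sc n j t0 w ^+ 2 / n%:R +
      (\sum_(k < n) (Sc n j (gr n k.+1) w - Sc n j (gr n k) w) ^+ 2) / D)).
    exact: eq_integrable (integrableD measurableT s2 sk3).
  split; first exact: eq_integrable (integrableD measurableT s12 a3).
  rewrite RintegralD// RintegralD// !RintegralZr// RintegralZl// a2 la sk2.
  apply: lerD; last by rewrite mulKf// gt_eqF.
  apply: lerD.
    by rewrite ler_pdivrMr// s1' mulrC ler_wpM2r// ltW.
  rewrite ler_pdivrMr//.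
  apply: (@le_trans _ _ (\sum_(k < n) n%:R * ((L * (D / n%:R)) ^+ 2 * V j))).
    by apply: ler_sum => k _; exact: (ED k).2.
  rewrite sumr_const card_ord -[leLHS]mulr_natl le_eqVlt; apply/orP; left; apply/eqP.
  by field; rewrite gt_eqF.
have X0 n j w : 0 <= X n j w.
  rewrite !addr_ge0//.
  - by rewrite divr_ge0 ?sqr_ge0.
  - by rewrite divr_ge0 ?(ltW D0)// sumr_ge0// => k _; rewrite sqr_ge0.
  - by rewrite mulr_ge0 ?invr_ge0// sumr_ge0.
have c0 j : 0 <= c j.
  have := mulr_ge0 (sqr_ge0 C) (V0 j).
  have := mulr_ge0 (mulr_ge0 (sqr_ge0 L) (V0 j)) (ltW D0).
  by have := a0 j; rewrite /c; lra.
pose B0 := (\sum_j c j + 1) / e.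
have B00 : 0 < B0 by rewrite divr_gt0// ltr_wpDl// sumr_ge0.
exists ((1 + L * D) * B0 + p%:R * (1 + D)).
  have LD := mulr_ge0 L0 (ltW D0).
  have : 0 <= p%:R * (1 + D) by rewrite mulr_ge0// addr_ge0// ltW.
  move=> pD; apply: ltr_wpDr => //; apply: mulr_gt0 => //.
  exact: ltr_wpDr.
move=> n n0; have n0' : 0 < n%:R :> R by rewrite ltr0n.
have [iX eX] := integrable_sum_fin (fun j => (XE n j n0).1).
have FX : fails_le P [set w | \sum_j X n j w < B0] e.
  apply: (markov_fails_le B00 _ iX) => [w|]; first by rewrite sumr_ge0.
  rewrite eX (@le_trans _ _ (\sum_j c j))//.
    by apply: ler_sum => j _; exact: (XE n j n0).2.
  by rewrite /B0 mulrC divfK ?gt_eqF// lerDl.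
apply: (fails_leS _ (lexx e) FX) => w /= XB t b tt.
have sn : 0 < Num.sqrt n%:R :> R by rewrite sqrtr_gt0.
have sn1 : 1 <= Num.sqrt n%:R :> R by rewrite -[leLHS]sqrtr1 ler_wsqrtr// ler1n.
have sn2 : Num.sqrt n%:R * Num.sqrt n%:R = n%:R :> R by rewrite -expr2 sqr_sqrtr// ltW.
have SX j : `|Sc n j t w| <= Num.sqrt n%:R * ((1 + L * D) * X n j w + (1 + D)).
  pose Q := n%:R^-1 * \sum_(i < n) `|(W i w).1 0 j|.
  have Q0 : 0 <= Q by rewrite mulr_ge0 ?invr_ge0// sumr_ge0.
  pose U1 := Sc n j t0 w ^+ 2 / n%:R.
  have U10 : 0 <= U1 by rewrite divr_ge0 ?sqr_ge0.
  pose U2 := (\sum_(k < n) (Sc n j (gr n k.+1) w - Sc n j (gr n k) w) ^+ 2) / D.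
  have U20 : 0 <= U2.
    by rewrite divr_ge0 ?(ltW D0)// sumr_ge0// => k _; rewrite sqr_ge0.
  have XU : X n j w = U1 + U2 + Q by [].
  have lip t2 t3 : t0 <= t2 <= t1 -> t0 <= t3 <= t1 ->
      `|Sc n j t2 w - Sc n j t3 w| <= L * (n%:R * Q) * `|t2 - t3|.
    move=> /andP[h2 _] /andP[h3 _]; rewrite /Q mulVKf ?gt_eqF// -sumrB.
    apply: (le_trans (ler_norm_sum _ _ _)).
    rewrite mulrAC mulr_sumr; apply: ler_sum => i _.
    by rewrite -mulrBl normrM ler_wpM2r// (psi_scale_lipschitz S).
  have LQ : 0 <= L * (n%:R * Q) by rewrite mulr_ge0// mulr_ge0// ltW.
  have H := grid_bound n0 t01 LQ lip tt.
  have LD : 0 <= L * D := mulr_ge0 L0 (ltW D0).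
  apply: (le_trans H) => {H lip}.
  have h1 : `|Sc n j t0 w| <= Num.sqrt n%:R * ((U1 + 1) / 2).
    have U1E : U1 = Sc n j t0 w ^+ 2 / (Num.sqrt n%:R * Num.sqrt n%:R).
      by rewrite sn2.
    apply: (le_trans (le_half_sqr _ sn)); rewrite mulrA ler_wpM2r// U1E.
    by rewrite le_eqVlt; apply/orP; left; apply/eqP; field; rewrite gt_eqF.
  have h2 : \sum_(k < n) `|Sc n j (gr n k.+1) w - Sc n j (gr n k) w| <=
      Num.sqrt n%:R * ((U2 + D) / 2).
    have m0 : 0 < D / Num.sqrt n%:R by rewrite divr_gt0.
    apply: (le_trans (@ler_sum _ _ _ _ _ _ (fun k _ => le_half_sqr _ m0))).
    rewrite -mulr_suml mulrA ler_wpM2r// big_split/= sumr_const card_ord -mulr_suml.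
    rewrite -[(D / _) *+ n]mulr_natl -[X in X * (D / _)]sn2 /U2.
    by rewrite le_eqVlt; apply/orP; left; apply/eqP; field; rewrite !gt_eqF.
  have h3 : L * (n%:R * Q) * (D / n%:R) = L * D * Q by field; rewrite gt_eqF.
  have h4 : L * D * Q <= Num.sqrt n%:R * (L * D * Q).
    by apply: ler_peMl => //; apply: mulr_ge0.
  rewrite -/D h3 XU; apply: (le_trans (lerD (lerD h1 h2) h4)).
  rewrite -!mulrDr ler_wpM2l ?(ltW sn)//.
  have := mulr_ge0 LD (addr_ge0 U10 U20).
  by move: (L * D) => l; clear -U10 U20 Q0 D0; rewrite mulrDr; lra.
have -> : \sum_(i < n) psi (t * (W i w).2) * dotv (W i w).1 b = \sum_j Sc n j t w * b 0 j.
  under eq_bigr do rewrite dotvE mulr_sumr.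
  rewrite exchange_big/=; apply: eq_bigr => j _; rewrite mulr_suml.
  by apply: eq_bigr => i _; rewrite mulrA.
apply: (le_trans (ler_norm_sum _ _ _)).
apply: (@le_trans _ _ (\sum_j (Num.sqrt n%:R * ((1 + L * D) * X n j w + (1 + D))) * `|b|)).
  by apply: ler_sum => j _; rewrite normrM ler_pM// coord_norm_le.
rewrite -mulr_suml ler_wpM2r// -mulr_sumr mulrC ler_wpM2r ?(ltW sn)//.
rewrite big_split/= sumr_const card_ord -mulr_sumr -[(1 + D) *+ p]mulr_natl lerD2r.
apply: ler_wpM2l; last exact: ltW.
by rewrite addr_ge0// mulr_ge0// ltW.
Qed.

End score_tightness.

(** * Vanishing of the last coordinates *)

(** Converts a gain linear in a coordinate into the scale of the penalty: in
    [a = a ^ (1 - q) * a ^ q] the first factor is at most [(D / sqrt n) ^ (1 - q)], and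
    [1 / 2 - (1 - q) / 2 = q / 2] is the remaining power of [n]. *)
Lemma powR_split {R : realType} (a D q : R) (n : nat) :
  0 < q -> q <= 1 -> 0 < D -> (0 < n)%N -> 0 <= a -> a <= D / Num.sqrt n%:R ->
  Num.sqrt n%:R * a <= D `^ (1 - q) * n%:R `^ (q / 2) * a `^ q.
Proof.
move=> q0 q1 D0 n0 a0 aD; have n0' : 0 < n%:R :> R by rewrite ltr0n.
have sE : Num.sqrt n%:R = n%:R `^ (2^-1) :> R by rewrite powR12_sqrt// ltW.
have [->|a_neq0] := eqVneq a 0; first by rewrite mulr0 mulr_ge0// mulr_ge0// powR_ge0.
have aE : a `^ (1 - q) * a `^ q = a.
  by rewrite -powRD ?subrK ?powRr1// a_neq0 implybT.
rewrite -[X in _ * X <= _]aE.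
rewrite mulrA ler_wpM2r ?powR_ge0//.
have h1 : a `^ (1 - q) <= (D / Num.sqrt n%:R) `^ (1 - q).
  by rewrite ge0_ler_powR ?subr_ge0// nnegrE// divr_ge0// ltW.
apply: (@le_trans _ _ (Num.sqrt n%:R * (D / Num.sqrt n%:R) `^ (1 - q))).
  by rewrite ler_wpM2l ?sqrtr_ge0.
rewrite powRM ?invr_ge0 ?sqrtr_ge0 ?(ltW D0)// mulrCA ler_wpM2l ?powR_ge0//.
rewrite sE -powRN -powRrM -powRD; last by rewrite (gt_eqF n0') implybT.
by rewrite (_ : 2^-1 + - 2^-1 * (1 - q) = q / 2)//; field.
Qed.

Lemma sqrt_nat_ge {R : realType} (x : R) :
  \forall n \near \oo, x <= Num.sqrt n%:R.
Proof.
exists (Num.truncn (x ^+ 2)).+1 => // n /= hn.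
rewrite (le_trans (ler_norm _))// -sqrtr_sqr ler_wsqrtr//.
by rewrite (le_trans (ltW (truncnS_gt _)))// ler_nat.
Qed.

Section sparsity.
Context {R : realType} {s k : nat} {d} {T : measurableType d} (P : probability T R)
  (G0 : probability 'rV[R]_(s + k) R) (F0 : probability R R) (f : R -> R).
Hypothesis fd : has_density F0 f.
Hypothesis f_even : even_fun f.
Hypothesis f_cont : continuous f.
Hypothesis f_noninc : abs_nonincreasing f.
Hypothesis f_dec0 : abs_decreasing_near0 f.
Hypothesis G2 : forall j, G0.-integrable setT (EFin \o (fun v : 'rV[R]_(s + k) => v 0 j ^+ 2)).
Context (b : R).
Hypothesis B2 : forall e : 'rV[R]_(s + k), e != 0 ->
  (G0 [set v | dotv v e = 0%R] < (1 - b)%:E)%E.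
Hypothesis b_gt0 : 0 < b.
Context (rho psi dpsi : R -> R) (M C : R).
Hypothesis S : smooth_rho rho psi dpsi M C.
Local Notation mu := (G0 \x F0)%E.
Context (W : nat -> T -> 'rV[R]_(s + k) * R).
Hypothesis mW : forall i, measurable_fun setT (W i).
Hypothesis lawW : forall i, has_law P (W i) mu.
Hypothesis indW : forall i j, i != j -> independent2 P (W i) (W j).

Definition loss (n : nat) (t : R) (e : 'rV[R]_(s + k)) (w : T) : R :=
  \sum_(i < n) rho (t * ((W i w).2 - dotv (W i w).1 e)).

Definition support_part (e : 'rV[R]_(s + k)) : 'rV[R]_(s + k) :=
  row_mx (lsubmx e) 0.

Lemma norm_support_part e : `|support_part e| <= `|e|.
Proof.
rewrite [leLHS]/Num.Def.normr/= mx_normrE; apply: bigmax_le => // -[i j] _ /=.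
rewrite ord1 mxE; case: split_ordP => l _; rewrite !mxE ?normr0//.
exact: coord_norm_le.
Qed.

Lemma norm_sub_support_part e :
  `|e - support_part e| <= \sum_(j < k) `|e 0 (rshift s j)|.
Proof.
rewrite [leLHS]/Num.Def.normr/= mx_normrE; apply: bigmax_le => [|[i j] _ /=].
  exact: sumr_ge0.
rewrite ord1 !mxE; case: split_ordP => l ->; rewrite !mxE ?subrr ?normr0 ?sumr_ge0//.
by rewrite subr0 (bigD1 l)//= lerDl sumr_ge0.
Qed.

(** By the mean value theorem each loss increment is [psi] at an intermediate point times a shift
    linear in [h]. Replacing that point by [t * u] leaves the score, of order [sqrt n * |h|], and an
    error of order [n * |e| * |h|], which the rate of [e] also reduces to [sqrt n * |h|]. *)
Lemma loss_support_part n (t D V B : R) (e : 'rV[R]_(s + k)) w :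
  (0 < n)%N -> 0 <= t -> 0 <= D -> 0 <= V ->
  `|e| <= D / Num.sqrt n%:R ->
  emp_mean W n (fun z => l1norm z.1 ^+ 2) w <= V ->
  (forall a, `|\sum_(i < n) psi (t * (W i w).2) * dotv (W i w).1 a| <=
     B * Num.sqrt n%:R * `|a|) ->
  loss n t (support_part e) w - loss n t e w <=
    (t * B + C * t ^+ 2 * D * V) * Num.sqrt n%:R * `|e - support_part e|.
Proof.
move=> n0 t0 D0 V0 eD lV hB; set e' := support_part e; set h := e - e'.
have n0' : 0 < n%:R :> R by rewrite ltr0n.
have sn : 0 < Num.sqrt n%:R :> R by rewrite sqrtr_gt0.
have sn2 : Num.sqrt n%:R * Num.sqrt n%:R = n%:R :> R by rewrite -expr2 sqr_sqrtr// ltW.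
have C0 := smooth_C_gt0 S.
have pt (z : 'rV[R]_(s + k) * R) :
    rho (t * (z.2 - dotv z.1 e')) - rho (t * (z.2 - dotv z.1 e)) <=
    t * (psi (t * z.2) * dotv z.1 h) + C * t ^+ 2 * `|e| * `|h| * l1norm z.1 ^+ 2.
  set v' := t * (z.2 - dotv z.1 e'); set v := t * (z.2 - dotv z.1 e).
  have vv : v' - v = t * dotv z.1 h by rewrite /v /v' /h dotvB; ring.
  have [c c_in ->] := mvt v v' (smooth_psi S).
  (* Both endpoints are this close to [t * z.2], because truncation does not increase the sup
     norm. *)
  have cd : `|c - t * z.2| <= t * (l1norm z.1 * `|e|).
    have h1 : `|v - t * z.2| <= t * (l1norm z.1 * `|e|).
      rewrite /v mulrBr addrAC subrr sub0r normrN normrM ger0_norm//.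
      by rewrite ler_wpM2l// dotv_le.
    have h2 : `|v' - t * z.2| <= t * (l1norm z.1 * `|e|).
      rewrite /v' mulrBr addrAC subrr sub0r normrN normrM ger0_norm//.
      rewrite ler_wpM2l// (le_trans (dotv_le _ _))// ler_wpM2l ?l1norm_ge0//.
      exact: norm_support_part.
    move: h1 h2 c_in; rewrite !ler_norml => /andP[? ?] /andP[? ?].
    by case: (leP v v') => vv' /andP[? ?]; apply/andP; split; lra.
  rewrite -[psi c](subrK (psi (t * z.2))) mulrDl addrC vv.
  rewrite [psi _ * (t * _)]mulrCA lerD2l.
  apply: (le_trans (ler_norm _)); rewrite normrM.
  apply: (@le_trans _ _ (C * (t * (l1norm z.1 * `|e|)) * (t * (l1norm z.1 * `|h|)))).
    apply: ler_pM => //.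
      by apply: (le_trans (smooth_psi_lipschitz S _ _)); rewrite ler_wpM2l// ltW.
    by rewrite normrM ger0_norm// ler_wpM2l// dotv_le.
  by rewrite le_eqVlt; apply/orP; left; apply/eqP; ring.
rewrite /loss -sumrB.
apply: (@le_trans _ _ (\sum_(i < n) (t * (psi (t * (W i w).2) * dotv (W i w).1 h) +
    C * t ^+ 2 * `|e| * `|h| * l1norm (W i w).1 ^+ 2))).
  by apply: ler_sum => i _; exact: pt.
rewrite big_split/= -!mulr_sumr.
have lV' : \sum_(i < n) l1norm (W i w).1 ^+ 2 <= V * n%:R.
  by move: lV; rewrite /emp_mean mulrC ler_pdivrMr.
have h1 : t * \sum_(i < n) psi (t * (W i w).2) * dotv (W i w).1 h <=
    t * (B * Num.sqrt n%:R * `|h|).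
  by rewrite ler_wpM2l// (le_trans (ler_norm _)).
have h2 : C * t ^+ 2 * `|e| * `|h| * \sum_(i < n) l1norm (W i w).1 ^+ 2 <=
    C * t ^+ 2 * (D / Num.sqrt n%:R) * `|h| * (V * n%:R).
  apply: ler_pM => //.
  - by rewrite !mulr_ge0 ?sqr_ge0// ltW.
  - by rewrite sumr_ge0// => i _; rewrite sqr_ge0.
  - by rewrite ler_wpM2r// ler_wpM2l// mulr_ge0 ?sqr_ge0// ltW.
apply: (le_trans (lerD h1 h2)).
move: sn sn2; set m := Num.sqrt n%:R => sn sn2; rewrite -sn2 le_eqVlt; apply/orP; left; apply/eqP.
by field; rewrite gt_eqF.
Qed.

(** The deterministic core: every probabilistic input is an inequality at one sample point, and the
    conclusion is exact vanishing. *)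
Lemma sparsity_event (t0 t1 q t A eta kap B V D cn : R) (n : nat)
    (e : 'rV[R]_(s + k)) w :
  (0 < n)%N -> 0 < t0 -> t0 <= t <= t1 -> 0 < q -> q <= 1 -> 0 < eta -> 0 < kap ->
  0 < B -> 0 <= V -> 0 <= D -> D <= eta / 3 * Num.sqrt n%:R ->
  (A <= `|e| -> n%:R * (b + eta) <= loss n t e w) ->
  loss n t 0 w <= n%:R * (b + eta / 3) ->
  (`|e| <= A -> kap * `|e| ^+ 2 <= emp_mean W n (fun z =>
        rho (t * (z.2 - dotv z.1 e)) - rho (t * z.2) +
        psi (t * z.2) * (t * dotv z.1 e)) w) ->
  (forall a, `|\sum_(i < n) psi (t * (W i w).2) * dotv (W i w).1 a| <=
     B * Num.sqrt n%:R * `|a|) ->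
  emp_mean W n (fun z => l1norm z.1 ^+ 2) w <= V ->
  loss n t e w <= loss n t 0 w + D * Num.sqrt n%:R * Num.min 1 `|e| ->
  loss n t e w + cn * \sum_(j < k) `|e 0 (rshift s j)| `^ q <=
    loss n t (support_part e) w ->
  let Dr := (D + t1 * B) / kap + 1 in
  (t1 * B + C * t1 ^+ 2 * Dr * V) * (Dr `^ (1 - q) * n%:R `^ (q / 2)) < cn ->
  rsubmx e = 0.
Proof.
move=> n0 t00 /andP[tt0 tt1] q0 q1 eta0 kap0 B0 V0 D0 Deta far L0 curv score l1V H1 H2 Dr cnE.
have n0' : 0 < n%:R :> R by rewrite ltr0n.
have sn : 0 < Num.sqrt n%:R :> R by rewrite sqrtr_gt0.
have sn2 : Num.sqrt n%:R * Num.sqrt n%:R = n%:R :> R by rewrite -expr2 sqr_sqrtr// ltW.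
have tpos : 0 < t := lt_le_trans t00 tt0.
have t1pos : 0 < t1 := lt_le_trans tpos tt1.
have Dr0 : 0 < Dr by rewrite /Dr ltr_wpDl// divr_ge0 ?(ltW kap0)// addr_ge0// mulr_ge0 ?ltW.
(* Beyond [A] the loss would be at least [n * (b + eta)], while the comparison allows only
   [n * (b + eta / 3)] plus [n * eta / 3]. *)
have eA : `|e| < A.
  rewrite ltNge; apply/negP => /far farn.
  have : D * Num.sqrt n%:R * Num.min 1 `|e| <= n%:R * (eta / 3).
    apply: (@le_trans _ _ (D * Num.sqrt n%:R)).
      by rewrite ler_piMr// mulr_ge0// ltW.
    rewrite (_ : n%:R * _ = eta / 3 * Num.sqrt n%:R * Num.sqrt n%:R).
      by rewrite ler_wpM2r ?(ltW sn).
    by rewrite -mulrA sn2 mulrC.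
  have : 0 < n%:R * eta by rewrite mulr_gt0.
  by rewrite !mulrDr in farn L0 => *; lra.
(* Curvature, comparison and score give [kap * |e|^2 * n <= (D + t1 * B) * sqrt n * |e|]; it remains
   to divide. *)
have e_small : `|e| <= Dr / Num.sqrt n%:R.
  have [->|e0] := eqVneq e 0; first by rewrite normr0 divr_ge0// ltW.
  have ne0 : 0 < `|e| by rewrite normr_gt0.
  set sc := \sum_(i < n) psi (t * (W i w).2) * dotv (W i w).1 e.
  have E : emp_mean W n (fun z => rho (t * (z.2 - dotv z.1 e)) - rho (t * z.2) +
      psi (t * z.2) * (t * dotv z.1 e)) w =
      n%:R^-1 * (loss n t e w - loss n t 0 w + t * sc).
    rewrite /emp_mean /loss; congr (_ * _); rewrite mulr_sumr -sumrB -big_split/=.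
    by apply: eq_bigr => i _; rewrite dotv0 subr0 [psi _ * (t * _)]mulrCA.
  have h : kap * `|e| ^+ 2 * n%:R <= loss n t e w - loss n t 0 w + t * sc.
    rewrite -ler_pdivlMr// [leRHS]mulrC -E; exact: curv (ltW eA).
  have h1 : loss n t e w - loss n t 0 w <= D * Num.sqrt n%:R * `|e|.
    rewrite lerBlDl (le_trans H1)// lerD2l ler_wpM2l//; last by rewrite ge_min lexx orbT.
    by rewrite mulr_ge0// ltW.
  have h2 : t * sc <= t1 * (B * Num.sqrt n%:R * `|e|).
    apply: (le_trans (ler_wpM2l (ltW tpos) (le_trans (ler_norm _) (score e)))).
    by rewrite ler_wpM2r// !mulr_ge0// ltW.
  rewrite ler_pdivlMr//.
  have h3 : `|e| * Num.sqrt n%:R * kap <= D + t1 * B.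
    rewrite -(@ler_pM2r _ (`|e| * Num.sqrt n%:R)) ?mulr_gt0//.
    rewrite (_ : _ * kap * _ = kap * `|e| ^+ 2 * (Num.sqrt n%:R * Num.sqrt n%:R)); last ring.
    rewrite sn2.
    by apply: (le_trans h); apply: (le_trans (lerD h1 h2)); rewrite le_eqVlt;
      apply/orP; left; apply/eqP; ring.
  by rewrite -ler_pdivlMr// in h3; rewrite (le_trans h3)// lerDl.
have tail j : `|e 0 (rshift s j)| <= Dr / Num.sqrt n%:R.
  exact: le_trans (coord_norm_le _ _) e_small.
set Sq := \sum_(j < k) `|e 0 (rshift s j)| `^ q in H2.
have Sq0 : 0 <= Sq by rewrite sumr_ge0// => j _; rewrite powR_ge0.
have C0 := smooth_C_gt0 S.
have Sq_le : cn * Sq <= (t1 * B + C * t1 ^+ 2 * Dr * V) *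
    (Dr `^ (1 - q) * n%:R `^ (q / 2)) * Sq.
  have h1 := loss_support_part n0 (ltW tpos) (ltW Dr0) V0 e_small l1V score.
  have h2 : cn * Sq <= loss n t (support_part e) w - loss n t e w by lra.
  apply: (le_trans h2); apply: (le_trans h1); rewrite -!mulrA.
  apply: ler_pM.
  - by rewrite addr_ge0// !mulr_ge0 ?sqr_ge0// ltW.
  - by rewrite mulr_ge0// ltW.
  - apply: lerD; first by rewrite ler_wpM2r// ltW.
    rewrite ler_wpM2l ?(ltW C0)// (mulrA t) (mulrA t1).
    by rewrite ler_wpM2r ?(mulr_ge0 (ltW Dr0))// ler_pM// ltW.
  - apply: (@le_trans _ _ (Num.sqrt n%:R * \sum_(j < k) `|e 0 (rshift s j)|)).
      by rewrite ler_wpM2l ?(ltW sn)// norm_sub_support_part.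
    rewrite mulrA /Sq !mulr_sumr; apply: ler_sum => j _.
    exact: powR_split.
(* If [Sq] were positive it could be cancelled in [Sq_le], against the strict lower bound on
   [cn]. *)
have Sq_eq0 : Sq = 0.
  apply/eqP; rewrite eq_le Sq0 andbT leNgt; apply/negP => Sqpos.
  by move: Sq_le; rewrite ler_pM2r// leNgt cnE.
apply/rowP => j; rewrite !mxE; apply/eqP.
have /eqP := Sq_eq0; rewrite psumr_eq0 => [|l _]; last exact: powR_ge0.
move=> /allP/(_ j); rewrite mem_index_enum => /(_ isT).
by rewrite powR_eq0 normr_eq0 => /andP[].
Qed.

(* The two inequalities record that the penalized objective at the estimator does
   not exceed its value at beta0 and at the truncated estimator. *)
Lemma whp_sparsity (t0 t1 q : R) (tau : nat -> T -> R)
    (dh : nat -> T -> 'rV[R]_(s + k)) :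
  0 < t0 -> t0 < t1 -> 0 < q -> q <= 1 ->
  whp P (fun n => [set w | t0 <= tau n w <= t1]) ->
  (forall eta, 0 < eta -> whp P (fun n => [set w | loss n (tau n w) 0 w <= n%:R * (b + eta)])) ->
  (forall e, 0 < e -> exists (D : R) (c : nat -> R),
    [/\ 0 <= D, c n / n%:R `^ (q / 2) @[n --> \oo] --> +oo &
    \forall n \near \oo, fails_le P [set w |
      loss n (tau n w) (dh n w) w <=
        loss n (tau n w) 0 w + D * Num.sqrt n%:R * Num.min 1 `|dh n w| /\
      loss n (tau n w) (dh n w) w + c n * \sum_(j < k) `|dh n w 0 (rshift s j)| `^ q <=
        loss n (tau n w) (support_part (dh n w)) w] e]) ->
  whp P (fun n => [set w | rsubmx (dh n w) = 0]).
Proof.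
move=> t00 t01 q0 q1 wT wL H e e0.
have [A [eta [eta0 hfar]]] := loss_far S mW lawW indW B2 t00.
(* If [dotv v a] vanished almost surely, B2 would read [1 < 1 - b]. *)
have G_nd (a : 'rV[R]_(s + k)) : a != 0 -> (0 < G0 [set v | dotv v a != 0%R])%E.
  move=> a0; rewrite lt_neqAle measure_ge0 andbT eq_sym; apply/negP => /eqP Ga.
  have mA : measurable [set v | dotv v a != 0].
    rewrite (_ : [set v | _] = ~` [set v | dotv v a = 0]); last first.
      by apply/seteqP; split => v /= /eqP.
    apply: measurableC; rewrite -[X in measurable X]setTI.
    exact: (measurable_dotv a measurableT (measurable_set1 0)).
  have := B2 a0; rewrite (_ : [set v | _] = ~` [set v | dotv v a != 0]); last first.
    by apply/seteqP; split => v /=; [move=> ->; rewrite eqxx|move/negP; rewrite negbK => /eqP].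
  rewrite (probability_setC G0 mA) Ga sube0 lte_fin => h.
  by have := b_gt0; lra.
have [kap kap0 hcurv] := loss_curvature fd f_even f_cont f_noninc f_dec0 G2 S mW lawW
  indW A t1 G_nd t00.
(* The constants of the score and of the comparison depend on the tolerance, so each is chosen for
   [e / 4]; the events with fixed constants share [e / 2]. *)
have e4 : 0 < e / 4 by rewrite divr_gt0.
have [B B0 hscore] := score_tight fd f_even G2 S mW lawW indW t00 t01 e4.
have [D [c [D0 c_lim hH]]] := H _ e4.
pose V := \int[G0]_v (l1norm v ^+ 2) + 1.
have V0 : 0 <= V by rewrite addr_ge0// Rintegral_ge0// => v _; rewrite sqr_ge0.
have eta30 : 0 < eta / 3 by rewrite divr_gt0.
have wV : whp P (fun n => [set w | emp_mean W n (fun z => l1norm z.1 ^+ 2) w <= V]).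
  have [iV eV] := integral_fst F0 (integrable_l1norm2 G2).
  apply: whpS (emp_mean_whp mW lawW indW iV ltr01); apply: nearW => n w /=.
  by rewrite eV ler_norml /V => /andP[_]; lra.
have wdet := whpI (whpI wT (wL _ eta30)) (whpI (whpI hfar hcurv) wV).
pose Dr := (D + t1 * B) / kap + 1.
pose E := (t1 * B + C * t1 ^+ 2 * Dr * V) * Dr `^ (1 - q).
have e2 : 0 < e / 2 by rewrite divr_gt0.
near=> n.
have n0 : (0 < n)%N by near: n; exists 1%N.
have n0' : 0 < n%:R :> R by rewrite ltr0n.
have F1 : fails_le P ([set w | t0 <= tau n w <= t1] `&`
    [set w | loss n (tau n w) 0 w <= n%:R * (b + eta / 3)] `&`
    ([set w | forall t (a : 'rV[R]_(s + k)), t0 <= t -> A <= `|a| ->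
      b + eta <= emp_mean W n (fun z => rho (t * (z.2 - dotv z.1 a))) w] `&`
    [set w | forall t (a : 'rV[R]_(s + k)), t0 <= t <= t1 -> `|a| <= A ->
      kap * `|a| ^+ 2 <= emp_mean W n (fun z =>
        rho (t * (z.2 - dotv z.1 a)) - rho (t * z.2) +
        psi (t * z.2) * (t * dotv z.1 a)) w] `&`
    [set w | emp_mean W n (fun z => l1norm z.1 ^+ 2) w <= V])) (e / 2).
  by near: n; exact: wdet.
have F2 := hscore n n0.
have F3 : fails_le P [set w |
      loss n (tau n w) (dh n w) w <=
        loss n (tau n w) 0 w + D * Num.sqrt n%:R * Num.min 1 `|dh n w| /\
      loss n (tau n w) (dh n w) w + c n * \sum_(j < k) `|dh n w 0 (rshift s j)| `^ q <=
        loss n (tau n w) (support_part (dh n w)) w] (e / 4).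
  by near: n.
have Dn : D <= eta / 3 * Num.sqrt n%:R.
  rewrite -ler_pdivrMl//; near: n.
  exact: sqrt_nat_ge.
have cn : E * n%:R `^ (q / 2) < c n.
  rewrite -ltr_pdivlMr ?powR_gt0//; near: n.
  by apply: (cvgryPgt _).1 => //.
have ee : e / 2 + (e / 4 + e / 4) = e by field.
rewrite -[X in fails_le _ _ X]ee.
apply: (fails_leS _ (lexx _) (fails_leI F1 (fails_leI F2 F3))).
move=> w [/= [[tw Lw] [[fw cw] Vw]] [sw [H1w H2w]]].
apply: (@sparsity_event t0 t1 q (tau n w) A eta kap B V D (c n) n) => //.
- move=> Ae; have /andP[tt _] := tw.
  by rewrite mulrC -ler_pdivlMr// [leRHS]mulrC; exact: fw Ae.
- exact: Lw.
- by move=> eA; exact: cw.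
- by move=> a; exact: sw.
- exact: Vw.
- exact: H1w.
- exact: H2w.
- by rewrite mulrA; exact: cn.
Unshelve. all: end_near.
Qed.

End sparsity.

(** * Bounds on the preliminary scale *)

(** The mean loss exceeds [b] for all scales up to [a] and is at most [b] at [A], so the infimum
    lies between them. Continuity in the scale makes the infimum attained, and the residuals at the
    estimated scale themselves have mean loss at most [b]. *)
Lemma mscale_bounds {R : realType} (rho psi dpsi : R -> R) (M C b a A : R) n
    (u : 'rV[R]_n) :
  smooth_rho rho psi dpsi M C -> 0 < a -> 0 < A ->
  n%:R^-1 * (\sum_(i < n) rho (u 0 i / A)) <= b ->
  (forall r, 0 < r -> r <= a -> b < n%:R^-1 * (\sum_(i < n) rho (u 0 i / r))) ->
  a <= Defs.mscale rho b u <= A /\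
  n%:R^-1 * (\sum_(i < n) rho (u 0 i / Defs.mscale rho b u)) <= b.
Proof.
move=> S a0 A0 Ab ab.
pose E := [set r | 0 < r /\ n%:R^-1 * (\sum_(i < n) rho (u 0 i / r)) <= b].
have Elb : lbound E a.
  move=> r [r0 rb]; rewrite leNgt; apply/negP => ra.
  by have := ab _ r0 (ltW ra); rewrite ltNge rb.
have hE : has_inf E by split; [exists A|exists a].
have sa : a <= Defs.mscale rho b u by apply: lb_le_inf => //; exists A.
have sA : Defs.mscale rho b u <= A by apply: ge_inf => //; exists a.
split; first by rewrite sa sA.
set sg := Defs.mscale rho b u; have sg0 : 0 < sg := lt_le_trans a0 sa.
rewrite leNgt; apply/negP => sgb.
have cont : (fun r => n%:R^-1 * (\sum_(i < n) rho (u 0 i / r))) @ sg -->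
    n%:R^-1 * (\sum_(i < n) rho (u 0 i / sg)).
  apply: cvgM; first exact: cvg_cst.
  apply: cvg_big => [|i _]; first exact: add_continuous.
  have cr : u 0 i / r @[r --> sg] --> u 0 i / sg.
    apply: cvgM; first exact: cvg_cst.
    by apply: cvgV; [rewrite gt_eqF|exact: cvg_id].
  have crho : continuous rho by exact: (smooth_continuous S).
  exact: (cvg_comp _ _ cr (crho _)).
have /= [dl /= dl0 hdl] := cvgr_gt _ cont _ sgb.
have [r [r0 rb] rs] := inf_adherent dl0 hE.
have sr : sg <= r by apply: ge_inf => //; exists a.
have : b < n%:R^-1 * (\sum_(i < n) rho (u 0 i / r)).
  by apply: hdl; rewrite /= ler0_norm ?subr_le0// opprB ltrBlDl.
by rewrite ltNge rb.
Qed.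

Section scale_bounds.
Context {R : realType} {p : nat} {d} {T : measurableType d} (P : probability T R)
  (G0 : probability 'rV[R]_p R) (F0 : probability R R) (f : R -> R).
Hypothesis fd : has_density F0 f.
Context (b : R).
Hypothesis b_gt0 : 0 < b.
Hypothesis b_lt1 : b < 1.
Context (rho psi dpsi : R -> R) (M C : R).
Hypothesis S : smooth_rho rho psi dpsi M C.
Local Notation mu := (G0 \x F0)%E.
Context (W : nat -> T -> 'rV[R]_p * R).
Hypothesis mW : forall i, measurable_fun setT (W i).
Hypothesis lawW : forall i, has_law P (W i) mu.
Hypothesis indW : forall i j, i != j -> independent2 P (W i) (W j).

(** No moment of the errors is assumed, so the sample is split at [N z <= A0]: inside, the Lipschitz
    bound gives at most [C * A0 / A = b / 4]; outside, the loss is at most 1 on a set of probability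
    at most [b / 4]. The law of large numbers uses up the remaining [b / 2]. *)
Lemma scale_upper : exists2 A : R, 0 < A & whp P (fun n => [set w |
  forall e : 'rV[R]_p, `|e| <= 1 ->
    emp_mean W n (fun z => rho ((z.2 - dotv z.1 e) / A)) w <= b]).
Proof.
pose N (z : 'rV[R]_p * R) := `|z.2| + l1norm z.1.
have mN : measurable_fun setT N.
  apply: measurable_funD.
    exact: (measurableT_comp (@normr_measurable R setT) measurable_snd).
  exact: (measurableT_comp (@measurable_l1norm R p) measurable_fst).
have i1 : mu.-integrable setT (EFin \o (fun=> 1 : R)).
  by apply: (@integrable_bounded _ _ _ mu _ 1) => // z; rewrite normr1.
have b4 : 0 < b / 4 by rewrite divr_gt0.
have [A0 A00 tA] := tail_integral i1 (fun=> ler01) mN b4.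
have C0 := smooth_C_gt0 S.
pose A := 4 * C * A0 / b.
have A_gt0 : 0 < A by rewrite divr_gt0// !mulr_gt0.
exists A => //.
pose l z : R := 1 * (A0 < N z)%R%:R.
have ml : measurable_fun setT l.
  by apply: measurable_funM => //; exact: measurable_ltr_indic.
have il : mu.-integrable setT (EFin \o l).
  by apply: (@integrable_bounded _ _ _ mu _ 1) => // z; rewrite /l mul1r ger0_norm// lern1 leq_b1.
have b2 : 0 < b / 2 by rewrite divr_gt0.
apply: whpS (whpI (whp_near P (nbhs_infty_gt 0)) (emp_mean_whp mW lawW indW il b2)).
apply: nearW => n w [/= n0 hw] e e1.
have n0' : 0 < n%:R :> R by rewrite ltr0n.
apply: (@le_trans _ _ (emp_mean W n (fun z => b / 4 + l z) w)).
  apply: emp_mean_le => z.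
  have zN : `|z.2 - dotv z.1 e| <= N z.
    rewrite (le_trans (ler_normB _ _))// lerD2l (le_trans (dotv_le _ _))//.
    by rewrite ler_piMr// l1norm_ge0.
  rewrite /l mul1r; case: (ltP A0 (N z)) => AN.
    by rewrite (le_trans (smooth_le1 S _))// lerDr ltW.
  rewrite addr0; have := smooth_lipschitz S ((z.2 - dotv z.1 e) / A) 0.
  rewrite (smooth_0 S) !subr0 => /(le_trans (ler_norm _)) h; apply: (le_trans h).
  rewrite normrM normfV (gtr0_norm A_gt0) mulrA ler_pdivrMr//.
  rewrite (_ : b / 4 * A = C * A0); last by rewrite /A; field; rewrite gt_eqF.
  by rewrite ler_wpM2l ?(ltW C0)// (le_trans zN).
rewrite /emp_mean big_split/= sumr_const card_ord mulrDr -[(b / 4) *+ n]mulr_natl mulKf ?gt_eqF//.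
by move: hw; rewrite ler_norml => /andP[_]; rewrite -/(emp_mean W n l w); rewrite /l in tA *; lra.
Qed.

Lemma integral_snd (g : R -> R) : F0.-integrable setT (EFin \o g) ->
  mu.-integrable setT (EFin \o (fun z : 'rV[R]_p * R => g z.2)) /\
  \int[mu]_z g z.2 = \int[F0]_x g x.
Proof.
apply: integral_measure_preserving => // A mA.
rewrite (_ : snd @^-1` A = setT `*` A); last first.
  by apply/seteqP; split => z //= [].
by rewrite /= product_measure1E//= (@probability_setT _ _ _ G0) mul1e.
Qed.

(** An error with a density is almost surely non-zero. Dividing by a small scale therefore saturates
    the loss on a set of probability close to 1, hence above [b], and a small shift of the
    coefficients does not spoil this. *)
Lemma scale_lower : exists a dl : R, [/\ 0 < a, 0 < dl & whp P (fun n => [set w |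
  forall (e : 'rV[R]_p) r, `|e| <= dl -> 0 < r -> r <= a ->
    b < emp_mean W n (fun z => rho ((z.2 - dotv z.1 e) / r)) w])].
Proof.
pose g0 : R -> R := \1_(~` [set 0]).
have m0 : measurable (~` [set (0 : R)]) by apply: measurableC; exact: measurable_set1.
have ig0 : F0.-integrable setT (EFin \o g0).
  apply: (@integrable_bounded _ _ _ _ _ 1); first exact: measurable_indic.
  by move=> v; rewrite ger0_norm /g0 indicE// lern1 leq_b1.
have Eg0 : \int[F0]_v g0 v = 1.
  have [_ _ fA] := fd.
  rewrite /Rintegral integral_indic// setIT /= (probability_setC F0 (measurable_set1 0)).
  by rewrite fA ?integral_set1 ?sube0//; exact: measurable_set1.
have [ig Eg] := integral_snd ig0; rewrite Eg0 in Eg.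
pose g (z : 'rV[R]_p * R) := g0 z.2.
have g_ge0 z : 0 <= g z by rewrite /g /g0 indicE.
have mg : measurable_fun setT g := integrable_measurable ig.
pose N (z : 'rV[R]_p * R) := Num.max (l1norm z.1) (`|z.2| `^ (-1)).
have mN : measurable_fun setT N.
  apply: measurable_maxr.
    exact: (measurableT_comp (@measurable_l1norm R p) measurable_fst).
  apply: (@measurableT_comp _ _ _ _ _ _ (fun x : R => x `^ (-1)) _ (fun z : 'rV[R]_p * R => `|z.2|)).
    exact: measurable_powR.
  exact: (measurableT_comp (@normr_measurable R setT) measurable_snd).
have c0 : 0 < (1 - b) / 2 by rewrite divr_gt0// subr_gt0.
have [A A0 tA] := tail_integral ig g_ge0 mN c0.
pose l z := g z - g z * (A < N z)%R%:R.
have mh : measurable_fun setT (fun z => g z * (A < N z)%R%:R).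
  by apply: measurable_funM => //; exact: measurable_ltr_indic.
have ih : mu.-integrable setT (EFin \o (fun z => g z * (A < N z)%R%:R)).
  apply: (integrable_dom mh ig) => z; rewrite ger0_norm ?mulr_ge0//.
  by rewrite ler_piMr// ?lern1 ?leq_b1//; exact: g_ge0.
have il : mu.-integrable setT (EFin \o l).
  exact: eq_integrable (integrableB measurableT ig ih).
have El : (1 + b) / 2 <= \int[mu]_z l z.
  by rewrite /l RintegralB//; rewrite /g Eg; rewrite /g in tA; lra.
have M0 := smooth_M_gt0 S.
have c40 : 0 < (1 - b) / 4 by rewrite divr_gt0// subr_gt0.
(* With the error at least [A^-1] and the shift at most [A * dl = 2^-1 * A^-1], the residual is at
   least [2^-1 * A^-1], which is [M] times the largest scale considered. *)
exists (2^-1 * A^-1 / M), (2^-1 * A^-1 * A^-1); split.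
- by rewrite !mulr_gt0 ?invr_gt0.
- by rewrite !mulr_gt0 ?invr_gt0.
apply: whpS (emp_mean_whp mW lawW indW il c40); apply: nearW => n w /= hw e r ee r0 ra.
apply: (@lt_le_trans _ _ (emp_mean W n l w)).
  by move: hw; rewrite ler_norml => /andP[? _]; lra.
apply: emp_mean_le => z.
rewrite /l /g /g0 indicE; case: (boolP (z.2 \in _)) => zE; last first.
  by rewrite mul0r subrr (smooth_ge0 S).
rewrite mul1r; case: (ltP A (N z)) => AN /=.
  by rewrite subrr (smooth_ge0 S).
move: AN; rewrite ge_max => /andP[zN uN].
have dz : 0 < `|z.2| by rewrite normr_gt0; apply/eqP; rewrite inE in zE.
have dzA : A^-1 <= `|z.2|.
  by rewrite -[leRHS]invrK lef_pV2 ?posrE ?invr_gt0// -powR_inv1// ltW.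
have de : `|dotv z.1 e| <= 2^-1 * A^-1.
  rewrite (le_trans (dotv_le _ _))//.
  rewrite (@le_trans _ _ (A * (2^-1 * A^-1 * A^-1)))//.
    by rewrite ler_pM ?l1norm_ge0.
  by rewrite le_eqVlt; apply/orP; left; apply/eqP; field; rewrite gt_eqF.
have far : 2^-1 * A^-1 <= `|z.2 - dotv z.1 e|.
  by have := ler_normD (z.2 - dotv z.1 e) (dotv z.1 e); rewrite subrK; lra.
rewrite subr0 (smooth_1 S)// normrM normfV (gtr0_norm r0) ler_pdivlMr//.
by rewrite (le_trans _ far)// mulrC -ler_pdivlMr.
Qed.

End scale_bounds.

(** * The two estimators *)

Lemma whp_cvg1 {R : realType} {d} {T : measurableType d} (P : probability T R)
    (E : nat -> set T) :
  (forall n, measurable (E n)) -> whp P E -> P (E n) @[n --> \oo] --> 1%E.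
Proof.
move=> mE wE; apply/fine_cvgP; split.
  by apply: nearW => n; exact: fin_num_measure.
apply/cvgrPdist_le => e e0; near=> n.
have : fails_le P (E n) e by near: n; exact: wE.
move=> /(fails_le_probability (mE n)).
have := probability_le1 P (mE n).
rewrite /= -(fineK (fin_num_measure P _ (mE n))) -EFinB !lee_fin => p1 p2.
by rewrite ger0_norm ?subr_ge0//; lra.
Unshelve. all: by end_near. Qed.

(** * From the observations to the design vectors and errors *)

Section regression_model.
Context {R : realType} {p : nat} {d} {T : measurableType d} (P : probability T R)
  (x : nat -> {RV P >-> 'rV[R]_p}) (y u : nat -> {RV P >-> R})
  (G0 : probability 'rV[R]_p R) (F0 : probability R R) (beta0 : 'rV[R]_p).
Hypothesis model : forall i w, y i w = dotv (x i w) beta0 + u i w.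
Hypothesis obs_iid : iid P (fun i w => (x i w, y i w)).
Hypothesis law_x : forall i, has_law P (x i) G0.
Hypothesis law_u : forall i, has_law P (u i) F0.
Hypothesis indep_ux : forall i, independent2 P (u i) (x i).

Definition design_error (i : nat) (w : T) : 'rV[R]_p * R := (x i w, u i w).
Local Notation W := design_error.

Lemma measurable_design_error i : measurable_fun setT (W i).
Proof. by apply: measurable_fun_pair; exact: measurable_funP. Qed.

Lemma law_design_error i : has_law P (W i) (G0 \x F0)%E.
Proof.
have mW := measurable_design_error i.
pose W' : {mfun T >-> ('rV[R]_p * R)%type} :=
  HB.pack (W i) (isMeasurableFun.Build _ _ _ _ _ mW).
move=> A mA; symmetry.
apply: (@product_measure_unique _ _ _ _ _ G0 F0 (distribution P W')) => //= B D mB mD.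
rewrite -(law_x i)// -(law_u i)// muleC -indep_ux//.
rewrite setIC; congr (P _).
Qed.

(** Independence is assumed for the observed pairs; the pair of design vector and error is the image
    of the observed pair under one fixed measurable map [sh]. *)
Lemma indep_design_error i j : i != j -> independent2 P (W i) (W j).
Proof.
move=> ij A B mA mB.
pose sh (z : 'rV[R]_p * R) := (z.1, z.2 - dotv z.1 beta0).
have msh : measurable_fun setT sh.
  apply: measurable_fun_pair; first exact: measurable_fst.
  apply: measurable_funB; first exact: measurable_snd.
  exact: (measurableT_comp (measurable_dotv beta0) measurable_fst).
have WE m D : W m @^-1` D = (fun w => (x m w, y m w)) @^-1` (sh @^-1` D).
  by apply/seteqP; split => w; rewrite /preimage/= /sh /= model /W addrAC subrr add0r.
pose AB m := if m == i then sh @^-1` A else sh @^-1` B.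
have mAB m : measurable (AB m).
  by rewrite /AB; case: ifP => _; rewrite -[X in measurable X]setTI; exact: msh.
have [/(_ [fset i; j]%fset AB mAB) + _] := obs_iid.
rewrite big_fsetU1 ?inE//= big_seq_fset1 /AB eqxx eq_sym (negbTE ij) !WE => <-.
congr (P _); apply/seteqP; split => w.
  move=> [h1 h2] m /=; rewrite !inE => /orP[] /eqP ->; first by rewrite eqxx.
  by rewrite eq_sym (negbTE ij).
move=> h; split.
  by have := h i; rewrite /= !inE eqxx => /(_ isT).
by have := h j; rewrite /= !inE eqxx orbT eq_sym (negbTE ij) => /(_ isT).
Qed.

Lemma residuals_design_error n w beta (i : 'I_n) :
  residuals (first_obs x y n w) beta 0 i =
    (W i w).2 - dotv (W i w).1 (beta - beta0).
Proof.
by rewrite mxE tnth_mktuple /= model dotvB /W /=; ring.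
Qed.

Lemma measurable_first_obs n : measurable_fun setT (first_obs x y n).
Proof.
apply/measurable_fun_tnthP => i.
rewrite (_ : _ \o _ = fun w => (x i w, y i w)); last first.
  by apply/funext => w; rewrite /= tnth_mktuple.
by apply: measurable_fun_pair; exact: measurable_funP.
Qed.

Lemma measurable_est_coord (est : estimator R p) n j :
  measurable_fun setT (fun w => est n (first_obs x y n w) 0 j).
Proof.
apply: (@measurableT_comp _ _ _ _ _ _ (fun v : 'rV[R]_p => v 0 j) _
  (fun w => est n (first_obs x y n w))).
  exact: measurable_coord.
apply: (@measurableT_comp _ _ _ _ _ _ (est n)); first exact: measurable_funP.
exact: measurable_first_obs.
Qed.

Lemma measurable_enorm_est (est : estimator R p) n :
  measurable_fun setT (fun w => enorm (est n (first_obs x y n w) - beta0)).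
Proof.
apply: (@measurableT_comp _ _ _ _ _ _ (@Num.sqrt R)); first exact: (continuous_measurable_fun (@sqrt_continuous R)).
apply: measurable_sum => j.
under eq_fun do rewrite !mxE.
apply: measurable_funX; apply: measurable_funB => //; exact: measurable_est_coord.
Qed.

Lemma coord_le_enorm (v : 'rV[R]_p) j : `|v 0 j| <= enorm v.
Proof.
rewrite /enorm -sqrtr_sqr ler_wsqrtr// (bigD1 j)//= lerDl sumr_ge0// => l _.
exact: sqr_ge0.
Qed.

Lemma norm_le_enorm (v : 'rV[R]_p) : `|v| <= enorm v.
Proof.
rewrite [leLHS]/Num.Def.normr/= mx_normrE; apply: bigmax_le; first exact: sqrtr_ge0.
by move=> [i j] _ /=; rewrite ord1 coord_le_enorm.
Qed.

Lemma measurable_gt_enorm (est : estimator R p) n r :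
  measurable [set w | r < enorm (est n (first_obs x y n w) - beta0)].
Proof.
rewrite (_ : [set w | _] =
  (fun w => enorm (est n (first_obs x y n w) - beta0)) @^-1` `]r, +oo[); last first.
  by apply/seteqP; split => w /=; rewrite in_itv/= andbT.
by rewrite -[X in measurable X]setTI; exact: measurable_enorm_est.
Qed.

Lemma consistent_whp (est : estimator R p) e :
  consistent P (fun n w => est n (first_obs x y n w)) beta0 -> 0 < e ->
  whp P (fun n => [set w | `|est n (first_obs x y n w) - beta0| <= e]).
Proof.
move=> cons e0 r r0.
have /fine_cvgP[_ /cvgrPdist_le/(_ _ r0)] := cons _ e0.
apply: filterS => n /=; rewrite sub0r normrN => h.
exists [set w | e < enorm (est n (first_obs x y n w) - beta0)]; split.
- exact: measurable_gt_enorm.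
- move=> w /= /negP; rewrite -ltNge => /lt_le_trans; apply; exact: norm_le_enorm.
- rewrite -(fineK (fin_num_measure P _ (measurable_gt_enorm _ _ _))) lee_fin.
  exact: le_trans (ler_norm _) h.
Qed.

Lemma sqrtn_consistent_fails_le (est : estimator R p) e :
  sqrtn_consistent P (fun n w => est n (first_obs x y n w)) beta0 -> 0 < e ->
  exists2 B : R, 0 < B & \forall n \near \oo, fails_le P [set w |
    forall j, `|(est n (first_obs x y n w) - beta0) 0 j| <= B / Num.sqrt n%:R] e.
Proof.
move=> cons e0; have [B hB] := cons e e0.
exists (`|B| + 1); first by rewrite ltr_pwDr.
apply: filterS hB => n hn.
have E : [set w | (B * (1 / Num.sqrt n%:R) < `|enorm (est n (first_obs x y n w) - beta0)|)%R] =
    [set w | B * (1 / Num.sqrt n%:R) < enorm (est n (first_obs x y n w) - beta0)].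
  by apply/seteqP; split => w /=; rewrite ger0_norm// sqrtr_ge0.
exists [set w | B * (1 / Num.sqrt n%:R) < enorm (est n (first_obs x y n w) - beta0)]; split.
- exact: measurable_gt_enorm.
- move=> w /= h; rewrite ltNge; apply/negP => h'; apply: h => j.
  apply: (le_trans (coord_le_enorm _ _)); apply: (le_trans h').
  rewrite div1r ler_wpM2r ?invr_ge0 ?sqrtr_ge0//.
  by have := ler_norm B; lra.
- by rewrite -E.
Qed.

Lemma measurable_support (k : nat) (cast : 'I_k -> 'I_p) (est : estimator R p) n :
  measurable [set w | forall j, est n (first_obs x y n w) 0 (cast j) = 0].
Proof.
rewrite (_ : [set w | _] = \big[setI/setT]_(j < k)
  ((fun w => est n (first_obs x y n w) 0 (cast j)) @^-1` [set 0])); last first.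
  apply/seteqP; split => w /=.
    by move=> h; apply: (big_ind (fun A : set T => A w)) => // j _; exact: h.
  move=> h j; move: h; rewrite (bigD1 j)//= => -[].
  by [].
apply: bigsetI_measurable => j _; rewrite -[X in measurable X]setTI.
by apply: measurable_est_coord => //; exact: measurable_set1.
Qed.

End regression_model.

(** When the two points are at distance at least 1 the term [|a| ^ q] suffices. Otherwise
    [|c| < |a|] is the only case of interest, and there [|c| ^ (q - 1) >= |a| ^ (q - 1)], since
    [q <= 1], gives the slope [|a| ^ (q - 1)]. *)
Lemma powR_diff_le {R : realType} (a c q : R) : a != 0 -> 0 < q -> q <= 1 ->
  `|a| `^ q - `|c| `^ q <= (`|a| `^ q + `|a| `^ (q - 1)) * Num.min 1 `|c - a|.
Proof.
move=> a0 q0 q1; have a_gt0 : 0 < `|a| by rewrite normr_gt0.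
have p2 : 0 <= `|a| `^ (q - 1) by exact: powR_ge0.
have p3 : 0 <= `|c| `^ q by exact: powR_ge0.
have aE : `|a| `^ (q - 1) * `|a| = `|a| `^ q.
  by rewrite -[X in _ * X](powRr1 (ltW a_gt0)) -powRD ?subrK// (gt_eqF a_gt0) implybT.
have [h|h] := leP 1 `|c - a|; first by rewrite mulr1; lra.
rewrite mulrDl; have ca : 0 <= `|c - a| by [].
have : 0 <= `|a| `^ q * `|c - a| by rewrite mulr_ge0.
suff : `|a| `^ q - `|c| `^ q <= `|a| `^ (q - 1) * `|c - a| by lra.
have tri : `|a| - `|c| <= `|c - a| by rewrite distrC lerB_dist.
have [ac|ca'] := leP `|a| `|c|.
  apply: (@le_trans _ _ 0); last by rewrite mulr_ge0.
  by rewrite subr_le0 ge0_ler_powR ?nnegrE// ltW.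
apply: (@le_trans _ _ (`|a| `^ (q - 1) * (`|a| - `|c|))); last by rewrite ler_wpM2l.
rewrite mulrBr aE lerD2l lerN2.
have [->|c0] := eqVneq c 0; first by rewrite normr0 mulr0 powR_ge0.
have c_gt0 : 0 < `|c| by rewrite normr_gt0.
have cE : `|c| `^ (q - 1) * `|c| = `|c| `^ q.
  by rewrite -[X in _ * X](powRr1 (ltW c_gt0)) -powRD ?subrK// (gt_eqF c_gt0) implybT.
rewrite -cE ler_wpM2r//.
rewrite -[q - 1]opprB !powRN lef_pV2 ?posrE ?powR_gt0//.
by rewrite ge0_ler_powR ?nnegrE ?subr_ge0// ltW.
Qed.

(** Weights [om] treat both estimators at once: constant 1 for Bridge, inverse powers of the
    preliminary estimate for the adaptive one. The lower bound [wm] is required only after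
    multiplication by the power of [bh], because a vanishing preliminary coordinate gives weight 0
    by the convention for inverses, while [bh] vanishes there too. *)
Lemma bridge_comparison {R : realType} (s k : nat) (L : 'rV[R]_(s + k) -> R)
    (b0 : 'rV[R]_s) (bh : 'rV[R]_(s + k)) (om : 'I_(s + k) -> R) (lam q Om wm : R) :
  0 < lam -> 0 < q -> q <= 1 -> (forall j, b0 0 j != 0) ->
  (forall j, 0 <= om (lshift k j) <= Om) ->
  (forall j, wm * `|bh 0 (rshift s j)| `^ q <=
     om (rshift s j) * `|bh 0 (rshift s j)| `^ q) ->
  0 <= wm ->
  L bh + lam * \sum_j om j * `|bh 0 j| `^ q <=
    L (row_mx b0 0) + lam * \sum_j om j * `|(row_mx b0 0 : 'rV_(s + k)) 0 j| `^ q ->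
  L bh + lam * \sum_j om j * `|bh 0 j| `^ q <=
    L (row_mx (lsubmx bh) 0) + lam * \sum_j om j *
      `|(row_mx (lsubmx bh) 0 : 'rV_(s + k)) 0 j| `^ q ->
  L bh <= L (row_mx b0 0) + lam * (Om * \sum_j (`|b0 0 j| `^ q + `|b0 0 j| `^ (q - 1))) *
     Num.min 1 `|bh - row_mx b0 0| /\
  L bh + lam * wm * \sum_(j < k) `|bh 0 (rshift s j)| `^ q <= L (row_mx (lsubmx bh) 0).
Proof.
move=> lam0 q0 q1 b00 omL omR wm0.
have pow0 : `|0 : R| `^ q = 0 by rewrite normr0 powR0// gt_eqF.
rewrite !big_split_ord/=.
under [in X in _ <= _ + lam * (X + _) -> _]eq_bigr do rewrite row_mxEl.
under [in X in _ <= _ + lam * (_ + X) -> _]eq_bigr do rewrite row_mxEr mxE pow0 mulr0.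
under [in X in _ -> _ <= _ + lam * (X + _) -> _]eq_bigr do rewrite row_mxEl mxE.
under [in X in _ -> _ <= _ + lam * (_ + X) -> _]eq_bigr do rewrite row_mxEr mxE pow0 mulr0.
rewrite !big1_eq !addr0 !mulrDr => H1 H2.
have tail : wm * \sum_(j < k) `|bh 0 (rshift s j)| `^ q <=
    \sum_(j < k) om (rshift s j) * `|bh 0 (rshift s j)| `^ q.
  by rewrite mulr_sumr; apply: ler_sum => j _.
have S0 : 0 <= \sum_(j < k) `|bh 0 (rshift s j)| `^ q.
  by rewrite sumr_ge0// => j _; rewrite powR_ge0.
have ltail := ler_wpM2l (ltW lam0) tail.
have lt0 : 0 <= lam * (wm * \sum_(j < k) `|bh 0 (rshift s j)| `^ q).
  by rewrite !mulr_ge0// ltW.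
split; last by rewrite -mulrA; lra.
pose m := Num.min 1 `|bh - row_mx b0 0|.
have m0 : 0 <= m by rewrite le_min ler01 normr_ge0.
have head : \sum_(j < s) om (lshift k j) * `|b0 0 j| `^ q -
    \sum_(j < s) om (lshift k j) * `|bh 0 (lshift k j)| `^ q <=
    Om * \sum_j (`|b0 0 j| `^ q + `|b0 0 j| `^ (q - 1)) * m.
  rewrite -sumrB mulr_sumr; apply: ler_sum => j _; rewrite -mulrBr.
  have /andP[om0 omO] := omL j.
  have h := powR_diff_le (bh 0 (lshift k j)) (b00 j) q0 q1.
  have mm : Num.min 1 `|bh 0 (lshift k j) - b0 0 j| <= m.
    rewrite le_min ge_min lexx/= ge_min; apply/orP; right.
    have := coord_norm_le (bh - row_mx b0 0) (lshift k j).
    by rewrite !mxE (unsplitK (inl j)).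
  apply: (@le_trans _ _ (om (lshift k j) * ((`|b0 0 j| `^ q + `|b0 0 j| `^ (q - 1)) * m))).
    by rewrite ler_wpM2l// (le_trans h)// ler_wpM2l.
  by rewrite ler_wpM2r// mulr_ge0.
have lhead := ler_wpM2l (ltW lam0) head.
rewrite -/m.
have E : lam * (Om * \sum_j (`|b0 0 j| `^ q + `|b0 0 j| `^ (q - 1)) * m) =
  lam * (Om * \sum_j (`|b0 0 j| `^ q + `|b0 0 j| `^ (q - 1))) * m.
  by rewrite -mulr_suml !mulrA.
rewrite -E; move: lhead; rewrite mulrBr; lra.
Qed.

(** The competitor has a finite objective, so the minimizer has one as well and must vanish where
    the penalty could be infinite. On such vectors the extended sum is a real one, as the inverse of
    0 is 0. *)
Lemma adaptive_finite {R : realType} {p : nat} (L L' io t vs : R)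
    (b2 bh be : 'rV[R]_p) :
  0 < io -> 0 < t -> 0 < vs -> (forall j, b2 0 j = 0 -> be 0 j = 0) ->
  (L%:E + io%:E * \sum_(j < p) adaptive_penalty t vs b2 bh j <=
    L'%:E + io%:E * \sum_(j < p) adaptive_penalty t vs b2 be j)%E ->
  (forall j, b2 0 j = 0 -> bh 0 j = 0) /\
  L + io * \sum_j (`|b2 0 j| `^ vs)^-1 * `|bh 0 j| `^ t <=
  L' + io * \sum_j (`|b2 0 j| `^ vs)^-1 * `|be 0 j| `^ t.
Proof.
move=> io0 t0 vs0.
have fin (c : 'rV[R]_p) : (forall j, b2 0 j = 0 -> c 0 j = 0) ->
    (\sum_(j < p) adaptive_penalty t vs b2 c j =
     (\sum_j (`|b2 0 j| `^ vs)^-1 * `|c 0 j| `^ t)%:E)%E.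
  move=> c0; rewrite -sumEFin; apply: eq_bigr => j _; rewrite /adaptive_penalty.
  case: eqP => [b20|_]; last by rewrite mulrC.
  by rewrite c0// eqxx normr0 (powR0 (lt0r_neq0 t0)) mulr0.
have ge0 (c : 'rV[R]_p) j : (0 <= adaptive_penalty t vs b2 c j)%E.
  rewrite /adaptive_penalty; case: ifP => _; first by case: ifP.
  by rewrite lee_fin mulr_ge0 ?invr_ge0 ?powR_ge0.
move=> be0; rewrite (fin be be0) => H.
have bh0 j : b2 0 j = 0 -> bh 0 j = 0.
  move=> b20; apply/eqP; apply/negPn/negP => bhj.
  move: H; rewrite (bigD1 j)//= {1}/adaptive_penalty b20 eqxx (negbTE bhj).
  have s0 : (0 <= \sum_(i < p | i != j) adaptive_penalty t vs b2 bh i)%E.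
    by apply: sume_ge0 => i _; exact: ge0.
  rewrite addye; last by rewrite gt_eqF// (lt_le_trans _ s0)// ltNyr.
  by rewrite gt0_muley ?lte_fin// addey// -EFinM -EFinD leye_eq.
split => //; move: H; rewrite (fin bh bh0).
by rewrite -!EFinM -!EFinD lee_fin.
Qed.

Lemma bigO_bound {R : realType} (a b : nat -> R) : a =O_\oo b ->
  exists2 K : R, 0 < K & \forall n \near \oo, `|a n| <= K * `|b n|.
Proof. by move=> /eqO_exP[K K0 h]; exists K. Qed.

(** * The MM-Bridge and adaptive MM-Bridge estimators *)

Section mm_estimators.
Context {R : realType} {s k : nat} {d : measure_display} {T : measurableType d}
  (P : probability T R)
  (x : nat -> {RV P >-> 'rV[R]_(s + k)}) (y u : nat -> {RV P >-> R})
  (G0 : probability 'rV[R]_(s + k) R) (F0 : probability R R)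
  (beta0 : 'rV[R]_(s + k)) (b0 : 'rV[R]_s) (b : R) (f : R -> R).
Hypothesis model : forall i w, y i w = dotv (x i w) beta0 + u i w.
Hypothesis obs_iid : iid P (fun i w => (x i w, y i w)).
Hypothesis law_x : forall i, has_law P (x i) G0.
Hypothesis law_u : forall i, has_law P (u i) F0.
Hypothesis indep_ux : forall i, independent2 P (u i) (x i).
Hypothesis beta0E : beta0 = row_mx b0 0.
Hypothesis b0_neq0 : forall j, b0 0 j != 0.
Hypothesis b_gt0 : 0 < b.
Hypothesis b_lt1 : b < 1.
Hypothesis B2 : forall e : 'rV[R]_(s + k), e != 0 ->
  (G0 [set v | dotv v e = 0%R] < (1 - b)%:E)%E.
Hypothesis fd : has_density F0 f.
Hypothesis f_even : even_fun f.
Hypothesis f_cont : continuous f.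
Hypothesis f_noninc : abs_nonincreasing f.
Hypothesis f_dec0 : abs_decreasing_near0 f.
Hypothesis G2 : forall j, G0.-integrable setT (EFin \o (fun v : 'rV[R]_(s + k) => v 0 j ^+ 2)).
Context (rho0 psi0 dpsi0 rho psi dpsi : R -> R) (M0 C0 M C : R).
Hypothesis S0 : smooth_rho rho0 psi0 dpsi0 M0 C0.
Hypothesis S : smooth_rho rho psi dpsi M C.
Hypothesis rho_le : forall v, rho v <= rho0 v.
Context (beta1 : estimator R (s + k)).
Hypothesis beta1_consistent :
  consistent P (fun n w => beta1 n (first_obs x y n w)) beta0.

Local Notation W := (design_error x u).
Let mW := measurable_design_error x u.
Let lawW := law_design_error law_x law_u indep_ux.
Let indW := indep_design_error model obs_iid.

Let sg n w := Defs.mscale rho0 b (residuals (first_obs x y n w) (beta1 n (first_obs x y n w))).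
Let d1 n w := beta1 n (first_obs x y n w) - beta0.

Lemma mm_lossE n w beta : mm_loss rho (sg n w) (first_obs x y n w) beta =
  loss rho W n (sg n w)^-1 (beta - beta0) w.
Proof.
rewrite /mm_loss /loss; apply: eq_bigr => i _.
by rewrite (residuals_design_error model) mulrC.
Qed.

Lemma scale_whp : exists t0 t1 : R, [/\ 0 < t0, t0 < t1 & whp P (fun n => [set w |
  t0 <= (sg n w)^-1 <= t1 /\
  emp_mean W n (fun z => rho0 ((sg n w)^-1 * (z.2 - dotv z.1 (d1 n w)))) w <= b])].
Proof.
have [A A0 wA] := scale_upper b_gt0 S0 mW lawW indW.
have [a [dl [a0 dl0 wa]]] := scale_lower fd b_lt1 S0 mW lawW indW.
(* Adding [A^-1] to the upper end makes [t0 < t1] strict, as the grid on [[t0, t1]] demands. *)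
exists A^-1, (A^-1 + a^-1); split; first by rewrite invr_gt0.
  by rewrite ltrDl invr_gt0.
have w1 := consistent_whp beta1_consistent (ltr01 : 0 < 1).
have w2 := consistent_whp beta1_consistent dl0.
apply: whpS (whpI (whpI wA wa) (whpI w1 w2)).
apply: nearW => n w [/= [hA ha] [n1 n2]].
have E r : n%:R^-1 * \sum_(i < n) rho0 (residuals (first_obs x y n w)
    (beta1 n (first_obs x y n w)) 0 i / r) =
    emp_mean W n (fun z => rho0 ((z.2 - dotv z.1 (d1 n w)) / r)) w.
  rewrite /emp_mean; congr (_ * _); apply: eq_bigr => i _.
  by rewrite (residuals_design_error model).
have hA' : n%:R^-1 * \sum_(i < n) rho0 (residuals (first_obs x y n w)
    (beta1 n (first_obs x y n w)) 0 i / A) <= b by rewrite E; exact: hA.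
have ha' r : 0 < r -> r <= a -> b < n%:R^-1 * \sum_(i < n) rho0
    (residuals (first_obs x y n w) (beta1 n (first_obs x y n w)) 0 i / r).
  by move=> r0 ra; rewrite E; exact: ha.
have [/andP[s1 s2] s3] := mscale_bounds S0 a0 A0 hA' ha'.
have sg0 : 0 < sg n w := lt_le_trans a0 s1.
split.
  rewrite lef_pV2 ?posrE// s2/= (@le_trans _ _ a^-1)//; last by rewrite lerDr invr_ge0 ltW.
  by rewrite lef_pV2 ?posrE.
rewrite E in s3; apply: le_trans s3; rewrite le_eqVlt; apply/orP; left; apply/eqP.
by rewrite /emp_mean; congr (_ * _); apply: eq_bigr => i _; rewrite mulrC.
Qed.

(** The residuals of [beta1] have mean [rho0]-loss at most [b] at their own scale, and
    [rho <= rho0]. Moving from [beta1] to [beta0] changes the loss by at most a Lipschitz constant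
    times [d1], which consistency makes small. *)
Lemma loss_beta0_whp (t1 : R) : 0 < t1 -> 
  whp P (fun n => [set w | 0 < (sg n w)^-1 <= t1 /\
    emp_mean W n (fun z => rho0 ((sg n w)^-1 * (z.2 - dotv z.1 (d1 n w)))) w <= b]) ->
  forall eta, 0 < eta ->
  whp P (fun n => [set w | loss rho W n (sg n w)^-1 0 w <= n%:R * (b + eta)]).
Proof.
move=> t10 wsg eta eta0.
have iN : (G0 \x F0)%E.-integrable setT (EFin \o (fun z : 'rV[R]_(s + k) * R => l1norm z.1 ^+ 2)).
  by have := integrable_l1norm2_mu F0 G2 1; apply: eq_integrable => // z _ /=; rewrite mul1r.
(* One unit comes from bounding the norm by its square plus 1, the other from the accuracy of the
   law of large numbers. *)
pose B := \int[(G0 \x F0)%E]_z (l1norm z.1 ^+ 2) + 2.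
have B0 : 0 < B by rewrite ltr_wpDl// Rintegral_ge0// => z _; rewrite sqr_ge0.
have CC := smooth_C_gt0 S.
have e0 : 0 < eta / (C * t1 * B) by rewrite divr_gt0// !mulr_gt0.
apply: whpS (whpI (whpI wsg (whp_near P (nbhs_infty_gt 0)))
  (whpI (emp_mean_whp mW lawW indW iN ltr01) (consistent_whp beta1_consistent e0))).
apply: nearW => n w [/= [[/andP[sg0 sgt] sb] n0] [mN dn]].
have n0' : 0 < n%:R :> R by rewrite ltr0n.
rewrite mulrC -ler_pdivrMr// mulrC.
set t := (sg n w)^-1 in sg0 sgt sb *; rewrite -/(d1 n w) in dn.
have pt (z : 'rV[R]_(s + k) * R) : rho (t * (z.2 - dotv z.1 0)) <=
    rho0 (t * (z.2 - dotv z.1 (d1 n w))) + C * t1 * (eta / (C * t1 * B)) * (l1norm z.1 ^+ 2 + 1).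
  have h1 := smooth_lipschitz S (t * (z.2 - dotv z.1 0)) (t * (z.2 - dotv z.1 (d1 n w))).
  have h3 : `|t * (z.2 - dotv z.1 0) - t * (z.2 - dotv z.1 (d1 n w))| <=
      t1 * (eta / (C * t1 * B)) * (l1norm z.1 ^+ 2 + 1).
    rewrite -mulrBr dotv0 subr0 opprB addrC subrK normrM gtr0_norm// -mulrA.
    apply: ler_pM => //; first exact: ltW.
    apply: (le_trans (dotv_le _ _)); rewrite mulrC; apply: ler_pM => //.
      exact: l1norm_ge0.
    by have := sqr_ge0 (l1norm z.1 - 1); rewrite sqrrB; have := l1norm_ge0 z.1; lra.
  have h4 := ler_wpM2l (ltW CC) h3.
  have := le_trans (ler_norm _) (le_trans h1 h4); rewrite !mulrA => h5.
  by rewrite -lerBlDl; apply: le_trans h5; rewrite lerB.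
have := emp_mean_le W n w pt.
rewrite -/(loss _ _ _ _ _ _) => /le_trans; apply.
rewrite /emp_mean big_split/= mulrDr lerD//.
rewrite -mulr_sumr mulrCA.
rewrite big_split/= sumr_const card_ord [X in _ * X <= _]mulrDr.
have -> : n%:R^-1 * n%:R = 1 :> R by rewrite mulVf// gt_eqF.
apply: (@le_trans _ _ (C * t1 * (eta / (C * t1 * B)) * B)).
  rewrite ler_wpM2l//; first by rewrite !mulr_ge0// ?invr_ge0 ltW// ?mulr_gt0.
  move: mN; rewrite /emp_mean /B ler_norml /= lerBlDr => /andP[_ h].
  by rewrite (_ : 2 = 1 + 1)// addrA lerD2r addrC.
rewrite le_eqVlt; apply/orP; left; apply/eqP; field.
by rewrite !gt_eqF.
Qed.

(** Restates [whp_sparsity] for the estimator itself: the last coordinates of [beta0] are 0, so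
    subtracting [beta0] commutes with truncation. The comparison is asked for only when the scale is
    non-zero, which [scale_whp] guarantees with high probability. *)
Lemma sparse_estimator (est : estimator R (s + k)) (q : R) : 0 < q -> q <= 1 ->
  (forall e, 0 < e -> exists (D : R) (c : nat -> R),
    [/\ 0 <= D, c n / n%:R `^ (q / 2) @[n --> \oo] --> +oo &
    \forall n \near \oo, fails_le P [set w | sg n w != 0 ->
      let z := first_obs x y n w in let bh := est n z in
      mm_loss rho (sg n w) z bh <=
        mm_loss rho (sg n w) z beta0 + D * Num.sqrt n%:R * Num.min 1 `|bh - beta0| /\
      mm_loss rho (sg n w) z bh + c n * \sum_(j < k) `|bh 0 (rshift s j)| `^ q <=
        mm_loss rho (sg n w) z (row_mx (lsubmx bh) 0)] e]) ->
  P [set w | rsubmx (est n (first_obs x y n w)) = 0] @[n --> \oo] --> 1%E.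
Proof.
move=> q0 q1 H.
have [t0 [t1 [t00 t01 wt]]] := scale_whp.
have wt' : whp P (fun n => [set w | t0 <= (sg n w)^-1 <= t1]).
  by apply: whpS wt; apply: nearW => n w [].
have t10 : 0 < t1 := lt_trans t00 t01.
have wL := loss_beta0_whp t10.
have {}wL : forall eta, 0 < eta ->
    whp P (fun n => [set w | loss rho W n (sg n w)^-1 0 w <= n%:R * (b + eta)]).
  apply: wL; apply: whpS wt; apply: nearW => n w [/andP[h1 h2] h3].
  by split => //; rewrite (lt_le_trans t00).
have rE (v : 'rV[R]_(s + k)) : rsubmx (v - beta0) = rsubmx v.
  by apply/rowP => j; rewrite beta0E !mxE (unsplitK (inr j)) mxE subr0.
have sE (v : 'rV[R]_(s + k)) :
    support_part (v - beta0) = row_mx (lsubmx v) 0 - beta0.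
  rewrite /support_part beta0E opp_row_mx add_row_mx subr0; congr (row_mx _ _).
  by apply/rowP => j; rewrite !mxE (unsplitK (inl j)) mxE.
apply: whp_cvg1 => [n|].
  rewrite (_ : [set w | _] =
      [set w | forall j, est n (first_obs x y n w) 0 (rshift s j) = 0]).
    exact: measurable_support.
  apply/seteqP; split => w /=.
    by move=> /rowP h j; have := h j; rewrite !mxE.
  by move=> h; apply/rowP => j; rewrite !mxE.
have h := whp_sparsity fd f_even f_cont f_noninc f_dec0 G2 B2 b_gt0 S mW lawW indW
  (dh := fun n w => est n (first_obs x y n w) - beta0) t00 t01 q0 q1 wt' wL.
apply: whpS (h _); first by apply: nearW => n w /=; rewrite rE.
move=> e e0; have e20 : 0 < e / 2 by rewrite divr_gt0.
have [D [c [D0 cq Hn]]] := H _ e20.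
exists D, c; split => //.
near=> n.
have F1 : fails_le P [set w | t0 <= (sg n w)^-1 <= t1] (e / 2).
  by near: n; exact: wt'.
rewrite [e]splitr; apply: (fails_leS _ (lexx _) (fails_leI F1 (near Hn n _))) => //.
move=> w [/= /andP[h1 _] h2].
have sg0 : sg n w != 0 by rewrite -invr_eq0 gt_eqF// (lt_le_trans t00).
have := h2 sg0; rewrite /= !mm_lossE subrr sE => -[g1 g2]; split => //.
apply: le_trans g2; rewrite lerD2l le_eqVlt; apply/orP; left; apply/eqP.
congr (_ * _); apply: eq_bigr => j _; congr (`|_| `^ _).
by have /rowP/(_ j) := rE (est n (first_obs x y n w)); rewrite mxE [in RHS]mxE.
Unshelve. all: by end_near. Qed.

Let Sum0 q := \sum_j (`|b0 0 j| `^ q + `|b0 0 j| `^ (q - 1)).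

Lemma bridge_sparse (q : R) (lambda : nat -> R) (betaB : estimator R (s + k)) :
  0 < q -> q <= 1 -> (forall n, 0 < lambda n) ->
  (forall n w, let z := first_obs x y n w in
     is_mm_bridge rho0 rho b (lambda n) q z (beta1 n z) (betaB n z)) ->
  lambda =O_\oo (fun n => Num.sqrt (n%:R : R)) ->
  lambda n / n%:R `^ (q / 2) @[n --> \oo] --> +oo ->
  P [set w | rsubmx (betaB n (first_obs x y n w)) = 0] @[n --> \oo] --> 1%E.
Proof.
move=> q0 q1 l0 hB /bigO_bound[K K0 hK] cl.
have A0 : 0 <= Sum0 q by apply: sumr_ge0 => j _; rewrite addr_ge0 ?powR_ge0.
apply: (sparse_estimator q0 q1) => e e0.
exists (K * Sum0 q), lambda; split => //; first by rewrite mulr_ge0// ltW.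
apply: filterS hK => n hn; apply: (fails_leS _ (lexx _) (fails_leT P (ltW e0))).
move=> w _ /= sg0.
have H := hB n w sg0; rewrite -/(sg n w) in H.
pose bh := betaB n (first_obs x y n w).
have one (v : 'rV[R]_(s + k)) :
    \sum_j 1 * `|v 0 j| `^ q = \sum_j `|v 0 j| `^ q.
  by apply: eq_bigr => j _; rewrite mul1r.
have := @bridge_comparison R s k (mm_loss rho (sg n w) (first_obs x y n w)) b0 bh
  (fun=> 1) (lambda n) q 1 1 (l0 n) q0 q1 b0_neq0.
rewrite !one ler01 lexx mulr1 mul1r -beta0E => h.
have [|j|||h1 h2] := h _ _ isT; rewrite ?mul1r//; try exact: H.
split => //; apply: (le_trans h1); rewrite lerD2l.
have m0 : 0 <= Num.min 1 `|bh - beta0| by rewrite le_min ler01 normr_ge0.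
apply: (ler_wpM2r m0); rewrite mulrAC ler_wpM2r// (le_trans (ler_norm _))// (le_trans hn)//.
by rewrite ger0_norm// sqrtr_ge0.
Qed.

Lemma adaptive_sparse (t vs : R) (iota : nat -> R)
    (beta2 betaA : estimator R (s + k)) :
  0 < t -> t <= 1 -> 0 < vs -> (forall n, 0 < iota n) ->
  sqrtn_consistent P (fun n w => beta2 n (first_obs x y n w)) beta0 ->
  (forall n w, let z := first_obs x y n w in
     is_adaptive_mm_bridge rho0 rho b (iota n) t vs z
       (beta1 n z) (beta2 n z) (betaA n z)) ->
  iota =O_\oo (fun n => Num.sqrt (n%:R : R)) ->
  iota n * n%:R `^ ((vs - t) / 2) @[n --> \oo] --> +oo ->
  P [set w | rsubmx (betaA n (first_obs x y n w)) = 0] @[n --> \oo] --> 1%E.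
Proof.
move=> t0 t1 vs0 i0 cons hA /bigO_bound[K K0 hK] cl.
have A0 : 0 <= Sum0 t by apply: sumr_ge0 => j _; rewrite addr_ge0 ?powR_ge0.
(* Once the preliminary estimate is within half of each non-zero coefficient, every weight on the
   support is at most one of these terms, hence at most their sum. *)
pose Om := \sum_j ((`|b0 0 j| / 2) `^ vs)^-1.
have Om0 : 0 <= Om by apply: sumr_ge0 => j _; rewrite invr_ge0 powR_ge0.
have OmE j : ((`|b0 0 j| / 2) `^ vs)^-1 <= Om.
  by rewrite /Om (bigD1 j)//= lerDl sumr_ge0// => l _; rewrite invr_ge0 powR_ge0.
apply: (sparse_estimator t0 t1) => e e0.
have [B B0 hB] := sqrtn_consistent_fails_le cons e0.
(* Dividing this penalty factor by [n ^ (t / 2)] leaves [iota n * n ^ ((vs - t) / 2)] times the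
   constant [B ^ (- vs)], so it diverges by assumption. *)
exists (K * (Om * Sum0 t)), (fun n => iota n * ((B / Num.sqrt n%:R) `^ vs)^-1); split.
- by rewrite !mulr_ge0// ltW.
- have Bv : 0 < (B `^ vs)^-1 by rewrite invr_gt0 powR_gt0.
  apply/cvgryPge => A; near=> n.
  have n0 : 0 < n%:R :> R by rewrite ltr0n; near: n; exists 1%N.
  have : A * B `^ vs <= iota n * n%:R `^ ((vs - t) / 2).
    by near: n; exact: ((cvgryPge _).1 cl).
  rewrite -ler_pdivlMr ?powR_gt0// => /le_trans; apply.
  rewrite le_eqVlt; apply/orP; left; apply/eqP.
  have -> : (B / Num.sqrt n%:R) `^ vs = B `^ vs * n%:R `^ (- (vs / 2)).
    rewrite powRM ?invr_ge0 ?sqrtr_ge0 ?(ltW B0)// -powR12_sqrt ?(ltW n0)//.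
    by rewrite -[(n%:R `^ _)^-1]powRN -powRrM; congr (_ * _ `^ _); field.
  rewrite invfM -[(n%:R `^ - _)^-1]powRN opprK -!mulrA; congr (_ * _).
  rewrite mulrC; congr (_ * _).
  rewrite -[(n%:R `^ (t / 2))^-1]powRN -powRD; last by rewrite (gt_eqF n0) implybT.
  by congr (_ `^ _); field.
have Bsmall : \forall n \near \oo, forall j, B / Num.sqrt n%:R <= `|b0 0 j| / 2.
  have [S1 S10 hS1] : exists2 S1 : R, 0 < S1 & forall j, S1 <= `|b0 0 j| / 2.
    (* Starting the minimum at 1 keeps it positive also when [s] is 0. *)
    exists (\big[Num.min/1]_j (`|b0 0 j| / 2)).
      apply: (big_ind (fun x => 0 < x)) => // [z1 z2 h1 h2|j _].
        by rewrite lt_min h1.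
      by rewrite divr_gt0// normr_gt0.
    by move=> j; rewrite (bigD1 j)//= ge_min lexx.
  have := @sqrt_nat_ge R (B / S1); apply: filter_app; exists 1%N => // n n0 /= h j.
  apply: le_trans (hS1 j).
  rewrite ler_pdivrMr ?sqrtr_gt0 ?ltr0n//.
  by rewrite mulrC -ler_pdivrMr.
near=> n.
have n0 : (0 < n)%N by near: n; exists 1%N.
have hn : `|iota n| <= K * `|Num.sqrt (n%:R : R)| by near: n.
have bn : forall j, B / Num.sqrt n%:R <= `|b0 0 j| / 2 by near: n.
have Bn0 : 0 < B / Num.sqrt n%:R by rewrite divr_gt0// sqrtr_gt0 ltr0n.
apply: (fails_leS _ (lexx _) (near hB n _)) => //= w cw sg0.
have H := hA n w sg0; rewrite -/(sg n w) in H.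
pose b2 := beta2 n (first_obs x y n w).
pose bh := betaA n (first_obs x y n w).
have b2I j : `|b0 0 j| / 2 <= `|b2 0 (lshift k j)|.
  have := le_trans (cw (lshift k j)) (bn j).
  rewrite beta0E !mxE (unsplitK (inl j)) -/b2.
  have := lerB_dist (b0 0 j) (b2 0 (lshift k j)); rewrite distrC.
  set A := `|b0 0 j|; set A2 := `|b2 0 _|; set A3 := `|_ - _|; lra.
have b2I_neq0 j : b2 0 (lshift k j) != 0.
  by rewrite -normr_gt0 (lt_le_trans _ (b2I j))// divr_gt0// normr_gt0.
have b2II j : `|b2 0 (rshift s j)| <= B / Num.sqrt n%:R.
  have := cw (rshift s j).
  by rewrite beta0E !mxE (unsplitK (inr j)) mxE subr0.
have beta0_supp j : b2 0 j = 0 -> beta0 0 j = 0.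
  rewrite beta0E mxE; case: split_ordP => l ->; last by rewrite mxE.
  by move/eqP; rewrite (negbTE (b2I_neq0 l)).
have [bh0 H1] := adaptive_finite (i0 n) t0 vs0 beta0_supp (H beta0).
have sub_supp j : b2 0 j = 0 -> (row_mx (lsubmx bh) 0 : 'rV_(s + k)) 0 j = 0.
  rewrite mxE; case: split_ordP => l ->; last by rewrite mxE.
  by move/eqP; rewrite (negbTE (b2I_neq0 l)).
have [_ H2] := adaptive_finite (i0 n) t0 vs0 sub_supp (H (row_mx (lsubmx bh) 0)).
have omL j : 0 <= (`|b2 0 (lshift k j)| `^ vs)^-1 <= Om.
  rewrite invr_ge0 powR_ge0/= (le_trans _ (OmE j))//.
  rewrite lef_pV2 ?posrE ?powR_gt0 ?normr_gt0//; last by rewrite divr_gt0// normr_gt0.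
  by rewrite ge0_ler_powR ?nnegrE// ?(ltW vs0)// divr_ge0.
have omR j : ((B / Num.sqrt n%:R) `^ vs)^-1 * `|bh 0 (rshift s j)| `^ t <=
    (`|b2 0 (rshift s j)| `^ vs)^-1 * `|bh 0 (rshift s j)| `^ t.
  have [z|z] := eqVneq (b2 0 (rshift s j)) 0.
    by rewrite bh0// normr0 (powR0 (lt0r_neq0 t0)) !mulr0.
  rewrite ler_wpM2r ?powR_ge0//.
  rewrite lef_pV2 ?posrE ?powR_gt0 ?normr_gt0//.
  by rewrite ge0_ler_powR ?nnegrE// ?(ltW vs0)// ltW.
have wm0 : 0 <= ((B / Num.sqrt n%:R) `^ vs)^-1 by rewrite invr_ge0 powR_ge0.
have := bridge_comparison (L := mm_loss rho (sg n w) (first_obs x y n w))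
  (om := fun j => (`|b2 0 j| `^ vs)^-1) (i0 n) t0 t1 b0_neq0 omL omR wm0.
rewrite -beta0E => /(_ H1 H2) [h1 h2].
split; last exact: h2.
apply: (le_trans h1); rewrite lerD2l.
have m0 : 0 <= Num.min 1 `|bh - beta0| by rewrite le_min ler01 normr_ge0.
apply: (ler_wpM2r m0); rewrite mulrAC ler_wpM2r ?mulr_ge0//.
rewrite (le_trans (ler_norm _))// (le_trans hn)//.
by rewrite ger0_norm// sqrtr_ge0.
Unshelve. all: by end_near. Qed.
End mm_estimators.

Unset Implicit Arguments.
Set Strict Implicit.
Set Printing Implicit Defensive.

Theorem theorem5 (R : realType) (s k : nat)
  (d : measure_display) (T : measurableType d) (P : probability T R)
  (x : nat -> {RV P >-> 'rV[R]_(s + k)}) (y u : nat -> {RV P >-> R})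
  (G0 : probability 'rV[R]_(s + k) R) (F0 : probability R R)
  (beta0 : 'rV[R]_(s + k)) (beta0I : 'rV[R]_s)
  (rho0 rho1 : R -> R) (b : R) (f0 : R -> R)
  (q t vs : R) (lambda iota : nat -> R)
  (beta1 beta2 betaB betaA : estimator R (s + k))
  (model : forall i w, y i w = dotv (x i w) beta0 + u i w)
  (obs_iid : iid P (fun i w => (x i w, y i w)))
  (law_x : forall i, has_law P (x i) G0)
  (law_u : forall i, has_law P (u i) F0)
  (indep_ux : forall i, independent2 P (u i) (x i))
  (beta0E : beta0 = row_mx beta0I 0)
  (beta0I_neq0 : forall j, beta0I 0 j != 0)
  (rho0_bounded : bounded_rho rho0)
  (rho1_bounded : bounded_rho rho1)
  (rho1_le : forall v, rho1 v <= rho0 v)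
  (b_gt0 : 0 < b) (b_lt1 : b < 1)
  (B1 : [/\ twice_cont_diff rho0, eventually_constant rho0,
            twice_cont_diff rho1 & eventually_constant rho1])
  (B2 : forall beta : 'rV[R]_(s + k), beta != 0 ->
     (G0 [set v | dotv v beta = 0%R] < (1 - b)%:E)%E)
  (B3 : [/\ has_density F0 f0, even_fun f0, continuous f0,
            abs_nonincreasing f0 & abs_decreasing_near0 f0])
  (B4 : (forall j, G0.-integrable setT (fun v => (v 0 j ^+ 2)%:E)) /\
        second_moment_mx G0 \in unitmx)
  (q_gt0 : 0 < q) (t_gt0 : 0 < t) (vs_gt0 : 0 < vs)
  (lambda_gt0 : forall n, 0 < lambda n) (iota_gt0 : forall n, 0 < iota n)
  (beta1_consistent :
     consistent P (fun n w => beta1 n (first_obs x y n w)) beta0)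
  (beta2_sqrtn_consistent :
     sqrtn_consistent P (fun n w => beta2 n (first_obs x y n w)) beta0)
  (betaB_mm_bridge : forall n w, let z := first_obs x y n w in
     is_mm_bridge rho0 rho1 b (lambda n) q z (beta1 n z) (betaB n z))
  (betaA_mm_bridge : forall n w, let z := first_obs x y n w in
     is_adaptive_mm_bridge rho0 rho1 b (iota n) t vs z
       (beta1 n z) (beta2 n z) (betaA n z)) :
  (q < 1 ->
   lambda =O_\oo (fun n => Num.sqrt (n%:R : R)) ->
   lambda n / n%:R `^ (q / 2) @[n --> \oo] --> +oo ->
   P [set w | rsubmx (betaB n (first_obs x y n w)) = 0] @[n --> \oo] --> 1%E)
  /\
  (t <= 1 ->
   iota =O_\oo (fun n => Num.sqrt (n%:R : R)) ->
   iota n * n%:R `^ ((vs - t) / 2) @[n --> \oo] --> +oo ->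
   P [set w | rsubmx (betaA n (first_obs x y n w)) = 0] @[n --> \oo] --> 1%E).
Proof.
have [f_dens f_even f_cont f_noninc f_dec0] := B3.
have [rho0_diff rho0_const rho1_diff rho1_const] := B1.
have [G2 _] := B4.
have [M0 [C0 S0]] := smooth_rho_exists rho0_bounded rho0_diff rho0_const.
have [M1 [C1 S1]] := smooth_rho_exists rho1_bounded rho1_diff rho1_const.
split=> [q_lt1|t_le1].
- exact: (bridge_sparse model obs_iid law_x law_u indep_ux beta0E beta0I_neq0 b_gt0
    b_lt1 B2 f_dens f_even f_cont f_noninc f_dec0 G2 S0 S1 rho1_le beta1_consistent
    q_gt0 (ltW q_lt1) lambda_gt0 betaB_mm_bridge).
- exact: (adaptive_sparse model obs_iid law_x law_u indep_ux beta0E beta0I_neq0 b_gt0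
    b_lt1 B2 f_dens f_even f_cont f_noninc f_dec0 G2 S0 S1 rho1_le beta1_consistent
    t_gt0 t_le1 vs_gt0 iota_gt0 beta2_sqrtn_consistent betaA_mm_bridge).
Qed.
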